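(* Let $\alpha\in\Sigma$. For $u\in(U_\alpha)_{\mathbb{F}}$ we have $$\{p\in\mathbb{A}:u.p\in\mathbb{A}\}=\{a.o\in\mathbb{A}:\varphi_\alpha(u)\le(-v)(\chi_\alpha(a))\},$$ and therefore this set is a half-apartment (with a wall parallel to the wall defined by $(-v)(\chi_\alpha)=0$) when $u\ne\operatorname{Id}$.
   Context: Let $\mathbb{K},\mathbb{F}$ be real closed fields with $\mathbb{K}\subseteq\mathbb{R}\cap\mathbb{F}$. Let $O\subsetneq\mathbb{F}$ be an order convex subring ($a,b\in O$ and $a\le c\le b$ imply $c\in O$); it is a valuation ring. Let $\Lambda=\mathbb{F}^\times/O^\times$, written additively (a $\mathbb{Q}$-vector space), and let $v:\mathbb{F}\to\Lambda\cup\{\infty\}$ be the associated valuation, with $\Lambda$ ordered so that $(-v)(a)\ge(-v)(b)$ whenever $a\ge b>0$; thus $O=\{a:(-v)(a)\le 0\}$ and $(-v)(0)=-\infty$. For a semialgebraic set $V$ defined over $\mathbb{K}$, $V_{\mathbb{F}}$ denotes its $\mathbb{F}$-extension. $G<\operatorname{SL}_n$ is a connected semisimple algebraic group over $\mathbb{K}$, self-adjoint ($g\in G$ implies $g^{\mathsf T}\in G$). $S<G$ is a maximal $\mathbb{K}$-split torus with $s=s^{\mathsf T}$ for all $s\in S$; $A_{\mathbb{F}}$ is the $\mathbb{F}$-extension of the semialgebraic connected component of $S_{\mathbb{K}}$ containing $\operatorname{Id}$; $K_{\mathbb{F}}=G_{\mathbb{F}}\cap\operatorname{SO}_n(\mathbb{F})$.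 Let $\mathfrak{g}=\operatorname{Lie}(G_{\mathbb{R}})\subseteq\mathbb{R}^{n\times n}$, $\mathfrak{a}=\operatorname{Lie}(A_{\mathbb{R}})$; $\Sigma\subseteq\mathfrak{a}^\star$ is the (possibly non-reduced) root system of $\mathfrak{g}$ with respect to $\mathfrak{a}$, with root spaces $\mathfrak{g}_\alpha$ ($\mathfrak{g}_{2\alpha}=0$ if $2\alpha\notin\Sigma$). For $\alpha\in\Sigma$, $\chi_\alpha:A_{\mathbb{F}}\to\mathbb{F}_{>0}$ is the restriction of the algebraic character of $S$ over $\mathbb{K}$ which over $\mathbb{R}$ satisfies $\chi_\alpha(\exp H)=e^{\alpha(H)}$, $H\in\mathfrak{a}$. Fix a basis $\Delta$ of $\Sigma$; let $A^+_{\mathbb{F}}=\{a\in A_{\mathbb{F}}:\chi_\alpha(a)\ge1\ \forall\alpha\in\Delta\}$. Root groups: $(U_\alpha)_{\mathbb{F}}=\exp((\mathfrak{g}_\alpha)_{\mathbb{F}}\oplus(\mathfrak{g}_{2\alpha})_{\mathbb{F}})$. Root group valuation: $\varphi_\alpha:(U_\alpha)_{\mathbb{F}}\to\Lambda\cup\{-\infty\}$, $\varphi_\alpha(\exp(X+X'))=\max\{\max_{i,j}(-v)(X_{ij}),\ \tfrac12\max_{i,j}(-v)(X'_{ij})\}$ for $X\in(\mathfrak{g}_\alpha)_{\mathbb{F}}$, $X'\in(\mathfrak{g}_{2\alpha})_{\mathbb{F}}$. $G_{\mathbb{F}}$ acts on symmetric positive definite matrices of determinant $1$ over $\mathbb{F}$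 by $g.x=gxg^{\mathsf T}$, and $\mathcal{X}_{\mathbb{F}}=G_{\mathbb{F}}.\operatorname{Id}$. For $x=g.\operatorname{Id}$, $y=h.\operatorname{Id}$, $\delta_{\mathbb{F}}(x,y)$ is the unique $a\in A^+_{\mathbb{F}}$ with $g^{-1}h\in K_{\mathbb{F}}aK_{\mathbb{F}}$. For $a\in A_{\mathbb{F}}$, $N_{\mathbb{F}}(a)=\prod_{\alpha\in\Sigma}\max\{\chi_\alpha(a),\chi_\alpha(a)^{-1}\}$, and $d(x,y)=(-v)(N_{\mathbb{F}}(\delta_{\mathbb{F}}(x,y)))\in\Lambda$, a $G_{\mathbb{F}}$-invariant pseudo-distance. $\mathcal{B}=\mathcal{X}_{\mathbb{F}}/\!\sim$ with $x\sim y$ iff $d(x,y)=0$, with the induced $G_{\mathbb{F}}$-action; $o\in\mathcal{B}$ is the class of $\operatorname{Id}$; $\mathbb{A}=A_{\mathbb{F}}.o\subseteq\mathcal{B}$. Half-apartments of $\mathbb{A}$ are the sets $\{a.o\in\mathbb{A}:(-v)(\chi_\beta(a))\ge\ell\}$ with $\beta\in\Sigma$, $\ell\in\Lambda$; its wall is $\{a.o:(-v)(\chi_\beta(a))=\ell\}$. *)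

(* Defs.v *)
From HB Require Import structures.
From mathcomp Require Import all_boot all_order all_algebra.
From mathcomp Require Import all_classical all_reals all_analysis.
From mathcomp Require Import complex.
From mathcomp Require mpoly.

Set Implicit Arguments.
Unset Strict Implicit.
Unset Printing Implicit Defensive.

Import Order.TTheory GRing.Theory Num.Theory.
Import numFieldNormedType.Exports.

Local Open Scope classical_set_scope.
Local Open Scope ring_scope.
Local Open Scope quotient_scope.

Record convexSubring (F : rcfType) := ConvexSubring {
  csub :> {pred F};
  csub_subring : subring_closed csub;
  csub_convex : forall a b c, a \in csub -> b \in csub -> a <= c <= b -> c \in csub;
  csub_proper : exists a, a \notin csub
}.

Section ValueGroup.
Variables (F : rcfType) (O : convexSubring F).

Definition nonzero : Type := {x : F | x != 0}.
HB.instance Definition _ := Choice.on nonzero.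

Implicit Types x y z : nonzero.

Lemma csub1 : 1 \in csub O.
Proof. by case: (csub_subring O). Qed.

Lemma csubM : {in csub O &, forall a b, a * b \in csub O}.
Proof. by case: (csub_subring O). Qed.

Lemma csubB : {in csub O &, forall a b, a - b \in csub O}.
Proof. by case: (csub_subring O). Qed.

Lemma csub0 : 0 \in csub O.
Proof. by rewrite -(subrr 1) csubB ?csub1. Qed.

Lemma csubN a : a \in csub O -> - a \in csub O.
Proof. by move=> aO; rewrite -sub0r csubB ?csub0. Qed.

Lemma csub_norm a b : b \in csub O -> `|a| <= `|b| -> a \in csub O.
Proof.
move=> bO; have nbO : `|b| \in csub O.
  by case: (ger0P b) => // _; apply: csubN.
by rewrite ler_norml; apply: csub_convex => //; apply: csubN.
Qed.

Definition assoc_rel x y := (val x / val y \in csub O) && (val y / val x \in csub O).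

Lemma csub_div_trans x y z :
  val x / val y \in csub O -> val y / val z \in csub O -> val x / val z \in csub O.
Proof.
move=> xy yz; have := csubM xy yz.
by rewrite mulrA mulfVK ?(valP y).
Qed.

Lemma assoc_refl : reflexive assoc_rel.
Proof. by move=> x; rewrite /assoc_rel divff ?(valP x)// csub1. Qed.

Lemma assoc_sym : symmetric assoc_rel.
Proof. by move=> x y; rewrite /assoc_rel andbC. Qed.

Lemma assoc_trans : transitive assoc_rel.
Proof.
move=> y x z /andP[xy yx] /andP[yz zy]; apply/andP; split.
  exact: csub_div_trans xy yz.
exact: csub_div_trans zy yx.
Qed.

Canonical assoc_equiv := EquivRel assoc_rel assoc_refl assoc_sym assoc_trans.

(* The quotient group F^* / O^*, written additively. Two nonzero elements are
   identified when their ratio and its inverse both lie in O. *)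
Definition Lambda : Type := {eq_quot assoc_equiv}.
HB.instance Definition _ := Choice.on Lambda.
HB.instance Definition _ := EqQuotient.on Lambda.

Definition nz_one : nonzero := Sub (1 : F) (oner_neq0 F).
Definition nz_mul x y : nonzero :=
  Sub (val x * val y) (mulf_neq0 (valP x) (valP y)).
Lemma nz_inv_subproof x : (val x)^-1 != 0.
Proof. by rewrite invr_neq0 ?(valP x). Qed.
Definition nz_inv x : nonzero := Sub (val x)^-1 (nz_inv_subproof x).
Lemma nz_sqrt_subproof x : Num.sqrt `|val x| != 0.
Proof. by rewrite sqrtr_eq0 -ltNge normr_gt0 (valP x). Qed.
Definition nz_sqrt x : nonzero := Sub (Num.sqrt `|val x|) (nz_sqrt_subproof x).

Lemma val_nz_mul x y : val (nz_mul x y) = val x * val y.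
Proof. by []. Qed.
Lemma val_nz_inv x : val (nz_inv x) = (val x)^-1.
Proof. by []. Qed.
Lemma val_nz_sqrt x : val (nz_sqrt x) = Num.sqrt `|val x|.
Proof. by []. Qed.

Definition vclass x : Lambda := \pi_Lambda x.

Lemma vclassP x y : reflect (vclass x = vclass y) (assoc_rel x y).
Proof. by apply: (iffP idP) => [h|/eqmodP]//; apply/eqmodP. Qed.

Lemma vclass_repr (l : Lambda) : vclass (repr l) = l.
Proof. exact: reprK. Qed.

Lemma assoc_repr x : assoc_rel (repr (vclass x)) x.
Proof. by apply/vclassP; rewrite vclass_repr. Qed.

Definition Ladd (l m : Lambda) := vclass (nz_mul (repr l) (repr m)).
Definition Lopp (l : Lambda) := vclass (nz_inv (repr l)).
Definition Lzero : Lambda := vclass nz_one.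

(* Lambda carries the order for which O is the set where v >= 0; thus -v is
   nondecreasing on positive elements, see negv_le0 and negv_homo. *)
Definition Lle (l m : Lambda) := val (repr m) / val (repr l) \in csub O.

(* Halving in the Q-vector space Lambda; see Lhalf_double. *)
Definition Lhalf (l : Lambda) := vclass (nz_sqrt (repr l)).

Lemma LaddE x y : Ladd (vclass x) (vclass y) = vclass (nz_mul x y).
Proof.
apply/vclassP; have /andP[x1 x2] := assoc_repr x; have /andP[y1 y2] := assoc_repr y.
by rewrite /assoc_rel !val_nz_mul -!mulf_div; apply/andP; split; apply: csubM.
Qed.

Lemma LoppE x : Lopp (vclass x) = vclass (nz_inv x).
Proof.
apply/vclassP; have /andP[x1 x2] := assoc_repr x.
rewrite /assoc_rel !val_nz_inv !invrK.
by rewrite (mulrC _ (val x)) (mulrC _ (val (repr _))) x1 x2.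
Qed.

Lemma LleE x y : Lle (vclass x) (vclass y) = (val y / val x \in csub O).
Proof.
have /andP[x1 x2] := assoc_repr x; have /andP[y1 y2] := assoc_repr y.
apply/idP/idP => h.
  exact: csub_div_trans (csub_div_trans y2 h) x1.
exact: csub_div_trans (csub_div_trans y1 h) x2.
Qed.

Lemma LaddA : associative Ladd.
Proof.
move=> l m n; rewrite -(vclass_repr l) -(vclass_repr m) -(vclass_repr n) !LaddE.
by congr vclass; apply: val_inj; rewrite !val_nz_mul mulrA.
Qed.

Lemma LaddC : commutative Ladd.
Proof.
move=> l m; rewrite -(vclass_repr l) -(vclass_repr m) !LaddE.
by congr vclass; apply: val_inj; rewrite !val_nz_mul mulrC.
Qed.

Lemma Ladd0 : left_id Lzero Ladd.
Proof.
move=> l; rewrite -(vclass_repr l) LaddE.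
by congr vclass; apply: val_inj; rewrite val_nz_mul mul1r.
Qed.

Lemma LaddN : left_inverse Lzero Lopp Ladd.
Proof.
move=> l; rewrite -(vclass_repr l) LoppE LaddE.
by congr vclass; apply: val_inj; rewrite val_nz_mul val_nz_inv mulVf ?(valP (repr l)).
Qed.

HB.instance Definition _ := GRing.isZmodule.Build Lambda LaddA LaddC Ladd0 LaddN.

Lemma Lle_refl : reflexive Lle.
Proof. by move=> l; rewrite /Lle divff ?(valP (repr l))// csub1. Qed.

Lemma Lle_anti : antisymmetric Lle.
Proof.
move=> l m /andP[lm ml]; rewrite -(vclass_repr l) -(vclass_repr m).
by apply/vclassP; rewrite /assoc_rel -/(Lle m l) -/(Lle l m) lm ml.
Qed.

Lemma Lle_trans : transitive Lle.
Proof. by move=> m l n lm mn; apply: csub_div_trans mn lm. Qed.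

HB.instance Definition _ :=
  Order.Le_isPOrder.Build ring_display Lambda Lle_refl Lle_anti Lle_trans.

Lemma Lle_total : total Lle.
Proof.
move=> l m; have := le_total `|val (repr m)| `|val (repr l)|.
rewrite /Lle => /orP[h|h]; apply/orP; [left|right];
  by apply: (csub_norm csub1); rewrite normr1 normf_div ler_pdivrMr ?mul1r
    ?normr_gt0 ?(valP (repr l)) ?(valP (repr m)).
Qed.

HB.instance Definition _ := Order.POrder_isTotal.Build ring_display Lambda Lle_total.

Lemma Lhalf_double (l : Lambda) : Lhalf l + Lhalf l = l.
Proof.
rewrite -[RHS]vclass_repr; rewrite [LHS]LaddE; apply/vclassP.
set x := repr l; rewrite /assoc_rel val_nz_mul val_nz_sqrt -expr2 sqr_sqrtr ?normr_ge0//.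
have x0 : `|val x| != 0 by rewrite normr_eq0 (valP x).
by apply/andP; split; apply: (csub_norm csub1);
  rewrite normr1 normf_div normr_id divff.
Qed.

End ValueGroup.

(* The bottom element None plays the role of -oo. *)
Definition withBot (T : Type) : Type := option T.
Definition Fin (T : Type) (x : T) : withBot T := Some x.

Section WithBot.
Variables (d : Order.disp_t) (T : orderType d).
HB.instance Definition _ := Choice.on (withBot T).

Definition wb_le (x y : withBot T) : bool :=
  match x, y with
  | None, _ => true
  | Some _, None => false
  | Some a, Some b => (a <= b)%O
  end.

Lemma wb_le_refl : reflexive wb_le.
Proof. by case=> //= a; exact: lexx. Qed.
Lemma wb_le_anti : antisymmetric wb_le.
Proof. by move=> [a|] [b|] //= /le_anti ->. Qed.
Lemma wb_le_trans : transitive wb_le.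
Proof. by move=> [a|] [b|] [c|] //=; exact: le_trans. Qed.
Lemma wb_le_total : total wb_le.
Proof. by move=> [a|] [b|] //=; exact: le_total. Qed.
Lemma wb_le0x (x : withBot T) : wb_le None x.
Proof. by []. Qed.

HB.instance Definition _ :=
  Order.Le_isPOrder.Build d (withBot T) wb_le_refl wb_le_anti wb_le_trans.
HB.instance Definition _ := Order.POrder_isTotal.Build d (withBot T) wb_le_total.
HB.instance Definition _ := Order.hasBottom.Build d (withBot T) wb_le0x.
End WithBot.

Section NegValuation.
Variables (F : rcfType) (O : convexSubring F).

(* The map -v, with values in Lambda extended by -oo. *)
Definition negv (a : F) : withBot (Lambda O) :=
  if insub a is Some x then Fin (- vclass O x) else None.

Definition whalf (l : withBot (Lambda O)) : withBot (Lambda O) := omap (@Lhalf F O) l.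

Lemma negv0 : negv 0 = None.
Proof. by rewrite /negv insubF ?eqxx. Qed.

Lemma negv_le0 a : (negv a <= Fin (0 : Lambda O))%O = (a \in csub O).
Proof.
rewrite /negv; case: insubP => [x _ <-|]; last first.
  by rewrite negbK => /eqP ->; rewrite csub0.
have -> : (Fin (- vclass O x) <= Fin (0 : Lambda O))%O =
  Lle (Lopp (vclass O x)) (Lzero O) by [].
by rewrite LoppE LleE val_nz_inv invrK mul1r.
Qed.

Lemma negv_homo a b : 0 < b -> b <= a -> (negv b <= negv a)%O.
Proof.
move=> b0 ba; have a0 : 0 < a := lt_le_trans b0 ba.
rewrite /negv; case: insubP => [x _ xE|]; last by rewrite gt_eqF.
case: insubP => [y _ yE|]; last by rewrite gt_eqF.
have -> : (Fin (- vclass O x) <= Fin (- vclass O y))%O =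
  Lle (Lopp (vclass O x)) (Lopp (vclass O y)) by [].
rewrite !LoppE LleE !val_nz_inv invrK xE yE.
apply: (csub_norm (csub1 O)); rewrite normr1 mulrC normf_div !gtr0_norm//.
by rewrite ler_pdivrMr ?mul1r.
Qed.
End NegValuation.

(* Polynomials in the n^2 matrix entries, the entries being numbered by mxvec. *)
Notation mxpol n K := (mpoly.mpoly (n * n) K).

Section Sets.
Variables (K : fieldType) (n : nat).

Definition mxeval (L : fieldType) (i : {rmorphism K -> L}) (p : mxpol n K)
  (x : 'M[L]_n) : L := mpoly.mmap i (fun k => mxvec x ord0 k) p.

(* The L-points of the algebraic set cut out by a set of equations over K. *)
Definition zeros (L : fieldType) (i : {rmorphism K -> L}) (I : set (mxpol n K))
  : set 'M[L]_n := [set x | forall p, I p -> mxeval i p x = 0].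

Definition zariski_closed (Z : set 'M[K]_n) :=
  exists I, Z = zeros (idfun : {rmorphism K -> K}) I.

Definition zariski_connected (Z : set 'M[K]_n) :=
  forall Z1 Z2, zariski_closed Z1 -> zariski_closed Z2 ->
    Z = Z1 `|` Z2 -> Z1 `&` Z2 = set0 -> Z1 = set0 \/ Z2 = set0.

Definition mx_subgroup (H : set 'M[K]_n) :=
  [/\ H 1%:M,
      forall g, H g -> g \in unitmx,
      forall g h, H g -> H h -> H (g *m h) &
      forall g, H g -> H (invmx g)].

Definition mx_derived (H : set 'M[K]_n) : set 'M[K]_n :=
  \bigcap_(L in [set L | mx_subgroup L /\
      forall g h, H g -> H h -> L (g *m h *m invmx g *m invmx h)]) L.

Definition mx_solvable (H : set 'M[K]_n) :=
  exists k, iter k mx_derived H = [set 1%:M].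

(* The radical of G is trivial (to be used over an algebraically closed field). *)
Definition trivial_radical (G : set 'M[K]_n) :=
  forall H, zariski_closed H -> zariski_connected H -> mx_subgroup H ->
    H `<=` G -> (forall g h, G g -> H h -> H (g *m h *m invmx g)) ->
    mx_solvable H -> H = [set 1%:M].

End Sets.

Section AlgebraicGroups.
Variables (K : rcfType) (n : nat).
Implicit Types G S T : set (mxpol n K).

(* Points over the algebraic closure K[i] of K. *)
Definition geom_points G : set 'M[K[i]%C]_n := zeros (real_complex K) G.

Definition alg_subgroup_SL G :=
  mx_subgroup (geom_points G) /\ geom_points G `<=` [set g | \det g = 1].

Definition connected_semisimple G :=
  [/\ alg_subgroup_SL G, zariski_connected (geom_points G) &
      trivial_radical (geom_points G)].

Definition self_adjoint G := forall g, geom_points G g -> geom_points G g^T.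

Definition diagonalizable_over_K S :=
  exists2 P : 'M[K]_n, P \in unitmx &
    forall s, geom_points S s ->
      is_diag_mx (map_mx (real_complex K) P *m s *m
                  invmx (map_mx (real_complex K) P)).

(* A K-split torus in SL_n: a connected algebraic subgroup that can be put in
   diagonal form by a base change over K. *)
Definition split_torus S :=
  [/\ alg_subgroup_SL S, zariski_connected (geom_points S) &
      diagonalizable_over_K S].

Definition maximal_split_torus G S :=
  [/\ split_torus S, geom_points S `<=` geom_points G &
      forall T, split_torus T -> geom_points T `<=` geom_points G ->
        geom_points S `<=` geom_points T -> geom_points T = geom_points S].

(* As S is closed in M_n, a regular function on S over K is the restriction of
   a polynomial over K; p is a character when it is a morphism to G_m. *)
Definition alg_character S (p : mxpol n K) :=
  let chi := mxeval (real_complex K) p in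
  (forall s, geom_points S s -> chi s != 0) /\
  (forall s t, geom_points S s -> geom_points S t -> chi (s *m t) = chi s * chi t).

End AlgebraicGroups.

Section Semialgebraic.
Variables (K : rcfType) (n : nat).

Inductive sa_formula :=
  | SaPos of mxpol n K
  | SaNot of sa_formula
  | SaAnd of sa_formula & sa_formula.

Fixpoint sa_holds (L : rcfType) (i : {rmorphism K -> L}) (f : sa_formula)
    (x : 'M[L]_n) : bool :=
  match f with
  | SaPos p => 0 < mxeval i p x
  | SaNot f => ~~ sa_holds i f x
  | SaAnd f g => sa_holds i f x && sa_holds i g x
  end.

Definition sa_set (L : rcfType) (i : {rmorphism K -> L}) (f : sa_formula)
  : set 'M[L]_n := [set x | sa_holds i f x].

(* The L2-extension of a semialgebraic subset V of M_n(L1) that is defined over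
   K. By Tarski-Seidenberg it does not depend on the formula defining V; for a
   V not definable over K it takes the junk value set0. *)
Definition sa_extension (L1 L2 : rcfType) (i1 : {rmorphism K -> L1})
    (i2 : {rmorphism K -> L2}) (V : set 'M[L1]_n) : set 'M[L2]_n :=
  [set x | exists2 f, V = sa_set i1 f & sa_set i2 f x].

Definition semialgebraic (V : set 'M[K]_n) :=
  exists f, V = sa_set (idfun : {rmorphism K -> K}) f.

Definition closed_in (V Z : set 'M[K]_n) := Z `<=` V /\ closure Z `&` V `<=` Z.

Definition sa_connected (V : set 'M[K]_n) :=
  forall Z1 Z2, semialgebraic Z1 -> semialgebraic Z2 ->
    closed_in V Z1 -> closed_in V Z2 ->
    V = Z1 `|` Z2 -> Z1 `&` Z2 = set0 -> Z1 = V \/ Z2 = V.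

Definition sa_component (V : set 'M[K]_n) (x : 'M[K]_n) : set 'M[K]_n :=
  \bigcup_(C in [set C | [/\ semialgebraic C, sa_connected C, C x & C `<=` V]]) C.

Definition torus_component (S : set (mxpol n K)) : set 'M[K]_n :=
  sa_component (zeros (idfun : {rmorphism K -> K}) S) 1%:M.

Definition torus_component_ext (S : set (mxpol n K)) (L : rcfType)
    (i : {rmorphism K -> L}) : set 'M[L]_n :=
  sa_extension (idfun : {rmorphism K -> K}) i (torus_component S).

End Semialgebraic.

Section Lie.
Variables (R : realType) (n : nat).

Definition mx_exp (X : 'M[R]_n) : 'M[R]_n :=
  \matrix_(i, j) lim ((fun N : nat => \sum_(k < N) (X ^+ k) i j / k`!%:R) @ \oo).

Definition is_Lie_algebra_of (V : {vspace 'M[R]_n}) (G : set 'M[R]_n) :=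
  forall X, X \in V <-> forall t : R, G (mx_exp (t *: X)).

Variables (g a : {vspace 'M[R]_n}).

Definition dual_space := 'Hom(subvs_of a, R^o).

Definition root_space (alpha : dual_space) : set 'M[R]_n :=
  [set X | X \in g /\ forall H : subvs_of a,
     vsval H *m X - X *m vsval H = (alpha H : R) *: X].

(* If alpha is a root but 2 alpha is not, root_space (alpha *+ 2) is {0}. *)
Definition restricted_roots : set dual_space :=
  [set alpha | alpha <> 0 /\ root_space alpha <> [set 0]].

Definition root_basis (Delta : seq dual_space) :=
  [/\ basis_of fullv Delta,
      forall alpha, alpha \in Delta -> restricted_roots alpha &
      forall alpha, restricted_roots alpha -> exists c : 'I_(size Delta) -> nat,
        alpha = \sum_(i < size Delta) Delta`_i *+ c i \/
        alpha = - (\sum_(i < size Delta) Delta`_i *+ c i)].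

End Lie.

Arguments restricted_roots {R n} g a.

Section RootGroups.
Variables (F : rcfType) (n : nat) (O : convexSubring F).

(* The exponential of a nilpotent n x n matrix. *)
Definition nil_exp (X : 'M[F]_n) : 'M[F]_n := \sum_(k < n) k`!%:R^-1 *: X ^+ k.

(* V and V2 stand for the F-extensions of the root spaces of alpha and 2 alpha. *)
Variables V V2 : set 'M[F]_n.

Definition root_group : set 'M[F]_n :=
  [set u | exists X X', [/\ V X, V2 X' & u = nil_exp (X + X')]].

Definition negv_mx (X : 'M[F]_n) : withBot (Lambda O) :=
  \big[Order.max / \bot%O]_(i < n) \big[Order.max / \bot%O]_(j < n) negv O (X i j).

(* A pair (X, X') with u = exp (X + X') is unique if it exists, since exp is
   injective on nilpotent matrices and the sum of V and V2 is direct. *)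
Definition root_group_val (u : 'M[F]_n) : withBot (Lambda O) :=
  let XX' := xget (0, 0) [set XX' : 'M[F]_n * 'M[F]_n |
    [/\ V XX'.1, V2 XX'.2 & u = nil_exp (XX'.1 + XX'.2)]] in
  Order.max (negv_mx XX'.1) (whalf (negv_mx XX'.2)).

End RootGroups.

Section Building.
Variables (F : rcfType) (n : nat) (O : convexSubring F).
Variables (T : choiceType) (Sigma : set T) (Delta : seq T).
Variable chi : T -> 'M[F]_n -> F.
Variables (GF AF : set 'M[F]_n).

Definition KF : set 'M[F]_n := [set k | [/\ GF k, k *m k^T = 1%:M & \det k = 1]].

Definition Aplus : set 'M[F]_n :=
  [set a | AF a /\ forall alpha, alpha \in Delta -> 1 <= chi alpha a].

Definition mx_act (g x : 'M[F]_n) := g *m x *m g^T.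

Definition XF : set 'M[F]_n := [set mx_act g 1%:M | g in GF].

(* The unique a in A+ with g^-1 h in K a K when x = g.Id and y = h.Id. *)
Definition cartan_proj (x y : 'M[F]_n) : 'M[F]_n :=
  xget 1%:M [set a | Aplus a /\ exists g h k k',
    [/\ GF g, GF h, KF k & KF k'] /\
    [/\ x = mx_act g 1%:M, y = mx_act h 1%:M & invmx g *m h = k *m a *m k']].

Definition mult_norm (a : 'M[F]_n) : F :=
  \big[*%R/1]_(alpha \in Sigma) Num.max (chi alpha a) (chi alpha a)^-1.

Definition pdist (x y : 'M[F]_n) : withBot (Lambda O) :=
  negv O (mult_norm (cartan_proj x y)).

(* Points of the building are equivalence classes, as subsets of X_F. *)
Definition bpoint (x : 'M[F]_n) : set 'M[F]_n :=
  [set y | XF y /\ pdist x y = Fin 0].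

Definition bact (g : 'M[F]_n) (p : set 'M[F]_n) : set 'M[F]_n := mx_act g @` p.

Definition basepoint := bpoint 1%:M.

Definition apartment : set (set 'M[F]_n) := [set bact a basepoint | a in AF].

Definition half_apartment (beta : T) (l : Lambda O) : set (set 'M[F]_n) :=
  [set bact a basepoint | a in [set a | AF a /\ Fin l <= negv O (chi beta a)]].

Definition wall (beta : T) (l : Lambda O) : set (set 'M[F]_n) :=
  [set bact a basepoint | a in [set a | AF a /\ negv O (chi beta a) = Fin l]].

Definition is_half_apartment_with_wall (H M : set (set 'M[F]_n)) :=
  exists beta l, [/\ Sigma beta, H = half_apartment beta l & M = wall beta l].

(* A_F acts on the apartment by translations; parallel means translate of. *)
Definition parallel (M M' : set (set 'M[F]_n)) :=
  exists2 a, AF a & M = bact a @` M'.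

End Building.

Arguments half_apartment {F n} O {T} Sigma Delta chi GF AF beta l.
Arguments wall {F n} O {T} Sigma Delta chi GF AF beta l.
Arguments is_half_apartment_with_wall {F n} O {T} Sigma Delta chi GF AF H M.

(* Main.v *)
Require Import Defs.
From HB Require Import structures.
From mathcomp Require Import all_boot all_order all_algebra.
From mathcomp Require Import boolp classical_sets.
From mathcomp Require Import complex ring.
From mathcomp Require mpoly sesquilinear spectral.
From mathcomp Require qe_rcf_th ordered_qelim qe_rcf.

(* Choose an orthogonal matrix Q over K diagonalizing S. By transfer between real
   closed fields, A_F consists of the elements of S_F that are positive definite,
   and G_F = K_F A_F^+ K_F follows from the real case, where one maximizes
   tr (k Y k^T H0) over the compact group K_R for a generic dominant H0: the first
   variation shows that k Y k^T commutes with a, hence lies in a because S is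
   maximal, and the second variation shows that it is dominant.

   The entries of an element a of A_F are bounded by a power of the numbers
   chi_beta(a)^(+-1), beta in Delta. With the Cartan decomposition this shows that
   o is the set of integral points of X_F, so that x.o = y.o iff x^-1 y is integral.

   Let u = exp (X + X') be in the root group of alpha. Grade the coordinates by the
   eigenvalues of some H in a with alpha(H) = 1: X has degree 1 and X' degree 2. If
   u a.o = b.o, the diagonal of the integral matrix b^-1 u a is that of b^-1 a, hence
   b^-1 a and a^-1 u a are integral. In degrees 1 and 2, the integrality of
   a^-1 u a = exp (c^-1 X + c^-2 X'), c = chi_alpha(a), is that of c^-1 X and of
   c^-2 X', which means phi_alpha(u) <= (-v)(c). *)

Set Implicit Arguments.
Unset Strict Implicit.
Unset Printing Implicit Defensive.

Import Order.TTheory GRing.Theory Num.Theory.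

Local Open Scope classical_set_scope.
Local Open Scope ring_scope.

(** * Polynomial functions of matrices *)

(** Neither the analytic exponential nor compactness is available over [F], and the characters are
    normalized only over the reals. Analytic arguments are therefore made over [R], stated as
    first-order sentences with parameters in [K], and carried to [K] and from there to [F]. This
    dictates the form of many lemmas: sentences quantify over matrices, infinite systems of
    equations are first made finite, and estimates are polynomial with natural exponents. Maximality
    of [S] is a hypothesis on tori defined over [K]; to reach [R] it is turned into a sentence about
    single elements that commute with the positive points of [S]. Tori are handled through monomials
    in diagonal coordinates: by independence of characters, the coincidences between monomials
    determine the Zariski closure of a diagonal group. The embedding of [K] in [R] serves a second
    purpose: elements of [K] are bounded by natural numbers, so polynomials over [K] preserve
    integrality. *)

Definition upoly (K : fieldType) (n : nat)
    (s : forall L : fieldType, {rmorphism K -> L} -> 'M[L]_n -> L) : Prop :=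
  exists p : mxpol n K, forall (L : fieldType) (i : {rmorphism K -> L}) x,
    mxeval i p x = s L i x.

(** Exponents are indexed by the two matrix coordinates: this is the form in which polynomials are
    used outside the module on multivariate polynomials. *)
Definition monoms (K L : fieldType) (n : nat) (i : K -> L)
    (s : seq (K * ('I_n -> 'I_n -> nat))) (x : 'M[L]_n) : L :=
  \sum_(t <- s) i t.1 * \prod_a \prod_b x a b ^+ t.2 a b.

(** Dickson's lemma for exponent vectors, of which only the first [m] values count. In the induction
    step a basis for the first [m] coordinates serves the vectors whose coordinate [m] is at least
    [N]; the others fall into finitely many slices of constant coordinate [m], each with a basis of
    its own. *)
Lemma dickson (m : nat) (M : (nat -> nat) -> Prop) :
  exists2 B : seq (nat -> nat), (forall k, (k < size B)%N -> M (nth (fun=> 0%N) B k)) &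
    forall f, M f -> exists2 k, (k < size B)%N &
      forall j, (j < m)%N -> (nth (fun=> 0%N) B k j <= f j)%N.
Proof.
have nthr (C D : seq (nat -> nat)) k :
    nth (fun=> 0%N) (C ++ D) (size C + k)%N = nth (fun=> 0%N) D k.
  by rewrite nth_cat ltnNge leq_addr addKn.
elim: m M => [|m IH] M.
  have [[f Mf]|noM] := pselect (exists f, M f).
    by exists [:: f] => [[]|]//; exists 0%N.
  by exists [::] => // f Mf; case: noM; exists f.
have [B0 B0M B0P] := IH M.
pose N := (\max_(k < size B0) nth (fun=> 0%N) B0 k m)%N.
have [C CM CP] : exists2 C : seq (nat -> nat),
    (forall k, (k < size C)%N -> M (nth (fun=> 0%N) C k)) &
    forall f, M f -> (f m < N)%N -> exists2 k, (k < size C)%N &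
      forall j, (j < m.+1)%N -> (nth (fun=> 0%N) C k j <= f j)%N.
  elim: N => [|N [C CM CP]]; first by exists [::].
  have [D DM DP] := IH (fun f => M f /\ f m = N).
  exists (C ++ D) => [k|f Mf].
    rewrite size_cat nth_cat; case: (ltnP k (size C)) => [kC _|kC]; first exact: CM.
    by rewrite -ltn_subLR // => /DM[].
  rewrite ltnS leq_eqVlt => /orP[/eqP fN|/(CP f Mf)[k kC kP]].
    have [k kD kP] := DP f (conj Mf fN).
    exists (size C + k)%N; first by rewrite size_cat ltn_add2l.
    move=> j; rewrite ltnS leq_eqVlt nthr.
    by case/orP=> [/eqP ->|/kP//]; rewrite (DM k kD).2 fN.
  exists k; first by rewrite size_cat ltn_addr.
  by move=> j jm; rewrite nth_cat kC kP.
exists (B0 ++ C) => [k|f Mf].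
  rewrite size_cat nth_cat; case: (ltnP k (size B0)) => [kB _|kB]; first exact: B0M.
  by rewrite -ltn_subLR // => /CM.
have [fN|Nf] := ltnP (f m) N.
  have [k kC kP] := CP f Mf fN.
  exists (size B0 + k)%N; first by rewrite size_cat ltn_add2l.
  by move=> j jm; rewrite nthr kP.
have [k kB kP] := B0P f Mf.
exists k; first by rewrite size_cat ltn_addr.
move=> j; rewrite ltnS leq_eqVlt nth_cat kB => /orP[/eqP ->|/kP//].
by apply: leq_trans Nf; rewrite (leq_bigmax (Ordinal kB)).
Qed.

Module MultivariatePolynomials.
Import mpoly.

Section Eval.
Variables (K : fieldType) (n : nat).
Implicit Types (p q : mxpol n K).

Lemma mxeval_add (L : fieldType) (i : {rmorphism K -> L}) p q x :
  mxeval i (p + q) x = mxeval i p x + mxeval i q x.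
Proof. exact: mmapD. Qed.

Lemma mxeval_mul (L : fieldType) (i : {rmorphism K -> L}) p q x :
  mxeval i (p * q) x = mxeval i p x * mxeval i q x.
Proof. by rewrite /mxeval rmorphM. Qed.

Lemma mxeval_const (L : fieldType) (i : {rmorphism K -> L}) c x :
  mxeval i (c%:MP : mxpol n K) x = i c.
Proof. by rewrite /mxeval mmapC. Qed.

Lemma mxeval_var (L : fieldType) (i : {rmorphism K -> L}) a b (x : 'M[L]_n) :
  mxeval i ('X_(mxvec_index a b) : mxpol n K) x = x a b.
Proof. by rewrite /mxeval mmapX mmap1U mxvecE. Qed.

Lemma mxeval_monoms p : exists s : seq (K * ('I_n -> 'I_n -> nat)),
  forall (L : fieldType) (i : {rmorphism K -> L}) x, mxeval i p x = monoms i s x.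
Proof.
exists [seq (p@_m, fun a b => (m : 'X_{1..n * n}) (mxvec_index a b)) | m <- msupp p] => L i x.
rewrite /monoms big_map /mxeval /mmap; apply: eq_bigr => m _; congr (_ * _).
rewrite pair_bigA /= /mmap1.
rewrite (reindex (uncurry (@mxvec_index n n))) /=; last first.
  exact: curry_mxvec_bij.
by apply: eq_bigr => -[a b] _ /=; rewrite mxvecE.
Qed.

(** Hilbert's basis theorem in terms of common zeros. [J] collects the polynomials whose vanishing
    follows from finitely many members of [I]. It is stable under [p - c * q], so division by
    finitely many elements with minimal leading monomials reduces each of its members to 0. *)
Lemma finite_basis (I : set (mxpol n K)) :
  exists2 s : seq (mxpol n K), (forall p, p \in s -> I p) &
    forall (L : fieldType) (i : {rmorphism K -> L}) x,
      (forall p, p \in s -> mxeval i p x = 0) ->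
      forall p, I p -> mxeval i p x = 0.
Proof.
pose J p := exists2 s : seq (mxpol n K), (forall p, p \in s -> I p) &
    forall (L : fieldType) (i : {rmorphism K -> L}) x,
      (forall p, p \in s -> mxeval i p x = 0) -> mxeval i p x = 0.
have JI p : I p -> J p.
  move=> Ip; exists [:: p] => [q|L i x]; first by rewrite inE => /eqP ->.
  by apply; rewrite inE.
have JB p q c : J p -> J q -> J (p - c * q).
  move=> [s sI sP] [t tI tP]; exists (s ++ t) => [r|L i x st0].
    by rewrite mem_cat => /orP[/sI|/tI].
  have /sP p0 : forall r, r \in s -> mxeval i r x = 0.
    by move=> r rs; apply: st0; rewrite mem_cat rs.
  have /tP q0 : forall r, r \in t -> mxeval i r x = 0.
    by move=> r rs; apply: st0; rewrite mem_cat rs orbT.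
  by rewrite -mulNr mxeval_add mxeval_mul p0 q0 mulr0 addr0.
pose fn (m : 'X_{1..n * n}) (k : nat) := if insub k is Some k' then m k' else 0%N.
have [B BM BP] := dickson (n * n)
  (fun f => exists p, [/\ J p, p != 0 & f = fn (mlead p)]).
have [g gP] : {g : nat -> mxpol n K & forall k, (k < size B)%N ->
    [/\ J (g k), g k != 0 & nth (fun=> 0%N) B k = fn (mlead (g k))]}.
  apply: (@choice _ _ (fun k p => (k < size B)%N ->
    [/\ J p, p != 0 & nth (fun=> 0%N) B k = fn (mlead p)])) => k.
  by have [/BM[p pP]|] := boolP (k < size B)%N; [exists p|exists 0].
have [G GI GP] : exists2 s : seq (mxpol n K), (forall p, p \in s -> I p) &
    forall (L : fieldType) (i : {rmorphism K -> L}) x,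
      (forall p, p \in s -> mxeval i p x = 0) ->
      forall k, (k < size B)%N -> mxeval i (g k) x = 0.
  elim: {-2}(size B) (leqnn (size B)) => [_|N IH NB]; first by exists [::].
  have [s sI sP] := IH (ltnW NB).
  have [[t tI tP] _ _] := gP _ NB.
  exists (s ++ t) => [r|L i x st0 k].
    by rewrite mem_cat => /orP[/sI|/tI].
  rewrite ltnS leq_eqVlt => /orP[/eqP ->|].
    by apply: tP => r rs; apply: st0; rewrite mem_cat rs orbT.
  by apply: sP => r rs; apply: st0; rewrite mem_cat rs.
exists G => // L i x G0; suff H p : J p -> mxeval i p x = 0 by move=> p /JI/H.
elim/mleadrect: p => p IH Jp.
have [->|p0] := eqVneq p 0; first by rewrite /mxeval mmap0.
have [k kB kP] := BP _ (ex_intro _ p (And3 Jp p0 erefl)).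
have [Jg g0 gE] := gP k kB; have gk0 := GP _ i x G0 k kB.
move: (g k) Jg g0 gE gk0 => {gP GP} {}g Jg g0 gE gk0.
have gp : (mlead g <= mlead p)%MM.
  apply/mnm_lepP => j; have := kP j (ltn_ord j).
  by rewrite gE /fn !valK.
(* Chosen so that [c * g] and [p] have the same leading term, which the difference loses. *)
pose c : mxpol n K := (mleadc p / mleadc g) *: 'X_[mlead p - mlead g].
have c0 : mleadc p / mleadc g != 0 by rewrite mulf_neq0 ?invr_eq0 ?mleadc_eq0.
have X0 : ('X_[mlead p - mlead g] : mxpol n K) != 0.
  by rewrite -mleadc_eq0 mleadXm mcoeffX eqxx oner_eq0.
have mc : mlead c = (mlead p - mlead g)%MM by rewrite mleadZ // mleadXm.
have cN0 : c != 0 by rewrite -mleadc_eq0 mleadcZE mleadXm mcoeffX eqxx mulr1.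
have mcg : mlead (c * g) = mlead p by rewrite mleadM // mc addmC addmBA // addmC addmK.
have lcg : mleadc (c * g) = mleadc p.
  by rewrite mleadM // mleadcM mleadcZE mleadXm mcoeffX eqxx mulr1 divfK // mleadc_eq0.
have E : mxeval i p x = mxeval i (p - c * g) x.
  by rewrite -mulNr mxeval_add mxeval_mul gk0 mulr0 addr0.
rewrite E.
have [->|pc0] := eqVneq (p - c * g) 0; first by rewrite /mxeval mmap0.
apply: IH; last exact: JB.
rewrite lt_neqAle; apply/andP; split.
  apply: contra pc0 => /eqP e.
  by rewrite -mleadc_eq0 e mcoeffB -[in X in _ - X]mcg lcg subrr.
by apply: le_trans (mleadB_le _ _) _; rewrite mcg joinxx.
Qed.

Lemma finite_basis_ord (I : set (mxpol n K)) :
  exists (N : nat) (r : 'I_N -> mxpol n K), (forall k, I (r k)) /\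
    forall (L : fieldType) (i : {rmorphism K -> L}) x,
      (forall k, mxeval i (r k) x = 0) -> forall p, I p -> mxeval i p x = 0.
Proof.
have [s sI sP] := finite_basis I; exists (size s), (tnth (in_tuple s)).
split=> [k|L i x rx0]; first by apply: sI; apply: mem_tnth.
by apply: sP => p /(tnthP (in_tuple s))[k ->]; apply: rx0.
Qed.

End Eval.

Section Upoly.
Variables (K : fieldType) (n : nat).
Notation upoly := (@upoly K n).

Lemma upoly_const c : upoly (fun L i x => i c).
Proof. by exists c%:MP => L i x; rewrite mxeval_const. Qed.

Lemma upoly_entry a b : upoly (fun L i x => x a b).
Proof. by exists 'X_(mxvec_index a b) => L i x; rewrite mxeval_var. Qed.

Lemma upolyD s t : upoly s -> upoly t -> upoly (fun L i x => s L i x + t L i x).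
Proof. by move=> [p pE] [q qE]; exists (p + q) => L i x; rewrite mxeval_add pE qE. Qed.

Lemma upolyM s t : upoly s -> upoly t -> upoly (fun L i x => s L i x * t L i x).
Proof. by move=> [p pE] [q qE]; exists (p * q) => L i x; rewrite mxeval_mul pE qE. Qed.

Lemma upoly_monoms s : upoly (fun L i x => monoms i s x).
Proof.
pose q (t : K * ('I_n -> 'I_n -> nat)) : mxpol n K :=
  t.1%:MP * \prod_a \prod_b 'X_(mxvec_index a b) ^+ t.2 a b.
exists (\sum_(t <- s) q t) => L i x; rewrite /monoms.
elim: s => [|t s IH]; first by rewrite !big_nil /mxeval mmap0.
rewrite !big_cons mxeval_add IH /q mxeval_mul mxeval_const; congr (_ * _ + _).
rewrite /mxeval rmorph_prod; apply: eq_bigr => a _ /=.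
rewrite rmorph_prod; apply: eq_bigr => b _ /=.
by rewrite rmorphXn /= -[mmap _ _ _]/(mxeval i _ x) mxeval_var.
Qed.

End Upoly.
End MultivariatePolynomials.

Section UpolyClosure.
Variables (K : fieldType) (n : nat).
Notation upoly := (@upoly K n).

Lemma upoly_ext s t : (forall L i x, s L i x = t L i x) -> upoly s -> upoly t.
Proof. by move=> st [p pE]; exists p => L i x; rewrite pE. Qed.

Lemma upolyN s : upoly s -> upoly (fun L i x => - s L i x).
Proof.
move=> us; have := MultivariatePolynomials.upolyM
  (MultivariatePolynomials.upoly_const n (-1 : K)) us.
by apply: upoly_ext => L i x; rewrite rmorphN1 mulN1r.
Qed.

Lemma upoly_sum (I : Type) (r : seq I)
    (F : forall L : fieldType, {rmorphism K -> L} -> 'M[L]_n -> I -> L) :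
  (forall k, upoly (fun L i x => F L i x k)) ->
  upoly (fun L i x => \sum_(k <- r) F L i x k).
Proof.
move=> uF; elim: r => [|k r IH].
  apply: upoly_ext (MultivariatePolynomials.upoly_const n (0 : K)) => L i x.
  by rewrite big_nil rmorph0.
apply: upoly_ext (MultivariatePolynomials.upolyD (uF k) IH) => L i x.
by rewrite big_cons.
Qed.

Lemma upoly_prod (I : Type) (r : seq I)
    (F : forall L : fieldType, {rmorphism K -> L} -> 'M[L]_n -> I -> L) :
  (forall k, upoly (fun L i x => F L i x k)) ->
  upoly (fun L i x => \prod_(k <- r) F L i x k).
Proof.
move=> uF; elim: r => [|k r IH].
  apply: upoly_ext (MultivariatePolynomials.upoly_const n (1 : K)) => L i x.
  by rewrite big_nil rmorph1.
apply: upoly_ext (MultivariatePolynomials.upolyM (uF k) IH) => L i x.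
by rewrite big_cons.
Qed.

Lemma upolyX s k : upoly s -> upoly (fun L i x => s L i x ^+ k).
Proof.
move=> us; elim: k => [|k IH].
  by apply: upoly_ext (MultivariatePolynomials.upoly_const n (1 : K)) => L i x;
    rewrite rmorph1.
by apply: upoly_ext (MultivariatePolynomials.upolyM us IH) => L i x; rewrite exprS.
Qed.

Lemma upoly_conj (P Q : 'M[K]_n) a b :
  upoly (fun L i x => (map_mx i P *m x *m map_mx i Q) a b).
Proof.
apply: (@upoly_ext (fun L i x => \sum_d (\sum_c i (P a c) * x c d) * i (Q d b))).
  move=> L i x; rewrite mxE; apply: eq_bigr => d _.
  by rewrite !mxE; congr (_ * _); apply: eq_bigr => c _; rewrite mxE.
apply: upoly_sum => d; apply: MultivariatePolynomials.upolyM; last first.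
  exact: MultivariatePolynomials.upoly_const.
apply: upoly_sum => c; apply: MultivariatePolynomials.upolyM.
  exact: MultivariatePolynomials.upoly_const.
exact: MultivariatePolynomials.upoly_entry.
Qed.

Lemma upoly_extension (C : fieldType) (c : {rmorphism K -> C}) (p : mxpol n K) :
  exists q : mxpol n C, forall x, mxeval idfun q x = mxeval c p x.
Proof.
have [s sP] := MultivariatePolynomials.mxeval_monoms p.
have [q qP] := MultivariatePolynomials.upoly_monoms
  [seq (c t.1, t.2) | t <- s].
by exists q => x; rewrite sP qP /monoms big_map.
Qed.

End UpolyClosure.

(** * Transfer between real closed fields *)

Lemma nth_map_default (T U : Type) (f : T -> U) x s k :
  nth (f x) (map f s) k = f (nth x s k).
Proof. by elim: s k => [|y s IH] [|k] //=. Qed.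

Section RcfMorphism.
Variables (K L : rcfType) (i : {rmorphism K -> L}).

(* Nonnegative elements of a real closed field are squares. *)
Lemma rcf_rmorph_ge0 x : (0 <= i x) = (0 <= x).
Proof.
have ge0 y : 0 <= y -> 0 <= i y.
  by move=> y0; rewrite -(sqr_sqrtr y0) rmorphXn sqr_ge0.
apply/idP/idP => [ix0|/ge0//]; rewrite leNgt; apply/negP => x0.
have : 0 <= i (- x) by rewrite ge0 // oppr_ge0 ltW.
rewrite rmorphN oppr_ge0 => ix0'.
have /eqP : i x = 0 by apply/le_anti; rewrite ix0 ix0'.
by rewrite fmorph_eq0 => /eqP x00; rewrite x00 ltxx in x0.
Qed.

Lemma rcf_rmorph_le x y : (i x <= i y) = (x <= y).
Proof. by rewrite -subr_ge0 -rmorphB rcf_rmorph_ge0 subr_ge0. Qed.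

Lemma rcf_rmorph_lt x y : (i x < i y) = (x < y).
Proof. by rewrite !ltNge rcf_rmorph_le. Qed.

End RcfMorphism.

(** * Quantifier elimination commutes with a change of the real closed field *)

Module QuantifierElimination.
Import qe_rcf_th ordered_qelim ord qe_rcf.
Section MapFormula.
Variables (K L : rcfType) (i : {rmorphism K -> L}).

Fixpoint map_term (t : GRing.term K) : GRing.term L :=
  match t with
  | GRing.Var x => GRing.Var _ x
  | GRing.Const x => GRing.Const (i x)
  | GRing.NatConst n => GRing.NatConst _ n
  | GRing.Add u v => GRing.Add (map_term u) (map_term v)
  | GRing.Opp u => GRing.Opp (map_term u)
  | GRing.NatMul u n => GRing.NatMul (map_term u) n
  | GRing.Mul u v => GRing.Mul (map_term u) (map_term v)
  | GRing.Inv u => GRing.Inv (map_term u)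
  | GRing.Exp u n => GRing.Exp (map_term u) n
  end.

Fixpoint map_formula (f : ord.formula K) : ord.formula L :=
  match f with
  | ord.Bool b => ord.Bool b
  | ord.Equal u v => ord.Equal (map_term u) (map_term v)
  | ord.Lt u v => ord.Lt (map_term u) (map_term v)
  | ord.Le u v => ord.Le (map_term u) (map_term v)
  | ord.Unit u => ord.Unit (map_term u)
  | ord.And f g => ord.And (map_formula f) (map_formula g)
  | ord.Or f g => ord.Or (map_formula f) (map_formula g)
  | ord.Implies f g => ord.Implies (map_formula f) (map_formula g)
  | ord.Not f => ord.Not (map_formula f)
  | ord.Exists n f => ord.Exists n (map_formula f)
  | ord.Forall n f => ord.Forall n (map_formula f)
  end.

Fixpoint map_qterm (t : qe_rcf.term K) : qe_rcf.term L :=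
  match t with
  | qe_rcf.Var x => qe_rcf.Var _ x
  | qe_rcf.Const x => qe_rcf.Const (i x)
  | qe_rcf.NatConst n => qe_rcf.NatConst _ n
  | qe_rcf.Add u v => qe_rcf.Add (map_qterm u) (map_qterm v)
  | qe_rcf.Opp u => qe_rcf.Opp (map_qterm u)
  | qe_rcf.NatMul u n => qe_rcf.NatMul (map_qterm u) n
  | qe_rcf.Mul u v => qe_rcf.Mul (map_qterm u) (map_qterm v)
  | qe_rcf.Exp u n => qe_rcf.Exp (map_qterm u) n
  end.

Fixpoint map_qformula (f : qe_rcf.formula K) : qe_rcf.formula L :=
  match f with
  | qe_rcf.Bool b => qe_rcf.Bool b
  | qe_rcf.Equal u v => qe_rcf.Equal (map_qterm u) (map_qterm v)
  | qe_rcf.Lt u v => qe_rcf.Lt (map_qterm u) (map_qterm v)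
  | qe_rcf.Le u v => qe_rcf.Le (map_qterm u) (map_qterm v)
  | qe_rcf.And f g => qe_rcf.And (map_qformula f) (map_qformula g)
  | qe_rcf.Or f g => qe_rcf.Or (map_qformula f) (map_qformula g)
  | qe_rcf.Implies f g => qe_rcf.Implies (map_qformula f) (map_qformula g)
  | qe_rcf.Not f => qe_rcf.Not (map_qformula f)
  end.

Local Notation mt := map_qterm.
Local Notation mf := map_qformula.
Local Notation mp := (map map_qterm).

Lemma map_rterm t : map_term (rterm_to_term t) = rterm_to_term (mt t).
Proof. by elim: t => //= [t -> u ->|t ->|t -> m|t -> u ->|t -> m]. Qed.

Lemma map_rformula f : map_formula (qfr_to_formula f) = qfr_to_formula (mf f).
Proof. by elim: f => //= [t u|t u|t u|f -> g ->|f -> g ->|f -> g ->|f ->]; rewrite ?map_rterm. Qed.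

Lemma map_to_rterm t : mt (to_rterm t) = to_rterm (map_term t).
Proof. by elim: t => //= [t -> u ->|t ->|t -> m|t -> u ->|t -> m]. Qed.

(** The elimination procedure is written in continuation-passing style, so this lemma and its
    analogues below assume that the continuations [k] and [k'] correspond. *)
Lemma map_Size p k k' : (forall n, mf (k n) = k' n) -> mf (Size p k) = Size (mp p) k'.
Proof.
by elim: p k k' => [|c p IH] k k' kk'//=; apply: IH => -[|n] /=; rewrite !kk'.
Qed.

Lemma map_Isnull p k k' :
  (forall n, mf (k n) = k' n) -> mf (Isnull p k) = Isnull (mp p) k'.
Proof. by move=> kk'; apply: map_Size => n. Qed.

Lemma map_LtSize p q k k' :
  (forall n, mf (k n) = k' n) -> mf (LtSize p q k) = LtSize (mp p) (mp q) k'.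
Proof. by move=> kk'; apply: map_Size => n; apply: map_Size => m. Qed.

Lemma map_LeadCoef p k k' :
  (forall t, mf (k t) = k' (mt t)) -> mf (LeadCoef p k) = LeadCoef (mp p) k'.
Proof.
elim: p k k' => [|c p IH] k k' kk' /=; first by rewrite kk' /= rmorph0.
by apply: IH => t /=; rewrite !kk'.
Qed.

Lemma map_AmulXn a m : mp (AmulXn a m) = AmulXn (mt a) m.
Proof. by elim: m => //= m ->; rewrite rmorph0. Qed.

Lemma map_AddPoly p q : mp (AddPoly p q) = AddPoly (mp p) (mp q).
Proof. by elim: p q => [|a p IH] [|b q] //=; rewrite IH. Qed.

Lemma map_ScalPoly c p : mp (ScalPoly c p) = ScalPoly (mt c) (mp p).
Proof. by rewrite /ScalPoly -!map_comp. Qed.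

Lemma map_MulPoly p q : mp (MulPoly p q) = MulPoly (mp p) (mp q).
Proof. by elim: p => [|a p IH] //=; rewrite map_AddPoly map_ScalPoly /= IH. Qed.

Lemma map_ExpPoly p m : mp (ExpPoly p m) = ExpPoly (mp p) m.
Proof.
rewrite /ExpPoly; case: m => // m; rewrite !iteropS.
by elim: m => //= m IH; rewrite map_MulPoly IH.
Qed.

Lemma map_OppPoly p : mp (OppPoly p) = OppPoly (mp p).
Proof. by rewrite /OppPoly map_ScalPoly /= rmorphN1. Qed.

Lemma map_NatMulPoly m p : mp (NatMulPoly m p) = NatMulPoly m (mp p).
Proof. by rewrite /NatMulPoly map_ScalPoly. Qed.

Lemma map_Deriv p : mp (Deriv p) = Deriv (mp p).
Proof. by elim: p => //= a p IH; rewrite map_AddPoly /= IH. Qed.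

Lemma map_Rediv_rec_loop q sq cq c qq r m k k' :
  (forall d, mf (k d) = k' (d.1.1, mp d.1.2, mp d.2)%PAIR) ->
  mf (Rediv_rec_loop q sq cq c qq r m k) =
  Rediv_rec_loop (mp q) sq (mt cq) c (mp qq) (mp r) m k'.
Proof.
move=> kk'; have E := (map_AddPoly, map_MulPoly, map_AmulXn, map_OppPoly).
elim: m c qq r => [|m IH] c qq r /=;
  (apply: map_Size => n; case: ifP => _; first by rewrite kk');
  apply: map_LeadCoef => t /=; first by rewrite kk' /= !E.
by rewrite IH /= !E.
Qed.

Lemma map_Rediv p q k k' :
  (forall d, mf (k d) = k' (d.1.1, mp d.1.2, mp d.2)%PAIR) ->
  mf (Rediv p q k) = Rediv (mp p) (mp q) k'.
Proof.
move=> kk'; apply: map_Isnull => -[]; first by rewrite kk' /= rmorph0.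
apply: map_Size => n; apply: map_Size => m; apply: map_LeadCoef => t.
by rewrite (map_Rediv_rec_loop _ _ _ _ _ _ _ kk') /= rmorph0.
Qed.

Lemma map_Rmod p q k k' : (forall r, mf (k r) = k' (mp r)) ->
  mf (Rmod p q k) = Rmod (mp p) (mp q) k'.
Proof. by move=> kk'; apply: map_Rediv => d. Qed.

Lemma map_Rscal p q k k' : (forall r, mf (k r) = k' r) ->
  mf (Rscal p q k) = Rscal (mp p) (mp q) k'.
Proof. by move=> kk'; apply: map_Rediv => d. Qed.

Lemma map_Rgcd_loop m p q k k' : (forall r, mf (k r) = k' (mp r)) ->
  mf (Rgcd_loop m p q k) = Rgcd_loop m (mp p) (mp q) k'.
Proof.
move=> kk'; elim: m p q => [|m IH] p q /=; apply: map_Rmod => r;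
  by apply: map_Isnull => -[].
Qed.

Lemma map_Rgcd p q k k' : (forall r, mf (k r) = k' (mp r)) ->
  mf (Rgcd p q k) = Rgcd (mp p) (mp q) k'.
Proof.
move=> kk'; apply: map_LtSize => -[]; apply: map_Isnull => -[] //;
  by apply: map_Size => n; apply: map_Rgcd_loop.
Qed.

Lemma map_BigRgcd ps k k' : (forall r, mf (k r) = k' (mp r)) ->
  mf (BigRgcd ps k) = BigRgcd (map mp ps) k'.
Proof.
elim: ps k k' => [|p ps IH] k k' kk' /=; first by rewrite kk' /= rmorph0.
by apply: IH => r; apply: map_Rgcd.
Qed.

Lemma map_Changes s k k' : (forall r, mf (k r) = k' r) ->
  mf (Changes s k) = Changes (mp s) k'.
Proof.
elim: s k k' => [|a s IH] k k' kk' //=.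
by apply: IH => v /=; rewrite !kk'; case: s.
Qed.

Lemma map_SeqPInfty ps k k' : (forall r, mf (k r) = k' (mp r)) ->
  mf (SeqPInfty ps k) = SeqPInfty (map mp ps) k'.
Proof.
elim: ps k k' => [|p ps IH] k k' kk' //=.
by apply: map_LeadCoef => t; apply: IH => r; rewrite kk'.
Qed.

Lemma map_SeqMInfty ps k k' : (forall r, mf (k r) = k' (mp r)) ->
  mf (SeqMInfty ps k) = SeqMInfty (map mp ps) k'.
Proof.
elim: ps k k' => [|p ps IH] k k' kk' //=.
apply: map_LeadCoef => t; apply: map_Size => n; apply: IH => r.
by rewrite kk' /= rmorphN1.
Qed.

Lemma map_ChangesPoly ps k k' : (forall r, mf (k r) = k' r) ->
  mf (ChangesPoly ps k) = ChangesPoly (map mp ps) k'.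
Proof.
move=> kk'; apply: map_SeqMInfty => r; apply: map_SeqPInfty => s.
by apply: map_Changes => m; apply: map_Changes => n.
Qed.

Lemma map_NextMod p q k k' : (forall r, mf (k r) = k' (mp r)) ->
  mf (NextMod p q k) = NextMod (mp p) (mp q) k'.
Proof.
move=> kk'; apply: map_LeadCoef => t; apply: map_Rscal => n.
by apply: map_Rmod => r; rewrite kk' map_ScalPoly.
Qed.

Lemma map_ModsAux p q m k k' : (forall r, mf (k r) = k' (map mp r)) ->
  mf (ModsAux p q m k) = ModsAux (mp p) (mp q) m k'.
Proof.
elim: m p q k k' => [|m IH] p q k k' kk' /=; first by rewrite kk'.
apply: map_Isnull => -[]; first by rewrite kk'.
by apply: map_NextMod => r; apply: IH => s; rewrite kk'.
Qed.

Lemma map_Mods p q k k' : (forall r, mf (k r) = k' (map mp r)) ->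
  mf (Mods p q k) = Mods (mp p) (mp q) k'.
Proof.
by move=> kk'; apply: map_Size => m; apply: map_Size => n; apply: map_ModsAux.
Qed.

Lemma map_PolyComb sq sc : mp (PolyComb sq sc) = PolyComb (map mp sq) sc.
Proof.
rewrite /PolyComb size_map /reducebig.
elim: (iota _ _) => // j s IH; rewrite /= map_MulPoly map_ExpPoly.
congr (MulPoly (ExpPoly _ _) _); last exact: IH.
by rewrite -[[::] in RHS]/(mp [::]) nth_map_default.
Qed.

Lemma map_TaqR p q k k' : (forall r, mf (k r) = k' r) ->
  mf (TaqR p q k) = TaqR (mp p) (mp q) k'.
Proof.
move=> kk'; rewrite /TaqR -map_Deriv -map_MulPoly; apply: map_Mods => r.
exact: map_ChangesPoly.
Qed.

Lemma map_Pcq sq j : mp (Pcq sq j) = Pcq (map mp sq) j.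
Proof.
rewrite /Pcq size_map -[[::] in RHS]/(mp [::]) -[LHS]nth_map_default.
by rewrite -map_comp; congr nth; apply: eq_map => s /=; rewrite map_PolyComb.
Qed.

Lemma map_TaqsR p sq j k k' : (forall r, mf (k r) = k' (mt r)) ->
  mf (TaqsR p sq j k) = TaqsR (mp p) (map mp sq) j k'.
Proof.
move=> kk'; rewrite /TaqsR -map_Pcq; apply: map_TaqR => n.
by rewrite kk' /= rmorph_int.
Qed.

Lemma map_BoundingPoly sq : mp (BoundingPoly sq) = BoundingPoly (map mp sq).
Proof.
rewrite /BoundingPoly map_Deriv; congr Deriv; rewrite /reducebig.
by elim: sq => //= p sq IH; rewrite map_MulPoly IH.
Qed.

(** The coefficients are read off the inverse of an integer matrix, which every field morphism
    respects. *)
Lemma map_coefs m j : i (coefs K m j) = coefs L m j.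
Proof.
rewrite /coefs -[LHS]nth_map_default rmorph0 -map_comp.
congr nth; apply: eq_map => a /=.
set M := castmx _ _; transitivity (map_mx i M a ord0); first by rewrite mxE.
rewrite map_castmx map_invmx -map_mx_comp; congr (castmx _ (invmx _) _ _).
by apply/matrixP => x y; rewrite !mxE /= rmorph_int.
Qed.

Lemma map_Coefs m j : mt (Coefs K m j) = Coefs L m j.
Proof.
case: m => [|[|m]] /=; congr Const; rewrite ?rmorph_nat ?map_coefs //.
by move: j => [|[|[|j]]] /=; rewrite ?fmorphV ?rmorph_nat ?rmorph0 // !nth_default ?rmorph0.
Qed.

Lemma map_CcountWeak p sq k k' : (forall r, mf (k r) = k' (mt r)) ->
  mf (CcountWeak p sq k) = CcountWeak (mp p) (map mp sq) k'.
Proof.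
move=> kk'; rewrite /CcountWeak size_map.
rewrite -[0%qfT in RHS]/(mt 0%qfT); move: (0%qfT) => s.
elim: (3 ^ _)%N s => [|j IH] s /=; first by rewrite kk'.
by apply: map_TaqsR => t; rewrite IH -map_Coefs.
Qed.

Lemma map_CcountGt0 sp sq :
  mf (CcountGt0 sp sq) = CcountGt0 (map mp sp) (map mp sq).
Proof.
apply: map_BigRgcd => r; apply: map_Isnull => -[] /=; last first.
  exact: map_CcountWeak.
rewrite -map_BoundingPoly; apply: map_CcountWeak => t /=.
congr (Or _ (Or _ _)); rewrite /reducebig.
  elim: sq => //= q sq IH; congr And => //; exact: map_LeadCoef.
elim: sq => //= q sq IH; congr And => //.
by apply: map_Size => n; apply: map_LeadCoef.
Qed.

Lemma map_abstrX m t : mp (abstrX m t) = abstrX m (mt t).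
Proof.
elim: t => //= [k|t <- u <-|t <-|t <- k|t <- u <-|t <- k].
- by case: ifP.
- by rewrite map_AddPoly.
- by rewrite map_OppPoly.
- by rewrite map_NatMulPoly.
- by rewrite map_MulPoly.
- by rewrite map_ExpPoly.
Qed.

Lemma map_wproj m s : map_formula (wproj m s) =
  wproj m (map map_term s.1%PAIR, map map_term s.2%PAIR).
Proof.
rewrite /wproj map_rformula map_CcountGt0 -!map_comp /=; congr qfr_to_formula.
by congr CcountGt0; apply: eq_map => t /=; rewrite map_abstrX map_to_rterm.
Qed.

Definition map_oclause (c : oclause K) : oclause L :=
  let: Oclause a b c d := c in
  Oclause (map map_term a) (map map_term b) (map map_term c) (map map_term d).

Lemma map_and_odnf s t : map map_oclause (and_odnf s t) =
  and_odnf (map map_oclause s) (map map_oclause t).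
Proof.
rewrite /and_odnf big_map (big_morph (map map_oclause) (map_cat _) (erefl _)).
apply: eq_bigr => -[a b c d] _; rewrite -!map_comp; apply: eq_map => -[a' b' c' d'] /=.
by rewrite !map_cat.
Qed.

Lemma map_qf_to_odnf f b :
  map map_oclause (qf_to_odnf f b) = qf_to_odnf (map_formula f) b.
Proof.
elim: f b => //= [c [] |t u []|t u []|t u []|t []
  |f IHf g IHg []|f IHf g IHg []|f IHf g IHg []|m f _ []|m f _ []] //;
  rewrite ?map_and_odnf ?map_cat ?IHf ?IHg //; by case: c.
Qed.

Lemma map_leq_elim_aux a b c :
  map (fun x => (map map_term x.1, map map_term x.2)%PAIR) (leq_elim_aux a b c) =
  leq_elim_aux (map map_term a) (map map_term b) (map map_term c).
Proof. by elim: c => //= t c <-; rewrite map_cat -!map_comp. Qed.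

Lemma map_neq_elim_aux a b : map (map map_term) (neq_elim_aux a b) =
  neq_elim_aux (map map_term a) (map map_term b).
Proof. by elim: b => //= t b <-; rewrite map_cat -!map_comp. Qed.

Lemma map_oclause_to_w c :
  map (fun x => (map map_term x.1, map map_term x.2)%PAIR) (oclause_to_w c) =
  oclause_to_w (map_oclause c).
Proof.
have leqE (o : oclause K) : oclause_leq_elim (map_oclause o) =
    map map_oclause (oclause_leq_elim o).
  by case: o => a b d e /=; rewrite -map_leq_elim_aux -!map_comp; apply: eq_map.
have neqE (o : oclause K) : oclause_neq_elim (map_oclause o) =
    map map_oclause (oclause_neq_elim o).
  by case: o => a b d e /=; rewrite -map_neq_elim_aux -!map_comp; apply: eq_map.
rewrite /oclause_to_w /oclause_neq_leq_elim leqE -map_comp -map_comp.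
rewrite (eq_map (g := map map_oclause \o @oclause_neq_elim K)); last first.
  by move=> o /=; rewrite neqE.
rewrite (map_comp (map map_oclause)) -map_flatten -map_comp.
by apply: eq_map => -[].
Qed.

Lemma map_proj m c : map_formula (proj (@wproj K) m c) =
  proj (@wproj L) m (map_oclause c).
Proof.
rewrite /proj -map_oclause_to_w; elim: oclause_to_w => //= s t ->.
by rewrite map_wproj.
Qed.

Lemma map_quantifier_elim f : map_formula (quantifier_elim (@wproj K) f) =
  quantifier_elim (@wproj L) (map_formula f).
Proof.
have aux g m b : map_formula (foldr ord.Or ord.False
      (map (proj (@wproj K) m) (qf_to_odnf g b))) =
    foldr ord.Or ord.False (map (proj (@wproj L) m) (qf_to_odnf (map_formula g) b)).
  by rewrite -map_qf_to_odnf; elim: qf_to_odnf => //= c s ->; rewrite map_proj.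
elim: f => //= [f -> g ->|f -> g ->|f -> g ->|f ->|m f <-|m f <-] //;
  by rewrite aux.
Qed.

Lemma eval_map e t : GRing.rterm t ->
  GRing.eval (map i e) (map_term t) = i (GRing.eval e t).
Proof.
elim: t => //= [k|n|t IHt u IHu|t IHt|t IHt n|t IHt u IHu|t IHt n].
- by rewrite -(rmorph0 i) nth_map_default.
- by rewrite rmorph_nat.
- by move=> /andP[/IHt -> /IHu ->]; rewrite rmorphD.
- by move=> /IHt ->; rewrite rmorphN.
- by move=> /IHt ->; rewrite rmorphMn.
- by move=> /andP[/IHt -> /IHu ->]; rewrite rmorphM.
- by move=> /IHt ->; rewrite rmorphXn.
Qed.

Lemma qf_eval_map e f : rformula f ->
  ord.qf_eval (map i e) (map_formula f) = ord.qf_eval e f.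
Proof.
elim: f => //= [t u|t u|t u|f IHf g IHg|f IHf g IHg|f IHf g IHg|f IHf].
- by move=> /andP[rt ru]; rewrite !eval_map // (inj_eq (fmorph_inj i)).
- by move=> /andP[rt ru]; rewrite !eval_map // rcf_rmorph_lt.
- by move=> /andP[rt ru]; rewrite !eval_map // rcf_rmorph_le.
- by move=> /andP[/IHf -> /IHg ->].
- by move=> /andP[/IHf -> /IHg ->].
- by move=> /andP[/IHf -> /IHg ->].
- by move=> /IHf ->.
Qed.

Lemma map_formula_rformula f : rformula f -> rformula (map_formula f).
Proof.
have rt t : GRing.rterm t -> GRing.rterm (map_term t).
  by elim: t => //= [t IHt u IHu|t IHt u IHu] /andP[/IHt -> /IHu ->].
by elim: f => //= [t u|t u|t u|f IHf g IHg|f IHf g IHg|f IHf g IHg]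
  /andP[]; do ?[move=> /rt ->|move=> /IHf ->|move=> /IHg ->].
Qed.

(** Elimination turns both formulas into the same quantifier-free formula up to [i], and [i]
    preserves the truth of such a formula because it reflects the order. *)
Theorem transfer e f : rformula f ->
  ord.holds (map i e) (map_formula f) <-> ord.holds e f.
Proof.
move=> rf.
have P (M : rcfType) := quantifier_elim_rformP (@wf_QE_wproj M) (@valid_QE_wproj M).
have /andP[_ rq] := quantifier_elim_wf (@wf_QE_wproj K) rf.
have PK := P K e f rf.
have PL := P L (map i e) (map_formula f) (map_formula_rformula rf).
have E := qf_eval_map e rq; rewrite map_quantifier_elim in E.
by split=> [/PL|/PK] h; [apply/PK; rewrite -E|apply/PL; rewrite E].
Qed.

End MapFormula.
End QuantifierElimination.

(* A shallow embedding of first-order formulas: a family of predicates, one for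
   each real closed extension [L] of [K], is definable when one formula over [K]
   describes all of them. A context is a nested pair of [m] matrices. *)
Section Definability.
Variables (K : rcfType) (n : nat).

Fixpoint ctx (L : Type) (m : nat) : Type :=
  if m is m'.+1 then (ctx L m' * 'M[L]_n)%type else unit.

Definition mx_seq (L : nmodType) (A : 'M[L]_n) : seq L :=
  codom (fun j => mxvec A ord0 j).

Fixpoint ctx_seq (L : nmodType) m : ctx L m -> seq L :=
  if m is m'.+1 then fun E => ctx_seq E.1 ++ mx_seq E.2 else fun=> [::].

Definition dscal m (s : forall L : rcfType, {rmorphism K -> L} -> ctx L m -> L) :=
  exists2 t : GRing.term K, GRing.rterm t & forall L i E,
    s L i E = GRing.eval (ctx_seq E) (QuantifierElimination.map_term i t).

Definition dmx m
    (A : forall L : rcfType, {rmorphism K -> L} -> ctx L m -> 'M[L]_n) :=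
  forall a b, dscal (fun L i E => A L i E a b).

Definition dform m
    (P : forall L : rcfType, {rmorphism K -> L} -> ctx L m -> Prop) :=
  exists2 f : ordered_qelim.ord.formula K, ordered_qelim.ord.rformula f &
    forall L i E, P L i E <->
      ordered_qelim.ord.holds (ctx_seq E) (QuantifierElimination.map_formula i f).

(** Used in both directions, with [K] as the common ground, it moves a closed statement from [R] to
    [F]. *)
Lemma transfer (P : forall L : rcfType, {rmorphism K -> L} -> Prop)
    (L : rcfType) (i : {rmorphism K -> L}) :
  dform (m := 0) (fun L i E => P L i) -> P L i <-> P K idfun.
Proof.
move=> [f rf fP]; have := QuantifierElimination.transfer i [::] rf.
have := QuantifierElimination.transfer idfun [::] rf.
have := fP L i tt; have := fP K idfun tt => /=.
tauto.
Qed.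

Section Closure.
Variable m : nat.
Implicit Types s t : forall L : rcfType, {rmorphism K -> L} -> ctx L m -> L.
Implicit Types A B : forall L : rcfType, {rmorphism K -> L} -> ctx L m -> 'M[L]_n.
Implicit Types P Q : forall L : rcfType, {rmorphism K -> L} -> ctx L m -> Prop.

Lemma dscal_const c : dscal (fun L i (E : ctx L m) => i c).
Proof. by exists (GRing.Const c). Qed.

Lemma dscal_nat k : dscal (fun L i (E : ctx L m) => k%:R).
Proof. by exists (GRing.NatConst _ k). Qed.

Lemma dscal0 : dscal (fun L i (E : ctx L m) => 0).
Proof. by exists (GRing.NatConst _ 0). Qed.

Lemma dscal1 : dscal (fun L i (E : ctx L m) => 1).
Proof. by exists (GRing.NatConst _ 1). Qed.

Lemma dscalD s t : dscal s -> dscal t -> dscal (fun L i E => s L i E + t L i E).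
Proof.
by move=> [u ru uE] [v rv vE]; exists (GRing.Add u v) => [/=|L i E];
  rewrite ?ru ?rv //= uE vE.
Qed.

Lemma dscalM s t : dscal s -> dscal t -> dscal (fun L i E => s L i E * t L i E).
Proof.
by move=> [u ru uE] [v rv vE]; exists (GRing.Mul u v) => [/=|L i E];
  rewrite ?ru ?rv //= uE vE.
Qed.

Lemma dscalN s : dscal s -> dscal (fun L i E => - s L i E).
Proof. by move=> [u ru uE]; exists (GRing.Opp u) => //= L i E; rewrite uE. Qed.

Lemma dscalX s k : dscal s -> dscal (fun L i E => s L i E ^+ k).
Proof. by move=> [u ru uE]; exists (GRing.Exp u k) => //= L i E; rewrite uE. Qed.

Lemma dscal_sum (I : Type) (r : seq I)
    (F : forall L : rcfType, {rmorphism K -> L} -> ctx L m -> I -> L) :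
  (forall k, dscal (fun L i E => F L i E k)) ->
  dscal (fun L i E => \sum_(k <- r) F L i E k).
Proof.
move=> dF; elim: r => [|k r [u ru uE]].
  by have [u ru uE] := dscal0; exists u => // L i E; rewrite big_nil (uE L i E).
have [v rv vE] := dF k.
by exists (GRing.Add v u) => [/=|L i E]; rewrite ?ru ?rv // big_cons vE uE.
Qed.

Lemma dscal_prod (I : Type) (r : seq I)
    (F : forall L : rcfType, {rmorphism K -> L} -> ctx L m -> I -> L) :
  (forall k, dscal (fun L i E => F L i E k)) ->
  dscal (fun L i E => \prod_(k <- r) F L i E k).
Proof.
move=> dF; elim: r => [|k r [u ru uE]].
  by have [u ru uE] := dscal1; exists u => // L i E; rewrite big_nil (uE L i E).
have [v rv vE] := dF k.
by exists (GRing.Mul v u) => [/=|L i E]; rewrite ?ru ?rv // big_cons vE uE.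
Qed.

Lemma dscal_ext s t : (forall L i E, s L i E = t L i E) -> dscal s -> dscal t.
Proof. by move=> st [u ru uE]; exists u => // L i E; rewrite -st uE. Qed.

Lemma dscal_mxeval p A : dmx A -> dscal (fun L i E => mxeval i p (A L i E)).
Proof.
move=> dA; have [r rP] := MultivariatePolynomials.mxeval_monoms p.
apply: (@dscal_ext (fun L i E => monoms i r (A L i E))) => [L i E|].
  by rewrite rP.
apply: dscal_sum => t; apply: dscalM; first exact: dscal_const.
by apply: dscal_prod => a; apply: dscal_prod => b; apply: dscalX; apply: dA.
Qed.

Lemma dscal_det A : dmx A -> dscal (fun L i E => \det (A L i E)).
Proof.
move=> dA; apply: dscal_sum => s; apply: dscalM.
  by apply: dscalX; apply: dscalN; apply: dscal1.
by apply: dscal_prod => a; apply: dA.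
Qed.

Lemma dmx_const (Q : 'M[K]_n) : dmx (fun L i (E : ctx L m) => map_mx i Q).
Proof.
move=> a b; apply: dscal_ext (dscal_const (Q a b)) => L i E; by rewrite mxE.
Qed.

Lemma dmx1 : dmx (fun L i (E : ctx L m) => 1%:M).
Proof.
move=> a b; apply: dscal_ext (dscal_nat (a == b)) => L i E.
by rewrite mxE; case: eqP.
Qed.

Lemma dmx_mul A B : dmx A -> dmx B -> dmx (fun L i E => A L i E *m B L i E).
Proof.
move=> dA dB a b.
apply: (@dscal_ext (fun L i E => \sum_(c < n) A L i E a c * B L i E c b)) => [L i E|].
  by rewrite mxE.
by apply: dscal_sum => c; apply: dscalM.
Qed.

Lemma dmx_tr A : dmx A -> dmx (fun L i E => (A L i E)^T).
Proof.
by move=> dA a b; apply: dscal_ext (dA b a) => L i E; rewrite mxE.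
Qed.

Lemma dmxD A B : dmx A -> dmx B -> dmx (fun L i E => A L i E + B L i E).
Proof.
move=> dA dB a b; apply: (@dscal_ext (fun L i E => A L i E a b + B L i E a b)).
  by move=> L i E; rewrite mxE.
by apply: dscalD.
Qed.

Lemma dmxN A : dmx A -> dmx (fun L i E => - A L i E).
Proof.
move=> dA a b; apply: (@dscal_ext (fun L i E => - A L i E a b)).
  by move=> L i E; rewrite mxE.
by apply: dscalN.
Qed.

Lemma dmxZ s A : dscal s -> dmx A -> dmx (fun L i E => s L i E *: A L i E).
Proof.
move=> ds dA a b; apply: (@dscal_ext (fun L i E => s L i E * A L i E a b)).
  by move=> L i E; rewrite mxE.
by apply: dscalM.
Qed.

Lemma dform_ext P Q : (forall L i E, P L i E <-> Q L i E) -> dform P -> dform Q.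
Proof.
move=> PQ [f rf fP]; exists f => // L i E.
exact: iff_trans (iff_sym (PQ L i E)) (fP L i E).
Qed.

Lemma dform_eq s t : dscal s -> dscal t -> dform (fun L i E => s L i E = t L i E).
Proof.
move=> [u ru uE] [v rv vE].
by exists (ordered_qelim.ord.Equal u v) => [/=|L i E]; rewrite ?ru ?rv //= uE vE.
Qed.

Lemma dform_lt s t : dscal s -> dscal t -> dform (fun L i E => s L i E < t L i E).
Proof.
move=> [u ru uE] [v rv vE].
by exists (ordered_qelim.ord.Lt u v) => [/=|L i E]; rewrite ?ru ?rv //= uE vE.
Qed.

Lemma dform_le s t : dscal s -> dscal t -> dform (fun L i E => s L i E <= t L i E).
Proof.
move=> [u ru uE] [v rv vE].
by exists (ordered_qelim.ord.Le u v) => [/=|L i E]; rewrite ?ru ?rv //= uE vE.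
Qed.

Lemma dform_and P Q : dform P -> dform Q -> dform (fun L i E => P L i E /\ Q L i E).
Proof.
move=> [f rf fP] [g rg gP].
exists (ordered_qelim.ord.And f g) => [/=|L i E]; first by rewrite rf rg.
by rewrite /= -fP -gP.
Qed.

Lemma dform_or P Q : dform P -> dform Q -> dform (fun L i E => P L i E \/ Q L i E).
Proof.
move=> [f rf fP] [g rg gP].
exists (ordered_qelim.ord.Or f g) => [/=|L i E]; first by rewrite rf rg.
by rewrite /= -fP -gP.
Qed.

Lemma dform_imp P Q : dform P -> dform Q -> dform (fun L i E => P L i E -> Q L i E).
Proof.
move=> [f rf fP] [g rg gP].
exists (ordered_qelim.ord.Implies f g) => [/=|L i E]; first by rewrite rf rg.
by rewrite /= -fP -gP.
Qed.

Lemma dform_iff P Q : dform P -> dform Q -> dform (fun L i E => P L i E <-> Q L i E).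
Proof. by move=> dP dQ; apply: dform_and; apply: dform_imp. Qed.

Lemma dform_not P : dform P -> dform (fun L i E => ~ P L i E).
Proof.
by move=> [f rf fP]; exists (ordered_qelim.ord.Not f) => //= L i E; rewrite -fP.
Qed.

Lemma dform_True : dform (fun L i (E : ctx L m) => True).
Proof. by exists (ordered_qelim.ord.Bool true). Qed.

Lemma dform_all (I : eqType) (r : seq I)
    (P : forall L : rcfType, {rmorphism K -> L} -> ctx L m -> I -> Prop) :
  (forall k, dform (fun L i E => P L i E k)) ->
  dform (fun L i E => forall k, k \in r -> P L i E k).
Proof.
move=> dP; elim: r => [|k r IH]; first by apply: dform_ext dform_True.
apply: dform_ext (dform_and (dP k) IH) => L i E; split=> [[Pk Pr] j|Pkr].
  by rewrite inE => /orP[/eqP ->|/Pr].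
by split=> [|j jr]; apply: Pkr; rewrite inE ?eqxx ?jr ?orbT.
Qed.

Lemma dform_forall_fin (I : finType)
    (P : forall L : rcfType, {rmorphism K -> L} -> ctx L m -> I -> Prop) :
  (forall k, dform (fun L i E => P L i E k)) ->
  dform (fun L i E => forall k, P L i E k).
Proof.
move=> dP; apply: dform_ext (dform_all (enum I) dP) => L i E.
by split=> Pk k; [apply: Pk; rewrite mem_enum|].
Qed.

Lemma dform_mxeq A B : dmx A -> dmx B -> dform (fun L i E => A L i E = B L i E).
Proof.
move=> dA dB; have d : dform (fun L i E => forall a b, A L i E a b = B L i E a b).
  by apply: dform_forall_fin => a; apply: dform_forall_fin => b; apply: dform_eq.
by apply: dform_ext d => L i E; split=> [AB|-> //]; apply/matrixP.
Qed.

Lemma dform_sa f A : dmx A -> dform (fun L i E => sa_set i f (A L i E)).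
Proof.
move=> dA; elim: f => [p|f IH|f IHf g IHg].
- by apply: dform_lt; [apply: dscal0|apply: dscal_mxeval].
- by apply: dform_ext (dform_not IH) => L i E; split=> /negP.
- apply: dform_ext (dform_and IHf IHg) => L i E; rewrite /sa_set /=.
  by split=> [[-> ->]|/andP[]].
Qed.

(** [G] may be infinite; a finite basis has the same zeros over every extension and is therefore one
    formula. *)
Lemma dform_zeros (G : set (mxpol n K)) A :
  dmx A -> dform (fun L i E => zeros i G (A L i E)).
Proof.
move=> dA; have [N [r [rG rP]]] := MultivariatePolynomials.finite_basis_ord G.
have d : dform (fun L i E => forall k, mxeval i (r k) (A L i E) = 0).
  by apply: dform_forall_fin => p; apply: dform_eq; [apply: dscal_mxeval|apply: dscal0].
by apply: dform_ext d => L i E; split=> [/rP|AG p]; last apply: AG.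
Qed.

End Closure.

Lemma size_mx_seq (L : nmodType) (A : 'M[L]_n) : size (mx_seq A) = (n * n)%N.
Proof. by rewrite size_codom card_ord. Qed.

Lemma size_ctx_seq (L : nmodType) m (E : ctx L m) :
  size (ctx_seq E) = (m * (n * n))%N.
Proof.
by elim: m E => //= m IH E; rewrite size_cat IH size_mx_seq mulSn addnC.
Qed.

Lemma nth_mx_seq (L : nmodType) (A : 'M[L]_n) a b :
  nth 0 (mx_seq A) (mxvec_index a b) = A a b.
Proof.
rewrite /mx_seq /codom /image_mem (nth_map (mxvec_index a b)) ?size_enum_ord //.
by rewrite nth_ord_enum mxvecE.
Qed.

(** The newest matrix of a context is laid out last, so the positions of older variables stay valid
    in a longer context. The second conjunct feeds the next application. *)
Lemma dmx_var_weaken m (v : forall L : rcfType, ctx L m -> 'M[L]_n) :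
  (exists2 x : 'I_n -> 'I_n -> nat, (forall a b, (x a b < m * (n * n))%N) &
    forall (L : rcfType) (E : ctx L m) a b, v L E a b = nth 0 (ctx_seq E) (x a b)) ->
  dmx (fun L (i : {rmorphism K -> L}) E => v L E) /\
  (exists2 x : 'I_n -> 'I_n -> nat, (forall a b, (x a b < m.+1 * (n * n))%N) &
    forall (L : rcfType) (E : ctx L m.+1) a b, v L E.1 a b = nth 0 (ctx_seq E) (x a b)).
Proof.
move=> [x xm xE]; split.
  by move=> a b; exists (GRing.Var _ (x a b)) => // L i E; rewrite xE.
exists x => [a b|L E a b]; first by apply: leq_trans (xm a b) _; rewrite mulSn leq_addl.
by rewrite xE /= nth_cat size_ctx_seq xm.
Qed.

Lemma dvar0 m : exists2 x : 'I_n -> 'I_n -> nat,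
  (forall a b, (x a b < m.+1 * (n * n))%N) &
    forall (L : rcfType) (E : ctx L m.+1) a b, E.2 a b = nth 0 (ctx_seq E) (x a b).
Proof.
exists (fun a b => (m * (n * n) + mxvec_index a b)%N) => [a b|L E a b].
  by rewrite mulSn addnC ltn_add2r.
by rewrite /= nth_cat size_ctx_seq ltnNge leq_addr addKn nth_mx_seq.
Qed.

Lemma dmx_var0 m : dmx (m := m.+1) (fun L i E => E.2).
Proof. exact: (dmx_var_weaken (dvar0 m)).1. Qed.
Let dvar1 m := (dmx_var_weaken (dvar0 m)).2.
Lemma dmx_var1 m : dmx (m := m.+2) (fun L i E => E.1.2).
Proof. exact: (dmx_var_weaken (dvar1 m)).1. Qed.
Let dvar2 m := (dmx_var_weaken (dvar1 m)).2.
Lemma dmx_var2 m : dmx (m := m.+3) (fun L i E => E.1.1.2).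
Proof. exact: (dmx_var_weaken (dvar2 m)).1. Qed.
Let dvar3 m := (dmx_var_weaken (dvar2 m)).2.
Lemma dmx_var3 m : dmx (m := m.+4) (fun L i E => E.1.1.1.2).
Proof. exact: (dmx_var_weaken (dvar3 m)).1. Qed.
Let dvar4 m := (dmx_var_weaken (dvar3 m)).2.
Lemma dmx_var4 m : dmx (m := m.+4.+1) (fun L i E => E.1.1.1.1.2).
Proof. exact: (dmx_var_weaken (dvar4 m)).1. Qed.

Lemma dform_exists m
    (P : forall L : rcfType, {rmorphism K -> L} -> ctx L m -> 'M[L]_n -> Prop) :
  dform (m := m.+1) (fun L i E => P L i E.1 E.2) ->
  dform (fun L i E => exists X, P L i E X).
Proof.
move=> [f rf fP].
(* The entries of the new matrix follow those of the context, so the variables to bind are the next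
   [n * n] numbers. *)
exists (foldr (@ordered_qelim.ord.Exists K) f (iota (m * (n * n)) (n * n))).
  by elim: (iota _ _).
move=> L i E; have -> : (exists X, P L i E X) <-> exists2 s, size s = (n * n)%N &
    ordered_qelim.ord.holds (ctx_seq E ++ s) (QuantifierElimination.map_formula i f).
  split=> [[X /(fP L i (E, X)) fX]|[s sn fs]].
    by exists (mx_seq X); rewrite ?size_mx_seq.
  exists (vec_mx (\row_j nth 0 s j)); apply/(fP L i (E, _)) => /=.
  suff -> : mx_seq (vec_mx (\row_j nth 0 s j)) = s by [].
  apply: (@eq_from_nth _ 0) => [|j]; rewrite size_mx_seq // => jn.
  have -> : j = Ordinal jn :> nat by [].
  case/mxvec_indexP: (Ordinal jn) => a b; by rewrite nth_mx_seq !mxE.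
(* Each quantifier writes just past the end of the sequence, which amounts to [rcons]. *)
rewrite -(size_ctx_seq E); elim: (n * n)%N (ctx_seq E) => [|k IH] e /=.
  split=> [[s /size0nil ->]|fe]; first by rewrite cats0.
  by exists [::]; rewrite ?cats0.
split=> [[[//|x s] [sk]]|[x]].
  rewrite -cat_rcons => fs; exists x; rewrite set_nthE ltnn subnn /= cats1.
  by have := IH (rcons e x); rewrite size_rcons => <-; exists s.
rewrite set_nthE ltnn subnn /= cats1.
have := IH (rcons e x); rewrite size_rcons => <- [s sk].
by rewrite cat_rcons => fs; exists (x :: s) => //=; rewrite sk.
Qed.

Lemma dform_forall m
    (P : forall L : rcfType, {rmorphism K -> L} -> ctx L m -> 'M[L]_n -> Prop) :
  dform (m := m.+1) (fun L i E => P L i E.1 E.2) ->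
  dform (fun L i E => forall X, P L i E X).
Proof.
move=> dP; have d := dform_not (dform_exists (P := fun L i E X => ~ P L i E X) (dform_not dP)).
apply: dform_ext d => L i E; split=> [nP X|PX [X]]; last by apply.
by apply: contrapT => nPX; apply: nP; exists X.
Qed.

End Definability.

(** * Symmetric matrices *)

Module SpectralTheory.
Import sesquilinear spectral.

Section Symmetric.
Variable K : rcfType.

(** Over [K[i]] the matrix is hermitian, so the spectral theorem diagonalizes it with real
    eigenvalues; two real matrices that are similar over [K[i]] are similar over [K]. *)
Lemma symmetric_diagonalizable n (A : 'M[K]_n) : A^T = A -> diagonalizable A.
Proof.
move=> symA; pose c : {rmorphism K -> K[i]%C} := real_complex K.
have realc m1 m2 (B : 'M[K]_(m1, m2)) : map_mx c B \is a realmx.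
  by apply/mxOverP => i j; rewrite mxE; apply/complex_realP; exists (B i j).
have hermA : map_mx c A \is hermsymmx.
  apply: realsym_hermsym (realc _ _ A); apply/is_hermitianmxP.
  by rewrite expr0 scale1r map_mx_id // map_trmx symA.
have /mxOverP realD := hermitian_spectral_diag_real hermA.
have /orthomx_spectralP AE := hermitian_normalmx hermA.
set P := spectralmx _ in AE; set D := spectral_diag _ in AE realD.
have uP : P \in unitmx := spectral_unit _.
pose D0 : 'rV[K]_n := map_mx (@complex.Re K) D.
have DE : D = map_mx c D0.
  by apply/matrixP => i j; rewrite !mxE -[c _]/(real_complex K _) RRe_real.
have sim : simmx_in unitmx (map_mx c A) (map_mx c (diag_mx D0)).
  exists P => //; apply/simmxP => //.
  by rewrite map_diag_mx -DE [in LHS]AE !mulmxA mulmxV // mul1mx.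
have [Q] := real_similar sim (realc _ _ _) (realc _ _ _).
rewrite inE => /andP[/mxOverP realQ uQ] /(simmxP uQ) QA.
pose Q0 := map_mx (@complex.Re K) Q.
have QE : Q = map_mx c Q0.
  by apply/matrixP => i j; rewrite !mxE -[c _]/(real_complex K _) RRe_real.
have uQ0 : Q0 \in unitmx by move: uQ; rewrite QE map_unitmx.
exists Q0 => //; apply/(diagonalizable_forLR uQ0); exists D0.
apply/(simmxLR uQ0)/(simmxP uQ0).
by move: QA; rewrite QE -!map_mxM => /map_mx_inj.
Qed.

(** Symmetric Gaussian elimination stays inside the classes of [e]: an entry [(i, j)] newly created
    in the Schur complement [C'] has [b] nonzero at both [i] and [j], so both indices are related to
    the pivot. *)
Lemma cholesky n (e : rel 'I_n) (M : 'M[K]_n) :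
  reflexive e -> symmetric e -> transitive e ->
  M^T = M -> (forall v : 'rV_n, v != 0 -> 0 < (v *m M *m v^T) 0 0) ->
  (forall i j, M i j != 0 -> e i j) ->
  exists2 L : 'M[K]_n, L *m M *m L^T = 1%:M & forall i j, L i j != 0 -> e i j.
Proof.
elim: n e M => [|n IH] e M eR eS eT.
  by exists 1%:M => [|[]//]; rewrite trmx1 [LHS]flatmx0 [RHS]flatmx0.
rewrite -[n.+1]/(1 + n)%N in e M eR eS eT *.
rewrite -[M]submxK.
set a := ulsubmx M; set b := ursubmx M; set C := drsubmx M.
move=> symM; have [aT dl CT] : [/\ a^T = a, dlsubmx M = b^T & C^T = C].
  by move: symM; rewrite tr_block_mx => /eq_block_mx[-> _ -> ->].
rewrite {}dl => posM eM; set m := a 0 0.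
have aE : a = m%:M by rewrite [a]mx11_scalar.
have m0 : 0 < m.
  have := posM (row_mx 1%:M 0); rewrite tr_row_mx mul_row_block !mul0mx !addr0.
  rewrite mul_row_col trmx0 mulmx0 addr0 trmx1 mul1mx mulmx1; apply.
  apply/eqP => /matrixP/(_ 0 (lshift n 0)); rewrite row_mxEl !mxE eqxx.
  by move/eqP; rewrite oner_eq0.
have m0' : m != 0 by rewrite gt_eqF.
pose E : 'M[K]_(1 + n) := block_mx 1%:M 0 (- m^-1 *: b^T) 1%:M.
pose C' := C - m^-1 *: (b^T *m b).
have EME : E *m block_mx a b b^T C *m E^T = block_mx a 0 0 C'.
  rewrite /E tr_block_mx !mulmx_block !trmx1 trmx0 linearZ /= trmxK.
  rewrite !(mul0mx, mulmx0, mul1mx, mulmx1, addr0, add0r).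
  have aE' : (- m^-1 *: b^T) *m a = - b^T.
    by rewrite aE mul_mx_scalar scalerA mulrN divff // scaleN1r.
  rewrite aE' addNr mul0mx add0r -!scalemxAr aE -scalemxAl mul_scalar_mx.
  rewrite scalerA mulNr mulVf // scaleN1r addNr.
  by congr block_mx; rewrite /C' addrC scaleNr scalemxAl.
have C'T : C'^T = C'.
  by rewrite /C' linearB linearZ /= trmx_mul trmxK CT.
have C'pos (v : 'rV_n) : v != 0 -> 0 < (v *m C' *m v^T) 0 0.
  move=> v0; pose w : 'rV_(1 + n) := row_mx 0 v *m E.
  have -> : v *m C' *m v^T = w *m block_mx a b b^T C *m w^T.
    rewrite /w trmx_mul !mulmxA -(mulmxA _ E) -(mulmxA _ (E *m _)) EME.
    by rewrite mul_row_block tr_row_mx mul_row_col !(mul0mx, mulmx0, add0r).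
  apply: posM; rewrite /w mul_row_block !mul0mx !add0r mulmx1.
  apply: contra_neq v0 => /eqP; rewrite -[0 in X in X -> _]row_mx0.
  by move=> /eqP/eq_row_mx[].
have eb j : b 0 j != 0 -> e (lshift n 0) (rshift 1 j).
  by move=> bj; apply: eM; rewrite block_mxEur.
have [L' L'M eL'] : exists2 L : 'M[K]_n, L *m C' *m L^T = 1%:M &
    forall i j, L i j != 0 -> e (rshift 1 i) (rshift 1 j).
  apply: (IH (fun i j => e (rshift 1 i) (rshift 1 j))).
  - by move=> i; refine (eR _).
  - by move=> i j; refine (eS _ _).
  - by move=> i j k; refine (eT _ _ _).
  - by [].
  - by [].
  move=> i j; have [Cij|Cij] := eqVneq (C i j) 0.
    rewrite /C' mxE Cij add0r mxE oppr_eq0 mxE mxE big_ord1 [b^T i 0]mxE => h.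
    have bi : b 0 i != 0 by apply: contra_neq h => ->; rewrite mul0r mulr0.
    have bj : b 0 j != 0 by apply: contra_neq h => ->; rewrite !mulr0.
    by apply: eT (eb _ bj); rewrite eS; apply: eb.
  by move=> _; apply: eM; rewrite block_mxEdr.
pose D : 'M[K]_(1 + n) := block_mx (Num.sqrt m)^-1%:M 0 0 L'.
exists (D *m E).
  rewrite trmx_mul !mulmxA -(mulmxA _ E) -(mulmxA _ (E *m _)) EME.
  rewrite /D tr_block_mx !mulmx_block !trmx0 tr_scalar_mx.
  rewrite !(mul0mx, mulmx0, addr0, add0r) L'M aE -!scalar_mxM.
  suff -> : (Num.sqrt m)^-1 * m * (Num.sqrt m)^-1 = 1 by rewrite -scalar_mx_block.
  by rewrite mulrAC -invfM -expr2 sqr_sqrtr ?ltW // mulVf.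
have -> : D *m E = block_mx (Num.sqrt m)^-1%:M 0 (- m^-1 *: (L' *m b^T)) L'.
  by rewrite /D mulmx_block !(mul0mx, mulmx0, mulmx1, addr0, add0r) -scalemxAr.
move=> i j; rewrite -(splitK i) -(splitK j).
case: (split i) => {}i; case: (split j) => {}j /=;
  rewrite ?(block_mxEul, block_mxEur, block_mxEdl, block_mxEdr).
- by rewrite !ord1.
- by rewrite mxE eqxx.
- rewrite ord1 !mxE mulf_eq0 negb_or => /andP[_] h.
  have [k] : exists k, L' i k * b^T k 0 != 0.
    apply: contrapT => nk; move: h; rewrite big1 ?eqxx // => k _.
    by apply/eqP/negPn/negP => hk; apply: nk; exists k.
  rewrite mulf_eq0 negb_or mxE => /andP[/eL' eik /eb ek].
  by apply: eT eik _; rewrite eS.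
- exact: eL'.
Qed.

(* The Gram matrix of the eigenvectors given by [P] respects the joint
   eigenspaces of [S], and so does its Cholesky factor. *)
Lemma orthogonal_diagonalization (C : fieldType) (c : {rmorphism K -> C}) n
    (S : set 'M[C]_n) (P : 'M[K]_n) :
  P \in unitmx -> (forall A, S A -> A^T = A) ->
  (forall A, S A -> is_diag_mx (map_mx c P *m A *m invmx (map_mx c P))) ->
  exists2 Q : 'M[K]_n, Q *m Q^T = 1%:M &
    forall A, S A -> is_diag_mx (map_mx c Q *m A *m (map_mx c Q)^T).
Proof.
move=> uP symS diagS; pose M := P *m P^T; pose Pc := map_mx c P.
have uPc : Pc \in unitmx by rewrite map_unitmx.
pose d A i := (Pc *m A *m invmx Pc) i i.
(* Two indices are related when their eigenvectors lie in the same joint eigenspace of [S]. *)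
pose e i j := `[< forall A, S A -> d A i = d A j >].
have diagE A : S A -> Pc *m A *m invmx Pc = diag_mx (\row_i d A i).
  move=> /diagS/is_diag_mxP h; apply/matrixP => i j; rewrite [RHS]mxE [X in X *+ _]mxE.
  by case: (eqVneq i j) => [->|ij] //=; rewrite h.
have PA A : S A -> Pc *m A = diag_mx (\row_i d A i) *m Pc.
  by move=> SA; rewrite -diagE // mulmxKV.
(* As [A] is symmetric, transposing [P A = D P] gives [A P^T = P^T D], so [D] commutes with the Gram
   matrix [P P^T]. *)
have MC A : S A -> diag_mx (\row_i d A i) *m map_mx c M = map_mx c M *m diag_mx (\row_i d A i).
  move=> SA; rewrite /M map_mxM -map_trmx -/Pc mulmxA -PA // -!mulmxA; congr mulmx.
  by rewrite -[X in X *m _](symS A SA) -trmx_mul PA // trmx_mul tr_diag_mx.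
have [L LM eL] : exists2 L : 'M[K]_n, L *m M *m L^T = 1%:M &
    forall i j, L i j != 0 -> e i j.
  apply: cholesky.
  - by move=> i; apply/asboolP.
  - by move=> i j; apply/asboolP/asboolP => h A SA; rewrite h.
  - by move=> i j k /asboolP ji /asboolP ik; apply/asboolP => A SA; rewrite ji ?ik.
  - by rewrite trmx_mul trmxK.
  - move=> v v0; have : v *m P != 0 by rewrite mulmx_free_eq0 // row_free_unit.
    rewrite mulmxA -mulmxA -trmx_mul; set w := v *m P => w0.
    rewrite mxE lt_neqAle; apply/andP; split; last first.
      by apply: sumr_ge0 => i _; rewrite [w^T _ _]mxE -expr2 sqr_ge0.
    rewrite eq_sym psumr_eq0; last by move=> i _; rewrite [w^T _ _]mxE -expr2 sqr_ge0.
    apply: contra_neqN w0 => /allP w0; apply/rowP => i.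
    have := w0 i; rewrite mem_index_enum [w^T _ _]mxE -expr2 sqrf_eq0.
    by move=> /(_ isT)/eqP ->; rewrite mxE.
  - move=> i j Mij; apply/asboolP => A /MC /matrixP/(_ i j).
    rewrite mul_diag_mx mul_mx_diag mxE [RHS]mxE [X in X * _]mxE.
    rewrite [X in _ = _ * X]mxE mulrC; apply: mulfI.
    by rewrite mxE fmorph_eq0.
have LC A : S A -> map_mx c L *m diag_mx (\row_i d A i) = diag_mx (\row_i d A i) *m map_mx c L.
  move=> SA; apply/matrixP => i j; rewrite mul_diag_mx mul_mx_diag !mxE.
  have [->|/eL/asboolP/(_ A SA) ->] := eqVneq (L i j) 0.
    by rewrite rmorph0 mul0r mulr0.
  by rewrite mulrC.
exists (L *m P); first by rewrite trmx_mul mulmxA -[L *m P *m _]mulmxA LM.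
move=> A SA; rewrite map_mxM trmx_mul -(mulmxA _ (map_mx c P)) PA //.
rewrite !mulmxA LC // -!mulmxA (mulmxA Pc) (mulmxA (map_mx c L)).
have -> : Pc *m (map_mx c P)^T = map_mx c M by rewrite /M map_mxM -map_trmx.
rewrite [X in _ *m X](_ : _ = 1%:M) ?mulmx1 ?diag_mx_is_diag //.
by rewrite map_trmx -!map_mxM LM map_mx1.
Qed.

Lemma symmetric_codiagonalization n (s : seq 'M[K]_n) :
  {in s, forall A, A^T = A} -> {in s &, forall A B, A *m B = B *m A} ->
  exists2 Q : 'M[K]_n, Q *m Q^T = 1%:M &
    forall A, A \in s -> is_diag_mx (Q *m A *m Q^T).
Proof.
move=> symS comS; have [P uP /allP diagP] : codiagonalizable s.
  apply/codiagonalizableP; split=> // A As.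
  exact/symmetric_diagonalizable/symS.
have [A|Q QQ Qs] := orthogonal_diagonalization (c := idfun)
    (S := [set A | A \in s]) uP symS.
  by rewrite map_mx_id // => /diagP/(diagonalizable_forP _ uP) h; apply/is_diag_mxP.
by exists Q => // A As; have := Qs A As; rewrite map_mx_id.
Qed.

End Symmetric.

End SpectralTheory.
Import SpectralTheory.

(** * Tori *)

Section Dedekind.
Variables (C : fieldType) (T : Type) (mul : T -> T -> T) (one : T) (D : set T).
Variables (I : finType) (chi : I -> T -> C).
Hypothesis D1 : D one.
Hypothesis DM : forall x y, D x -> D y -> D (mul x y).
Hypothesis chi1 : forall j, chi j one = 1.
Hypothesis chiM : forall j x y, D x -> D y -> chi j (mul x y) = chi j x * chi j y.

Let same j k := `[< forall x, D x -> chi j x = chi k x >].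

(** The characters may coincide on [D], hence the sum over a class. Take [x] with
    [chi j0 x != chi k x]: subtracting [chi j0 x] times the relation from its translate by [x]
    removes [j0] and brings in no new index. Once only the class of [k] is left, evaluate at
    [one]. *)
Lemma dedekind (c : I -> C) k :
  (forall x, D x -> \sum_j c j * chi j x = 0) -> \sum_(j | same j k) c j = 0.
Proof.
have [N] := ubnP #|[pred j | (c j != 0) && ~~ same j k]|.
elim: N c => // N IH c cN c0.
have [j0 /andP[cj0 /asboolPn nj0]|none] := pickP (fun j => (c j != 0) && ~~ same j k).
  have [x Dx xj0] : exists2 x, D x & chi j0 x != chi k x.
    apply: contrapT => nx; apply: nj0 => x Dx.
    by apply/eqP/negPn/negP => h; apply: nx; exists x.
  pose c' j := c j * (chi j x - chi j0 x).
  have : \sum_(j | same j k) c' j = 0.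
    apply: IH => [|y Dy].
      rewrite -ltnS; apply: leq_trans cN; rewrite ltnS; apply: proper_card.
      apply/fintype.properP; split.
        by apply/fintype.subsetP => j; rewrite !inE mulf_eq0 negb_or => /andP[/andP[-> _] ->].
      exists j0; first by rewrite inE cj0; apply/asboolPn.
      rewrite inE negb_and negbK.
      by rewrite /c' subrr mulr0 eqxx.
    have E : \sum_j c' j * chi j y =
        \sum_j c j * chi j (mul x y) - chi j0 x * \sum_j c j * chi j y.
      rewrite mulr_sumr -sumrB; apply: eq_bigr => j _; rewrite /c' chiM //.
      by rewrite mulrBr mulrBl mulrA [chi j0 x * _]mulrCA mulrA.
    by rewrite E !c0 ?mulr0 ?subr0 //; apply: DM.
  rewrite (eq_bigr (fun j => (chi k x - chi j0 x) * c j)); last first.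
    by move=> j /asboolP/(_ x Dx); rewrite /c' => ->; rewrite mulrC.
  rewrite -mulr_sumr => /eqP; rewrite mulf_eq0 => /orP[|/eqP//].
  by rewrite subr_eq0 eq_sym (negbTE xj0).
have := c0 one D1; rewrite (bigID (fun j => same j k)) /= [X in _ + X]big1.
  by rewrite addr0 => h; rewrite -[RHS]h; apply: eq_bigr => j _; rewrite chi1 mulr1.
by move=> j nj; have := none j; rewrite nj andbT => /negbFE/eqP ->; rewrite mul0r.
Qed.

(** The coefficients of a relation on [D] sum to 0 over each class of equal characters, so the
    relation survives the substitution of any values that are constant on classes. [r] picks a
    representative of each class. *)
Lemma dedekind_eval (c e : I -> C) :
  (forall x, D x -> \sum_j c j * chi j x = 0) ->
  (forall j k, (forall x, D x -> chi j x = chi k x) -> e j = e k) ->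
  \sum_j c j * e j = 0.
Proof.
move=> c0 eP; pose r j := odflt j [pick k | same k j].
have rP j : same (r j) j.
  by rewrite /r; case: pickP => [//|/(_ j)] /= /asboolP[].
have rE j k : same j k -> r j = r k.
  move=> /asboolP jk; have E : (fun l => same l j) =1 (fun l => same l k).
    by move=> l; apply/asboolP/asboolP => h x Dx; rewrite h // jk.
  rewrite /r (eq_pick E); case: pickP => // /(_ k) /asboolP[] //.
rewrite (partition_big r predT) //= big1 // => k _.
rewrite (eq_bigr (fun j => e k * c j)); last first.
  move=> j /eqP <-; rewrite mulrC; congr (_ * _); apply/esym/eP => x Dx.
  by have /asboolP -> := rP j.
rewrite -mulr_sumr; have [rk|rk] := eqVneq (r k) k.
  rewrite (eq_bigl (same^~ k)) ?dedekind ?mulr0 // => j.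
  apply/eqP/idP => [<-|/rE ->//]; apply/asboolP => x Dx.
  by have /asboolP -> := rP j.
rewrite big1 ?mulr0 // => j /eqP rj; case/eqP: rk.
by rewrite -rj; apply: rE.
Qed.

End Dedekind.

(** * Monomials and the closure of diagonal groups *)

Definition vmul (L : fieldType) n (x y : 'rV[L]_n) : 'rV[L]_n := \row_j (x 0 j * y 0 j).

Definition vmon (L : fieldType) n (m : 'I_n -> nat) (x : 'rV[L]_n) : L :=
  \prod_j x 0 j ^+ m j.

Lemma vmon_mul (L : fieldType) n m (x y : 'rV[L]_n) :
  vmon m (vmul x y) = vmon m x * vmon m y.
Proof. by rewrite /vmon -big_split; apply: eq_bigr => j _; rewrite mxE exprMn. Qed.

Lemma vmon1 (L : fieldType) n m : vmon m (const_mx 1 : 'rV[L]_n) = 1.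
Proof. by rewrite /vmon big1 // => j _; rewrite mxE expr1n. Qed.

(* The binomial closure of [D], which turns out to be its Zariski closure. *)
Definition vclosure (L : fieldType) n (D : set 'rV[L]_n) : set 'rV[L]_n :=
  [set d | forall m m', (forall x, D x -> vmon m x = vmon m' x) -> vmon m d = vmon m' d].

Section Density.
Variables (K L : fieldType) (i : {rmorphism K -> L}) (n : nat).

Definition laurent (phi : 'rV[L]_n -> L) :=
  exists (N : nat) (c : 'I_N -> L) (m : 'I_N -> 'I_n -> nat),
    forall d, phi d = \sum_j c j * vmon (m j) d.

Lemma laurent_const c : laurent (fun=> c).
Proof.
exists 1%N, (fun=> c), (fun _ _ => 0%N) => d.
by rewrite big_ord1 /vmon big1 ?mulr1 // => j _; rewrite expr0.
Qed.

Lemma laurent_coord j : laurent (fun d => d 0 j).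
Proof.
exists 1%N, (fun=> 1), (fun _ k => (k == j) : nat) => d.
rewrite big_ord1 mul1r /vmon (bigD1 j) //= eqxx expr1 big1 ?mulr1 // => k.
by move=> /negbTE ->; rewrite expr0.
Qed.

Lemma laurentD f g : laurent f -> laurent g -> laurent (fun d => f d + g d).
Proof.
move=> [N [c [m fE]]] [N' [c' [m' gE]]].
exists (N + N')%N, (fun j => match split j with inl k => c k | inr k => c' k end),
  (fun j => match split j with inl k => m k | inr k => m' k end) => d.
rewrite big_split_ord fE gE /=; congr (_ + _); apply: eq_bigr => j _.
  by rewrite (unsplitK (inl j)).
by rewrite (unsplitK (inr j)).
Qed.

Lemma laurentM f g : laurent f -> laurent g -> laurent (fun d => f d * g d).
Proof.
move=> [N [c [m fE]]] [N' [c' [m' gE]]].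
exists #|{: 'I_N * 'I_N'}|, (fun j => c (enum_val j).1 * c' (enum_val j).2),
  (fun j k => m (enum_val j).1 k + m' (enum_val j).2 k)%N => d.
rewrite fE gE big_distrlr pair_bigA /=.
rewrite (reindex (fun j : 'I_#|{: 'I_N * 'I_N'}| => enum_val j)) /=; last first.
  exact/onW_bij/enum_val_bij.
apply: eq_bigr => j _; rewrite mulrACA; congr (_ * _).
by rewrite /vmon -big_split; apply: eq_bigr => k _; rewrite exprD.
Qed.

Lemma laurent_ext f g : f =1 g -> laurent f -> laurent g.
Proof. by move=> fg [N [c [m fE]]]; exists N, c, m => d; rewrite -fg. Qed.

Lemma laurent_sum (I : Type) (r : seq I) (F : 'rV[L]_n -> I -> L) :
  (forall k, laurent (F^~ k)) -> laurent (fun d => \sum_(k <- r) F d k).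
Proof.
move=> lF; elim: r => [|k r IH].
  by apply: laurent_ext (laurent_const 0) => d; rewrite big_nil.
by apply: laurent_ext (laurentD (lF k) IH) => d; rewrite big_cons.
Qed.

Lemma laurent_prod (I : Type) (r : seq I) (F : 'rV[L]_n -> I -> L) :
  (forall k, laurent (F^~ k)) -> laurent (fun d => \prod_(k <- r) F d k).
Proof.
move=> lF; elim: r => [|k r IH].
  by apply: laurent_ext (laurent_const 1) => d; rewrite big_nil.
by apply: laurent_ext (laurentM (lF k) IH) => d; rewrite big_cons.
Qed.

Lemma laurentX f k : laurent f -> laurent (fun d => f d ^+ k).
Proof.
move=> lf; elim: k => [|k IH].
  by apply: laurent_ext (laurent_const 1) => d.
by apply: laurent_ext (laurentM lf IH) => d; rewrite exprS.
Qed.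

Lemma mxeval_laurent (A B : 'M[L]_n) (p : mxpol n K) :
  laurent (fun d => mxeval i p (A *m diag_mx d *m B)).
Proof.
have [s sP] := MultivariatePolynomials.mxeval_monoms p.
apply: (@laurent_ext (fun d => monoms i s (A *m diag_mx d *m B))) => [d|]; first by rewrite sP.
apply: laurent_sum => t; apply: laurentM; first exact: laurent_const.
apply: laurent_prod => a; apply: laurent_prod => b; apply: laurentX.
apply: (@laurent_ext (fun d => \sum_j A a j * d 0 j * B j b)) => [d|].
  by rewrite mxE; apply: eq_bigr => j _; rewrite mul_mx_diag mxE.
apply: laurent_sum => j; apply: laurentM; last exact: laurent_const.
by apply: laurentM; [exact: laurent_const|exact: laurent_coord].
Qed.

(** Monomials are characters of the monoid [D]. A polynomial that vanishes on [D] is a relation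
    between them, and a point of [vclosure D] respects every coincidence of monomials on [D]. *)
Lemma mxeval_vclosure (A B : 'M[L]_n) (p : mxpol n K) (D : set 'rV[L]_n) d :
  D (const_mx 1) -> (forall x y, D x -> D y -> D (vmul x y)) ->
  (forall x, D x -> mxeval i p (A *m diag_mx x *m B) = 0) ->
  vclosure D d -> mxeval i p (A *m diag_mx d *m B) = 0.
Proof.
move=> D1 DM p0 dD; have [N [c [m pE]]] := mxeval_laurent A B p.
rewrite pE; apply: (dedekind_eval (mul := @vmul L n) (one := const_mx 1) (D := D)
  (chi := fun j => vmon (m j))) => //.
- by move=> j; apply: vmon1.
- by move=> j x y _ _; apply: vmon_mul.
- by move=> x Dx; rewrite -pE p0.
by move=> j k; apply: dD.
Qed.

End Density.

(** * Integer weights and one-parameter subgroups *)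

Definition pairing n (w : 'I_n -> int) (l : 'I_n -> int) : int := \sum_j w j * l j.

(* Over rat, a vector outside a row space is detected by the cokernel. *)
Lemma separating_weight n (M : set ('I_n -> int)) (l : 'I_n -> int) :
  M (fun=> 0) -> (forall x y, M x -> M y -> M (fun j => x j + y j)) ->
  (forall x, M x -> M (fun j => - x j)) ->
  (forall k x, k != 0 -> M (fun j => k * x j) -> M x) -> ~ M l ->
  exists w : 'I_n -> int, (forall x, M x -> pairing w x = 0) /\ pairing w l != 0.
Proof.
move=> M0 MD MN Msat nMl.
pose v (x : 'I_n -> int) : 'rV[rat]_n := \row_j (x j)%:~R.
have Mz (k : int) x : M x -> M (fun j => k * x j).
  move=> Mx; have Mn (a : nat) : M (fun j => a%:Z * x j).
    elim: a => [|a IH]; first by rewrite (_ : (fun _ => _) = fun=> 0) //; apply/funext => j; rewrite mul0r.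
    rewrite (_ : (fun _ => _) = fun j => x j + a%:Z * x j); first exact: MD.
    by apply/funext => j; rewrite -addn1 PoszD mulrDl mul1r addrC.
  case: k => a; first exact: Mn.
  rewrite (_ : (fun _ => _) = fun j => - (a.+1%:Z * x j)); first exact/MN/Mn.
  by apply/funext => j; rewrite NegzE mulNr.
(* The rational span of [M]. [B] has maximal rank among the matrices all of whose row combinations
   have a nonzero integer multiple in [M]; adjoining an element of [M] keeps this property, so [B]
   already contains it. *)
have [B [BM BP]] : exists B : 'M[rat]_n, (forall x, M x -> (v x <= B)%MS) /\
    forall u : 'rV_n, (u <= B)%MS -> exists k x, [/\ k != 0, M x & k%:~R *: u = v x].
  pose P (r : nat) := exists B : 'M[rat]_n, \rank B = r /\
    forall u : 'rV_n, (u <= B)%MS -> exists k x, [/\ k != 0, M x & k%:~R *: u = v x].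
  have P0 : exists r, `[< P r >].
    exists 0%N; apply/asboolP; exists 0; split; first exact: mxrank0.
    move=> u; rewrite submx0 => /eqP ->; exists 1, (fun=> 0); split=> //.
    by rewrite scaler0; apply/rowP => j; rewrite !mxE.
  have Pn r : `[< P r >] -> (r <= n)%N by move=> /asboolP[B [<- _]]; apply: rank_leq_row.
  have [r /asboolP[B [Br BP]] rmax] := ex_maxnP P0 Pn.
  exists B; split=> // x Mx; apply: contrapT => /negP nxB.
  pose B' := (B + v x)%MS.
  have rB' : (r < \rank B')%N.
    rewrite -Br; apply: rank_ltmx; rewrite /ltmx addsmxSl /= addsmx_sub submx_refl.
    exact: nxB.
  have : (\rank B' <= r)%N.
    apply: rmax; apply/asboolP; exists B'; split=> // u /sub_addsmxP[[a b] /= uE].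
    have [k [y [k0 My yE]]] := BP _ (submxMl a B).
    pose q : rat := b 0 0.
    have bq : b *m v x = q *: v x by rewrite [b]mx11_scalar mul_scalar_mx.
    exists (k * denq q), (fun j => denq q * y j + (k * numq q) * x j); split.
    - by rewrite mulf_neq0 ?denq_neq0.
    - by apply: MD; apply: Mz.
    have qE : (denq q)%:~R * q = (numq q)%:~R.
      by rewrite -[X in _ * X = _]divq_num_den mulrC mulfVK // intr_eq0 denq_neq0.
    transitivity ((denq q)%:~R *: (k%:~R *: (a *m B)) +
        (k%:~R * ((denq q)%:~R * q)) *: v x).
      by rewrite uE bq intrM scalerDr !scalerA mulrA [(denq q)%:~R * k%:~R]mulrC.
    rewrite yE qE -intrM.
    by apply/rowP => j; rewrite !mxE intrD !intrM.
  by rewrite leqNgt rB'.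
(* Here saturation enters: a nonzero multiple of [l] in [M] would put [l] itself in [M]. *)
have nlB : ~~ (v l <= B)%MS.
  apply/negP => /BP[k [x [k0 Mx kE]]]; apply: nMl; apply: (Msat k) => //.
  rewrite (_ : (fun _ => _) = x) //; apply/funext => j.
  by have /rowP/(_ j) := kE; rewrite !mxE -rmorphM /= => /intr_inj.
have [a na] : exists a, (v l *m cokermx B) 0 a != 0.
  apply: contrapT => h; case/negP: nlB; rewrite submxE; apply/eqP/rowP => a.
  by rewrite [RHS]mxE; apply/eqP/negPn/negP => ha; apply: h; exists a.
(* The weight is a column of the cokernel, with denominators cleared by their product. *)
pose u j := cokermx B j a; pose dd := \prod_j denq (u j).
have dd0 : dd != 0 by apply/prodf_neq0 => j _; apply: denq_neq0.
pose w j := numq (u j) * \prod_(k | k != j) denq (u k).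
have wE j : (w j)%:~R = dd%:~R * u j.
  have -> : dd = denq (u j) * \prod_(k | k != j) denq (u k) by rewrite /dd (bigD1 j).
  rewrite /w !intrM mulrAC; congr (_ * _).
  by rewrite -[X in _ = _ * X]divq_num_den mulrC mulfVK // intr_eq0 denq_neq0.
have wP x : (pairing w x)%:~R = dd%:~R * (v x *m cokermx B) 0 a.
  rewrite /pairing rmorph_sum mxE mulr_sumr; apply: eq_bigr => j _.
  by rewrite /= intrM wE mxE -mulrA [u j * _]mulrC.
exists w; split=> [x /BM|].
  rewrite submxE => /eqP xB; apply: (@intr_inj rat).
  by rewrite wP xB mxE mulr0.
by rewrite -(intr_eq0 rat) wP mulf_neq0 // intr_eq0.
Qed.

Section IntegerWeights.
Variables (C : fieldType) (n : nat).
Implicit Types (d : 'rV[C]_n) (w l : 'I_n -> int) (m : 'I_n -> nat).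

Definition vunit d := forall j, d 0 j != 0.

Definition vz l d : C := \prod_j d 0 j ^ l j.

Definition mdiff m m' : 'I_n -> int := fun j => (m j)%:Z - (m' j)%:Z.

Lemma vz_add l l' d : vunit d -> vz (fun j => l j + l' j) d = vz l d * vz l' d.
Proof. by move=> d0; rewrite /vz -big_split; apply: eq_bigr => j _; rewrite expfzDr. Qed.

Lemma vz_opp l d : vz (fun j => - l j) d = (vz l d)^-1.
Proof. by rewrite /vz -prodfV; apply: eq_bigr => j _; rewrite invr_expz. Qed.

Lemma exprz_prod (k : int) (f : 'I_n -> C) : (\prod_j f j) ^ k = \prod_j f j ^ k.
Proof.
by rewrite (big_morph _ (fun x y => expfzMl x y k) (exp1rz C k)).
Qed.

Lemma vz_mulz k l d : vz (fun j => k * l j) d = vz l d ^ k.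
Proof. by rewrite /vz exprz_prod; apply: eq_bigr => j _; rewrite exprz_exp mulrC. Qed.

Lemma vz_nat m d : vz (fun j => (m j)%:Z) d = vmon m d.
Proof. by []. Qed.

Lemma vmon_neq0 m d : vunit d -> vmon m d != 0.
Proof. by move=> d0; apply/prodf_neq0 => j _; rewrite expf_neq0. Qed.

Lemma vz_mdiff m m' d : vunit d -> (vmon m d = vmon m' d) <-> (vz (mdiff m m') d = 1).
Proof.
move=> d0; rewrite /mdiff vz_add // vz_opp !vz_nat.
by split=> [->|h]; [rewrite divff ?vmon_neq0|apply: (divr1_eq h)].
Qed.

Lemma mdiff_surj l : exists m m', l = mdiff m m'.
Proof.
exists (fun j => `|Num.max (l j) 0|%N), (fun j => `|Num.max (- l j) 0|%N).
apply/funext => j; rewrite /mdiff !gez0_abs ?le_max ?lexx ?orbT //.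
by case: (leP 0 (l j)) => h; [rewrite max_r ?oppr_le0 // subr0|
  rewrite max_l ?oppr_ge0 1?ltW // sub0r opprK].
Qed.

Definition vpow (t : C) w : 'rV[C]_n := \row_j t ^ w j.

Lemma vunit_vpow t w : t != 0 -> vunit (vpow t w).
Proof. by move=> t0 j; rewrite mxE expfz_neq0. Qed.

Lemma vz_vpow t w l : t != 0 -> vz l (vpow t w) = t ^ pairing w l.
Proof.
move=> t0; rewrite /vz /pairing.
have -> : t ^ (\sum_j w j * l j) = \prod_j t ^ (w j * l j).
  exact: (big_morph _ (fun x y => expfzDr x y t0) (expr0z t)).
by apply: eq_bigr => j _; rewrite mxE exprz_exp.
Qed.

(** The exponents that are trivial on [D] form a lattice, saturated by the second hypothesis. A
    weight that annihilates this lattice but not [mdiff m m'] gives a one-parameter subgroup inside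
    the closure of [D] that tells the two monomials apart. *)
Lemma weights_separate (D : set 'rV[C]_n) m m' :
  (forall d, D d -> vunit d) ->
  (forall k l, k != 0 -> (forall d, D d -> vz l d ^ k = 1) -> forall d, D d -> vz l d = 1) ->
  ~ (forall d, D d -> vmon m d = vmon m' d) ->
  exists2 w, forall t, t != 0 -> vclosure D (vpow t w) & pairing w (mdiff m m') != 0.
Proof.
move=> D0 Dsat nmm'; pose M l := forall d, D d -> vz l d = 1.
have [||||ml|w [wM wl]] := @separating_weight n M (mdiff m m').
- by move=> d Dd; rewrite /vz big1 // => j _; rewrite expr0z.
- by move=> x y Mx My d Dd; rewrite vz_add ?Mx ?My ?mulr1 //; apply: D0.
- by move=> x Mx d Dd; rewrite vz_opp Mx ?invr1.
- by move=> k x k0 Mx; apply: Dsat k0 _ => d Dd; rewrite -vz_mulz Mx.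
- by apply: nmm' => d Dd; apply/vz_mdiff; [apply: D0|apply: ml].
exists w => // t t0 a b ab; apply/vz_mdiff; first exact: vunit_vpow.
rewrite vz_vpow // wM ?expr0z // => d Dd; apply/vz_mdiff; first exact: D0.
exact: ab.
Qed.

End IntegerWeights.

(* Along t |-> d t^w a polynomial function becomes a Laurent polynomial in t. *)
Lemma mxeval_curve (C : fieldType) n (A B : 'M[C]_n) (q : mxpol n C) d (w : 'I_n -> int) :
  exists (N : nat) (P : {poly C}), forall t, t != 0 ->
    t ^+ N * mxeval idfun q (A *m diag_mx (vmul d (vpow t w)) *m B) = P.[t].
Proof.
have [M [c [m qE]]] := mxeval_laurent idfun A B q.
pose e j := pairing w (fun k => (m j k)%:Z).
(* Large enough for [t ^+ N] to clear all negative exponents. *)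
pose N := (\max_j `|e j|)%N.
exists N, (\sum_j (c j * vmon (m j) d) *: 'X^(`|(N%:Z + e j)%R|%N)) => t t0.
rewrite qE horner_sum mulr_sumr; apply: eq_bigr => j _.
rewrite hornerZ hornerXn vmon_mul -[X in _ * (_ * (_ * X))]vz_nat vz_vpow //.
rewrite -/(e j) !mulrA [t ^+ N * _]mulrC -!mulrA; congr (_ * _).
rewrite mulrCA; congr (_ * _); rewrite exprnP [t ^+ `|_|]exprnP -expfzDr // gez0_abs //.
have : `|e j| <= N%:Z by rewrite -abszE lez_nat; apply: leq_bigmax.
by rewrite ler_norml => /andP[h _]; rewrite addrC -lerBlDr sub0r.
Qed.

Lemma poly_nonroot (C : numDomainType) (p : {poly C}) :
  p != 0 -> exists2 t, 0 < t & p.[t] != 0.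
Proof.
move=> p0; pose rs : seq C := [seq k.+1%:R | k <- iota 0 (size p)].
have rs_uniq : uniq rs.
  by rewrite map_inj_uniq ?iota_uniq // => a b /mulrIn => /(_ (oner_neq0 _)) [].
have := contraNN (fun x => max_poly_roots p0 x rs_uniq).
rewrite size_map size_iota ltnn => /(_ isT) /allPn[t /mapP[k _ ->] tn].
by exists k.+1%:R => //; rewrite ltr0n.
Qed.

(** * Connectedness of the closure of a diagonal group *)

Section DiagonalGroup.
Variables (C : numFieldType) (n : nat) (A B : 'M[C]_n).
Variable D : set 'rV[C]_n.
Hypothesis D1 : D (const_mx 1).
Hypothesis Dunit : forall d, D d -> vunit d.
Hypothesis Dsat : forall k l, k != 0 -> (forall d, D d -> vz l d ^ k = 1) ->
  forall d, D d -> vz l d = 1.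

Let pt (d : 'rV[C]_n) := A *m diag_mx d *m B.

Lemma vclosure_sub d : D d -> vclosure D d.
Proof. by move=> Dd m m'; apply. Qed.

Lemma vclosureM x y : vclosure D x -> vclosure D y -> vclosure D (vmul x y).
Proof.
move=> cx cy m m' mm'; rewrite !vmon_mul; congr (_ * _); [exact: cx|exact: cy].
Qed.

(** [D'] consists of the points of the closure whose translation preserves the first piece. It
    contains every [2 ^ w] whose curve [t ^ w] stays in the closure. These points separate
    monomials, so each coincidence of monomials on [D'] holds on [D], and polynomials that vanish on
    [D'] vanish on the whole closure. *)
Lemma vclosure_connected (I1 I2 : set (mxpol n C)) :
  (forall d, vclosure D d -> zeros idfun I1 (pt d) \/ zeros idfun I2 (pt d)) ->
  (forall d, ~ (zeros idfun I1 (pt d) /\ zeros idfun I2 (pt d))) ->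
  zeros idfun I1 (pt (const_mx 1)) ->
  forall d, vclosure D d -> zeros idfun I1 (pt d).
Proof.
move=> cover disj one d cd p I1p.
pose D' : set 'rV[C]_n := [set x | vclosure D x /\ forall y, vclosure D y ->
  zeros idfun I1 (pt y) -> zeros idfun I1 (pt (vmul x y))].
have vmul1 (x : 'rV[C]_n) : vmul (const_mx 1) x = x.
  by apply/rowP => j; rewrite !mxE mul1r.
have vmulC (x y : 'rV[C]_n) : vmul x y = vmul y x.
  by apply/rowP => j; rewrite !mxE mulrC.
apply: (@mxeval_vclosure _ _ idfun n A B p D') => //.
- split; first exact: vclosure_sub.
  by move=> y _; rewrite vmul1.
- move=> x y [cx xP] [cy yP]; split; first exact: vclosureM.
  move=> z cz z1; rewrite (_ : vmul _ z = vmul x (vmul y z)).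
    by apply: xP; [apply: vclosureM|apply: yP].
  by apply/rowP => j; rewrite !mxE mulrA.
- move=> x [cx xP]; have := xP _ (vclosure_sub D1) one.
  by rewrite vmulC vmul1; apply.
move=> m m' mm'; apply: cd => x Dx; move: x Dx.
apply: contrapT => nmm'; have [w wD wm] := weights_separate Dunit Dsat nmm'.
have two0 : (2 : C) != 0 by rewrite pnatr_eq0.
have /mm'/(vz_mdiff m m' (vunit_vpow w two0)) : D' (vpow 2 w).
  split; first exact: wD.
  move=> y cy y1; rewrite vmulC.
  have curve t : t != 0 -> vclosure D (vmul y (vpow t w)).
    by move=> t0; apply: vclosureM => //; apply: wD.
  (* If the curve through [y] is in the second piece at [t = 2], some [f] of [I1] is nonzero there.
     Every [g] of [I2] then vanishes along the curve, since at a common non-root of both the point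
     would lie in no piece. At [t = 1] this puts [y] in both pieces. *)
  have [//|y2] := cover _ (curve 2 two0).
  have [f I1f ff] : exists2 f, I1 f & mxeval idfun f (pt (vmul y (vpow 2 w))) != 0.
    apply: contrapT => nf; apply: (disj (vmul y (vpow 2 w))); split=> // f I1f.
    by apply/eqP/negPn/negP => h; apply: nf; exists f.
  have [N [P PE]] := mxeval_curve A B f y w.
  have P0 : P != 0.
    apply: contra_neq ff => P0; have := PE 2 two0; rewrite P0 horner0 => /eqP.
    by rewrite mulf_eq0 expf_eq0 (negbTE two0) andbF => /eqP.
  exfalso; apply: (disj y); split=> // g I2g.
  have [N' [P' P'E]] := mxeval_curve A B g y w.
  have P'0 : P' = 0.
    apply/eqP/negPn/negP => P'0; have PP' : P * P' != 0 by rewrite mulf_neq0.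
    have [t /lt0r_neq0 t0] := poly_nonroot PP'.
    rewrite hornerM -PE // -P'E // !mulf_eq0 !negb_or => /andP[/andP[_ ft] /andP[_ gt]].
    by have [/(_ f I1f)|/(_ g I2g)] := cover _ (curve t t0); apply/eqP.
  have := P'E 1 (oner_neq0 _); rewrite P'0 horner0 expr1n mul1r.
  by rewrite (_ : vpow 1 w = const_mx 1) 1?vmulC ?vmul1 //; apply/rowP => j; rewrite !mxE exp1rz.
rewrite vz_vpow // => /eqP.
by rewrite pexprz_eq1 ?ler0n // (negbTE wm) (eqr_nat C 2 1).
Qed.

End DiagonalGroup.

Lemma mxeval_map (K L : fieldType) (i : {rmorphism K -> L}) n (p : mxpol n K) x :
  mxeval i p (map_mx i x) = i (mxeval idfun p x).
Proof.
have [s sP] := MultivariatePolynomials.mxeval_monoms p; rewrite !sP /monoms.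
rewrite rmorph_sum; apply: eq_bigr => t _; rewrite rmorphM /=; congr (_ * _).
rewrite rmorph_prod; apply: eq_bigr => a _; rewrite rmorph_prod.
by apply: eq_bigr => b _; rewrite mxE rmorphXn.
Qed.

Lemma zeros_map (K L : fieldType) (i : {rmorphism K -> L}) n (G : set (mxpol n K)) x :
  zeros i G (map_mx i x) <-> zeros idfun G x.
Proof.
split=> Gx p /Gx; rewrite mxeval_map; last by move=> ->; rewrite rmorph0.
by move/eqP; rewrite fmorph_eq0 => /eqP.
Qed.

(** * Matrices that are diagonal in an orthonormal basis *)

Definition pt (L : fieldType) n (Q : 'M[L]_n) (d : 'rV[L]_n) := Q^T *m diag_mx d *m Q.

Section Pt.
Variables (L : fieldType) (n : nat) (Q : 'M[L]_n).
Hypothesis QQ : Q *m Q^T = 1%:M.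

Lemma QTQ : Q^T *m Q = 1%:M.
Proof. exact: mulmx1C. Qed.

Lemma pt1 : pt Q (const_mx 1) = 1%:M.
Proof. by rewrite /pt diag_const_mx mulmx1 QTQ. Qed.

Lemma diag_mx_vmul d e : diag_mx (vmul d e) = diag_mx d *m diag_mx e :> 'M[L]_n.
Proof.
apply/matrixP => i j; rewrite mul_diag_mx !mxE.
by case: eqVneq => [->|]; rewrite ?mulr1n // !mulr0n mulr0.
Qed.

Lemma ptM d e : pt Q (vmul d e) = pt Q d *m pt Q e.
Proof.
by rewrite /pt diag_mx_vmul -!mulmxA (mulmxA Q) QQ mul1mx.
Qed.

Lemma det_pt d : \det (pt Q d) = \prod_j d 0 j.
Proof.
rewrite /pt !det_mulmx mulrAC -det_mulmx QTQ det1 mul1r det_diag.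
by [].
Qed.

Lemma pt_conj d : Q *m pt Q d *m Q^T = diag_mx d.
Proof. by rewrite /pt !mulmxA QQ mul1mx -mulmxA QQ mulmx1. Qed.

Lemma diag_pt x : is_diag_mx (Q *m x *m Q^T) ->
  x = pt Q (\row_j (Q *m x *m Q^T) j j).
Proof.
move=> /is_diag_mxP dx; rewrite /pt.
have -> : diag_mx (\row_j (Q *m x *m Q^T) j j) = Q *m x *m Q^T.
  apply/matrixP => i j; rewrite [LHS]mxE [X in X *+ _]mxE.
  by case: (eqVneq i j) => [->|ij] //; rewrite mulr0n dx.
by rewrite !mulmxA QTQ mul1mx -mulmxA QTQ mulmx1.
Qed.

Lemma pt_tr d : (pt Q d)^T = pt Q d.
Proof. by rewrite /pt !trmx_mul trmxK tr_diag_mx mulmxA. Qed.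

End Pt.

Lemma pt_map (K L : fieldType) (i : {rmorphism K -> L}) n (Q : 'M[K]_n) d :
  pt (map_mx i Q) (map_mx i d) = map_mx i (pt Q d).
Proof. by rewrite /pt !map_mxM map_trmx map_diag_mx. Qed.

(** Positivity in existential form, so that it is first-order in matrix variables; on torus points
    it amounts to positive coordinates. *)
Definition is_gram (L : fieldType) n (x : 'M[L]_n) := exists q : 'M[L]_n, x = q *m q^T.

Lemma gram_pt_pos (K : rcfType) n (Q : 'M[K]_n) (d : 'rV_n) : Q *m Q^T = 1%:M ->
  (forall j, d 0 j != 0) -> is_gram (pt Q d) -> forall j, 0 < d 0 j.
Proof.
move=> QQ d0 [q qE] j; rewrite lt_neqAle eq_sym d0 /=.
have -> : d 0 j = ((Q *m q) *m (Q *m q)^T) j j.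
  by rewrite trmx_mul mulmxA -(mulmxA Q) -qE pt_conj // mxE eqxx.
by rewrite mxE; apply: sumr_ge0 => k _; rewrite [_^T _ _]mxE -expr2 sqr_ge0.
Qed.

Lemma pos_gram (K : rcfType) n (Q : 'M[K]_n) (d : 'rV_n) : (forall j, 0 < d 0 j) -> is_gram (pt Q d).
Proof.
move=> d0; exists (Q^T *m diag_mx (map_mx Num.sqrt d)).
rewrite trmx_mul trmxK tr_diag_mx mulmxA -(mulmxA Q^T) -diag_mx_vmul /pt.
congr (_ *m diag_mx _ *m _); apply/rowP => j; rewrite !mxE -expr2 sqr_sqrtr //.
exact: ltW.
Qed.

(** * Split tori in orthogonal coordinates *)

Section SplitTorus.
Variables (K : rcfType) (n : nat) (S : set (mxpol n K)).
Hypothesis hS : split_torus S.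
Hypothesis hST : forall s, geom_points S s -> s^T = s.

Local Notation C := (K[i]%C).
Let rc : {rmorphism K -> C} := real_complex K.

Lemma torus_orthogonal_coordinates : exists2 Q : 'M[K]_n, Q *m Q^T = 1%:M &
  forall s, geom_points S s -> is_diag_mx (map_mx rc Q *m s *m (map_mx rc Q)^T).
Proof.
by case: hS => _ _ [P uP diagP]; exact: (orthogonal_diagonalization uP hST diagP).
Qed.

Section Coordinates.
Variable Q : 'M[K]_n.
Hypothesis QQ : Q *m Q^T = 1%:M.
Hypothesis Qdiag :
  forall s, geom_points S s -> is_diag_mx (map_mx rc Q *m s *m (map_mx rc Q)^T).

Let Qc := map_mx rc Q.
Let QcQc : Qc *m Qc^T = 1%:M.
Proof. by rewrite map_trmx -map_mxM QQ map_mx1. Qed.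

Let DS : set 'rV[C]_n := [set d | geom_points S (pt Qc d)].

Lemma torus_pt s : geom_points S s -> exists2 d, DS d & s = pt Qc d.
Proof.
move=> Ss; exists (\row_j (Qc *m s *m Qc^T) j j); last exact/diag_pt/Qdiag.
by rewrite /DS /= -diag_pt //; apply: Qdiag.
Qed.

Lemma torus_one : DS (const_mx 1).
Proof. by case: hS => -[[S1 _ _ _] _] _ _; rewrite /DS /= pt1. Qed.

Lemma torus_mul x y : DS x -> DS y -> DS (vmul x y).
Proof.
move=> Sx Sy; have [[[_ _ SM _] _] _ _] := hS.
change (geom_points S (pt Qc (vmul x y))); rewrite (ptM QcQc).
exact: (SM (pt Qc x) (pt Qc y) Sx Sy).
Qed.

Lemma torus_unit d : DS d -> vunit d.
Proof.
case: hS => -[_ Sdet] _ _ /Sdet; rewrite /= det_pt // => d1 j.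
apply/eqP => dj; move: d1; rewrite (bigD1 j) //= dj mul0r => /esym/eqP.
by rewrite oner_eq0.
Qed.

Lemma torus_vclosure d : vclosure DS d -> DS d.
Proof.
move=> cd p Sp.
have key := @mxeval_vclosure K C rc n Qc^T Qc p DS d torus_one torus_mul.
by apply: key cd => x Sx; apply: (Sx p Sp).
Qed.

(* A character with finite image cuts the connected torus into closed pieces. *)
Lemma torus_saturated k l : k != 0 -> (forall d, DS d -> vz l d ^ k = 1) ->
  forall d, DS d -> vz l d = 1.
Proof.
move=> k0 lk; have [m [m' lE]] := mdiff_surj l.
pose N := `|k|%N; have N0 : (0 < N)%N by rewrite lt0n absz_eq0.
have lN d : DS d -> vmon m d ^+ N = vmon m' d ^+ N.
  move=> Sd; have u := torus_unit Sd.
  have h : vz l d ^+ N = 1.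
    have := lk d Sd; rewrite /N; case: (k) => a //=.
    by rewrite NegzE -invr_expz => /(congr1 GRing.inv); rewrite invrK invr1.
  move: h; rewrite lE /mdiff vz_add // vz_opp !vz_nat exprMn exprVn => /divr1_eq.
  by [].
(* [zariski_closed] asks for polynomials over [C], so the equations of [S] are rewritten with
   coefficients there. *)
have S_ext : forall p, S p -> exists q : mxpol n C,
    forall x, mxeval idfun q x = mxeval rc p x.
  by move=> p _; apply: upoly_extension.
pose dd (x : 'M[C]_n) := \row_j (Qc *m x *m Qc^T) j j.
have ddpt d : dd (pt Qc d) = d by apply/rowP => j; rewrite mxE pt_conj // mxE eqxx.
have mon_poly a : upoly (fun (L : fieldType) (i : {rmorphism C -> L}) x =>
    \prod_j (map_mx i Qc *m x *m map_mx i Qc^T) j j ^+ a j).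
  by apply: upoly_prod => j; apply: upolyX; apply: upoly_conj.
have [f1 f1E] : exists q : mxpol n C, forall d,
    mxeval idfun q (pt Qc d) = vmon m d - vmon m' d.
  have [q qE] := MultivariatePolynomials.upolyD (mon_poly m) (upolyN (mon_poly m')).
  exists q => d; rewrite qE !map_mx_id //; congr (_ - _);
    by apply: eq_bigr => j _; rewrite pt_conj // mxE eqxx.
(* The second factor of [x^N - y^N]. Where [x = y] it is [N x^(N-1)], which is nonzero, so the
   pieces cut out by [f1] and [f2] are disjoint. *)
have [f2 f2E] : exists q : mxpol n C, forall d,
    mxeval idfun q (pt Qc d) = \sum_(j < N) vmon m d ^+ (N.-1 - j) * vmon m' d ^+ j.
  have [q qE] := upoly_sum (index_enum 'I_N) (fun j : 'I_N =>
    MultivariatePolynomials.upolyM (upolyX (N.-1 - j) (mon_poly m))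
      (upolyX j (mon_poly m'))).
  exists q => d; rewrite qE; apply: eq_bigr => j _; rewrite !map_mx_id //.
  by congr (_ ^+ _ * _ ^+ _); apply: eq_bigr => a _; rewrite pt_conj // mxE eqxx.
pose IS f := [set q : mxpol n C | q = f \/
  exists2 p, S p & forall x, mxeval idfun q x = mxeval rc p x].
have ISP f x : zeros idfun (IS f) x <-> geom_points S x /\ mxeval idfun f x = 0.
  split=> [Zx|[Sx fx] q [->//|[p Sp ->]]]; last exact: Sx.
  split; last by apply: Zx; left.
  move=> p Sp; have [q qE] := S_ext p Sp.
  by rewrite -qE; apply: Zx; right; exists p.
have [_ conS _] := hS.
have [||||Z1|Z2] := conS (zeros idfun (IS f1)) (zeros idfun (IS f2)).
- by exists (IS f1).
- by exists (IS f2).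
- apply/seteqP; split=> [x Sx|x [/ISP[]|/ISP[]]//].
  have [d Sd xE] := torus_pt Sx.
  have /eqP := lN d Sd; rewrite -subr_eq0 subrXX mulf_eq0 => /orP[] /eqP h.
    by left; apply/ISP; split=> //; rewrite xE f1E.
  by right; apply/ISP; split=> //; rewrite xE f2E.
- apply/seteqP; split=> // x [/ISP[Sx x1] /ISP[_ x2]].
  have [d Sd xE] := torus_pt Sx.
  move: x1 x2; rewrite xE f1E f2E => /eqP; rewrite subr_eq0 => /eqP <- /eqP.
  rewrite (eq_bigr (fun=> vmon m d ^+ N.-1)); last first.
    by move=> j _; rewrite -exprD subnK // -ltnS prednK.
  rewrite sumr_const card_ord mulrn_eq0 expf_eq0 -[N == _]negbK -lt0n N0 /=.
  by rewrite (negbTE (vmon_neq0 m (torus_unit Sd))) andbF.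
- exfalso; have : zeros idfun (IS f1) (pt Qc (const_mx 1)).
    by apply/ISP; split; [exact: torus_one|rewrite f1E !vmon1 subrr].
  by rewrite Z1.
move=> d Sd; rewrite lE; apply/vz_mdiff; first exact: torus_unit.
have : geom_points S (pt Qc d) by [].
rewrite /geom_points.
have [d1|] := pselect (zeros idfun (IS f1) (pt Qc d)).
  by move=> _; have /ISP[_] := d1; rewrite f1E => /eqP; rewrite subr_eq0 => /eqP.
move=> n1 _; exfalso; suff : zeros idfun (IS f2) (pt Qc d) by rewrite Z2.
apply/ISP; split=> //; have /eqP := lN d Sd.
rewrite -subr_eq0 subrXX mulf_eq0 => /orP[] /eqP h; last by rewrite f2E.
by case: n1; apply/ISP; split=> //; rewrite f1E.
Qed.

Definition pos_coords : set 'rV[C]_n := [set d | exists2 d0 : 'rV[K]_n,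
  d = map_mx rc d0 & (forall j, 0 < d0 0 j) /\ zeros idfun S (pt Q d0)].

(* The points 2^w are real and positive, and they separate the characters. *)
Lemma torus_dense d : DS d -> vclosure pos_coords d.
Proof.
move=> Sd m m' mm'; have [mmS|nmm'] := pselect (forall x, DS x -> vmon m x = vmon m' x).
  exact: mmS.
have [w wD wm] := weights_separate torus_unit torus_saturated nmm'.
have two0 : (2 : C) != 0 by rewrite pnatr_eq0.
have vE : vpow (2 : C) w = map_mx rc (vpow 2 w).
  by apply/rowP => j; rewrite !mxE -[2 in LHS](rmorph_nat rc) -rmorphXz // unitfE pnatr_eq0.
have /mm'/(vz_mdiff m m' (vunit_vpow w two0)) : pos_coords (vpow 2 w).
  exists (vpow 2 w) => //; split=> [j|]; first by rewrite mxE exprz_gt0.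
  by apply/(zeros_map rc); rewrite -pt_map -vE; apply/torus_vclosure/wD.
by rewrite vz_vpow // => /eqP; rewrite pexprz_eq1 ?ler0n // (negbTE wm) (eqr_nat C 2 1).
Qed.

End Coordinates.
End SplitTorus.

(** * Tori cut out by binomial equations *)

Section BinomialTorus.
Variables (K : rcfType) (n : nat) (Q : 'M[K]_n).
Hypothesis QQ : Q *m Q^T = 1%:M.

Local Notation C := (K[i]%C).
Let rc : {rmorphism K -> C} := real_complex K.
Let Qc := map_mx rc Q.
Let QcQc : Qc *m Qc^T = 1%:M.
Proof. by rewrite map_trmx -map_mxM QQ map_mx1. Qed.

Variable D : set 'rV[K]_n.
Hypothesis D1 : D (const_mx 1).
Hypothesis Dpos : forall d, D d -> forall j, 0 < d 0 j.
Hypothesis Ddet : forall d, D d -> \prod_j d 0 j = 1.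

Let Dc : set 'rV[C]_n := [set map_mx rc d | d in D].

(** The equations are the vanishing of the off-diagonal entries and the coincidences of monomials on
    [D], all over [K]. For connectedness the trivial exponents must be saturated, which holds
    because a positive element with a nonzero power equal to 1 is 1. *)
Lemma binomial_torus : exists T : set (mxpol n K), split_torus T /\
  geom_points T = [set pt Qc d | d in vclosure Dc].
Proof.
pose diag_entry (L : fieldType) (i : {rmorphism K -> L}) (x : 'M[L]_n) a b :=
  (map_mx i Q *m x *m map_mx i Q^T) a b.
have vmon_map m d : vmon m (map_mx rc d) = rc (vmon m d).
  by rewrite /vmon rmorph_prod; apply: eq_bigr => j _; rewrite mxE rmorphXn.
have vcM x y : vclosure Dc x -> vclosure Dc y -> vclosure Dc (vmul x y).
  by move=> cx cy m m' mm'; rewrite !vmon_mul (cx _ _ mm') (cy _ _ mm').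
have vc1 : vclosure Dc (const_mx 1) by move=> m m' _; rewrite !vmon1.
(* Determinant 1 is itself a coincidence of monomials, with exponents all 1 and all 0. *)
have vc_prod x : vclosure Dc x -> \prod_j x 0 j = 1.
  move=> /(_ (fun=> 1%N) (fun=> 0%N)).
  have -> : vmon (fun=> 0%N) x = 1 by rewrite /vmon big1.
  have -> : vmon (fun=> 1%N) x = \prod_j x 0 j by apply: eq_bigr => j _; rewrite expr1.
  apply=> _ [d Dd <-]; rewrite !vmon_map; congr (rc _); rewrite /vmon [RHS]big1 //.
  by rewrite -[RHS](Ddet Dd); apply: eq_bigr => j _; rewrite expr1.
have vc_unit x : vclosure Dc x -> vunit x.
  move=> /vc_prod x1 j; apply/eqP => xj; move: x1.
  by rewrite (bigD1 j) //= xj mul0r => /esym/eqP; rewrite oner_eq0.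
pose T : set (mxpol n K) := [set q |
  (exists a b, a != b /\ forall (L : fieldType) (i : {rmorphism K -> L}) x,
     mxeval i q x = diag_entry L i x a b) \/
  (exists m m', (forall x, Dc x -> vmon m x = vmon m' x) /\
     forall (L : fieldType) (i : {rmorphism K -> L}) x,
     mxeval i q x = \prod_j diag_entry L i x j j ^+ m j -
                    \prod_j diag_entry L i x j j ^+ m' j)].
have TE : geom_points T = [set pt Qc d | d in vclosure Dc].
  apply/seteqP; split=> [x Tx|_ [d cd <-] q].
    have dx : is_diag_mx (Qc *m x *m Qc^T).
      apply/is_diag_mxP => a b ab.
      have [q qE] := upoly_conj Q Q^T a b.
      have Tq : T q by left; exists a, b; split=> // L i y; rewrite qE.
      by have := Tx q Tq; rewrite qE -map_trmx.
    exists (\row_j (Qc *m x *m Qc^T) j j); last exact/esym/diag_pt.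
    move=> m m' mm'.
    have mon_poly a : upoly (fun (L : fieldType) (i : {rmorphism K -> L}) x =>
        \prod_j diag_entry L i x j j ^+ a j).
      by apply: upoly_prod => j; apply: upolyX; apply: upoly_conj.
    have [q qE] := MultivariatePolynomials.upolyD (mon_poly m) (upolyN (mon_poly m')).
    have Tq : T q by right; exists m, m'.
    have := Tx q Tq; rewrite qE => /eqP; rewrite subr_eq0 => /eqP h.
    have monE a : vmon a (\row_j (Qc *m x *m Qc^T) j j) =
        \prod_j diag_entry C rc x j j ^+ a j.
      by apply: eq_bigr => j _; rewrite mxE map_trmx.
    by rewrite !monE.
  have entryE a b : diag_entry C rc (pt Qc d) a b = diag_mx d a b.
    by rewrite /diag_entry -/Qc -map_trmx pt_conj.
  move=> [[a [b [ab ->]]]|[m [m' [mm' ->]]]].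
    by rewrite entryE mxE (negbTE ab).
  have monE a : \prod_j diag_entry C rc (pt Qc d) j j ^+ a j = vmon a d.
    by apply: eq_bigr => j _; rewrite entryE mxE eqxx.
  by rewrite !monE (cd m m' mm') subrr.
exists T; split; last exact: TE.
split.
- split; last by rewrite TE => _ [d cd <-]; rewrite /= det_pt ?vc_prod.
  rewrite TE; split.
  + by exists (const_mx 1); rewrite ?pt1.
  + by move=> _ [d cd <-]; rewrite unitmxE det_pt ?vc_prod ?unitr1.
  + by move=> _ _ [d cd <-] [e ce <-]; exists (vmul d e); [exact: vcM|rewrite ptM].
  + move=> _ [d cd <-]; have d0 := vc_unit d cd.
    exists (\row_j (d 0 j)^-1).
      have vi m : vmon m (\row_j (d 0 j)^-1) = (vmon m d)^-1.
        by rewrite /vmon -prodfV; apply: eq_bigr => j _; rewrite mxE exprVn.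
      by move=> m m' mm'; rewrite !vi (cd m m').
    have u : pt Qc d \in unitmx by rewrite unitmxE det_pt ?vc_prod ?unitr1.
    have h : pt Qc (\row_j (d 0 j)^-1) *m pt Qc d = 1%:M.
      rewrite -ptM // -(pt1 QcQc); congr pt.
      by apply/rowP => j; rewrite !mxE mulVf.
    by rewrite -[LHS]mulmx1 -(mulmxV u) mulmxA h mul1mx.
- have Dc1 : Dc (const_mx 1).
    by exists (const_mx 1) => //; apply/rowP => j; rewrite !mxE rmorph1.
  have Dcu x : Dc x -> vunit x by move=> Dx; apply: vc_unit => m m'; apply.
  have Dcs k l : k != 0 -> (forall d, Dc d -> vz l d ^ k = 1) ->
      forall d, Dc d -> vz l d = 1.
    move=> k0 lk _ [d Dd <-].
    have vzE : vz l (map_mx rc d) = rc (vz l d).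
      rewrite /vz rmorph_prod; apply: eq_bigr => j _; rewrite mxE rmorphXz //.
      by rewrite unitfE gt_eqF // Dpos.
    have := lk _ (ex_intro2 _ _ d Dd erefl); rewrite vzE.
    have v0 : 0 < vz l d by apply: prodr_gt0 => j _; rewrite exprz_gt0 // Dpos.
    rewrite -rmorphXz ?unitfE ?gt_eqF // -(rmorph1 rc) => /(fmorph_inj rc)/eqP.
    by rewrite pexprz_eq1 ?ltW // (negbTE k0) => /eqP ->; rewrite rmorph1.
  have T1 : geom_points T (pt Qc (const_mx 1)) by rewrite TE; exists (const_mx 1).
  have key I1 I2 : geom_points T = zeros idfun I1 `|` zeros idfun I2 ->
      zeros idfun I1 `&` zeros idfun I2 = set0 ->
      zeros idfun I1 (pt Qc (const_mx 1)) -> zeros idfun I2 = set0 :> set 'M[C]_n.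
    move=> cover disj one; apply/seteqP; split=> // x x2.
    have : geom_points T x by rewrite cover; right.
    rewrite TE => -[d cd dE]; rewrite -disj; split=> //; rewrite -dE.
    have con := @vclosure_connected C n Qc^T Qc Dc Dc1 Dcu Dcs I1 I2.
    apply: con => // [e ce|e e12].
      have : geom_points T (pt Qc e) by rewrite TE; exists e.
      by rewrite cover.
    suff : (set0 : set 'M[C]_n) (pt Qc e) by [].
    by rewrite -disj.
  move=> _ _ [I1 ->] [I2 ->] cover disj.
  have := T1; rewrite cover => -[one|one]; [right|left].
    exact: key cover disj one.
  by apply: (key I2 I1); rewrite 1?setUC 1?setIC.
- exists Q; first by have := mulmx1_unit QQ => -[].
  rewrite TE => _ [d cd <-].
  have <- : Qc^T = invmx Qc.
    have [u _] := mulmx1_unit QcQc.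
    by rewrite -[LHS]mul1mx -(mulVmx u) -mulmxA QcQc mulmx1.
  by rewrite pt_conj // diag_mx_is_diag.
Qed.

End BinomialTorus.

Lemma vmulACA (L : fieldType) n (a b c d : 'rV[L]_n) :
  vmul (vmul a b) (vmul c d) = vmul (vmul a c) (vmul b d).
Proof. by apply/rowP => j; rewrite !mxE mulrACA. Qed.

(** * Elements that commute with a maximal split torus *)

Section Maximality.
Variables (K : rcfType) (n : nat) (S : set (mxpol n K)).
Hypothesis sS : split_torus S.
Hypothesis hST : forall s, geom_points S s -> s^T = s.

Local Notation C := (K[i]%C).
Let rc : {rmorphism K -> C} := real_complex K.

(* Two commuting symmetric families are diagonalized in turn: a basis adapted to
   the projections onto the joint eigenspaces of the first one respects it. *)
Lemma torus_coordinates_with (p : 'M[K]_n) : p^T = p ->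
  (forall s, geom_points S s -> map_mx rc p *m s = s *m map_mx rc p) ->
  exists2 Q : 'M[K]_n, Q *m Q^T = 1%:M & is_diag_mx (Q *m p *m Q^T) /\
    forall s, geom_points S s -> is_diag_mx (map_mx rc Q *m s *m (map_mx rc Q)^T).
Proof.
move=> pT pS.
have [Q QQ Qdiag] := torus_orthogonal_coordinates sS hST.
have QcQc : map_mx rc Q *m (map_mx rc Q)^T = 1%:M.
  by rewrite map_trmx -map_mxM QQ map_mx1.
pose B := Q *m p *m Q^T.
pose dv s := \row_j (map_mx rc Q *m s *m (map_mx rc Q)^T) j j.
have dvE s : geom_points S s -> map_mx rc Q *m s *m (map_mx rc Q)^T = diag_mx (dv s).
  move=> Ss; rewrite {1}(diag_pt QcQc (Qdiag s Ss)) pt_conj //.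
pose e i j := `[< forall s, geom_points S s -> dv s 0 i = dv s 0 j >].
have eR i : e i i by apply/asboolP.
have eS i j : e i j = e j i.
  by apply/asboolP/asboolP => h s Ss; rewrite h.
have eT i j k : e i j -> e j k -> e i k.
  by move=> /asboolP h /asboolP h'; apply/asboolP => s Ss; rewrite h // h'.
have eE i j k : e i j -> e i k = e j k.
  move=> ij; apply/idP/idP => h; last exact: eT ij h.
  by apply: eT h; rewrite eS.
have eB i j : B i j != 0 -> e i j.
  move=> Bij; apply/asboolP => s Ss.
  have : map_mx rc B *m diag_mx (dv s) = diag_mx (dv s) *m map_mx rc B.
    rewrite -dvE // /B !map_mxM -map_trmx !mulmxA.
    rewrite -(mulmxA _ _^T (map_mx rc Q)) (mulmx1C QcQc) mulmx1.
    rewrite -(mulmxA _ _^T (map_mx rc Q)) (mulmx1C QcQc) mulmx1.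
    by rewrite -(mulmxA _ (map_mx rc p)) pS // mulmxA.
  move=> /matrixP/(_ i j); rewrite mul_mx_diag mul_diag_mx mxE [RHS]mxE.
  rewrite [X in X * _]mxE [X in _ = _ * X]mxE [RHS]mulrC => h.
  by apply/esym; apply: mulfI h; rewrite fmorph_eq0.
(* The projection onto the joint eigenspace that belongs to [i]. *)
pose Dl i : 'M[K]_n := diag_mx (\row_j (e i j)%:R).
have BT : B^T = B by rewrite /B !trmx_mul trmxK pT mulmxA.
have BD i : B *m Dl i = Dl i *m B.
  apply/matrixP => a b; rewrite mul_mx_diag mul_diag_mx mxE [RHS]mxE.
  rewrite [X in _ * X = _]mxE [X in _ = X * _]mxE.
  have [->|/eB ab] := eqVneq (B a b) 0; first by rewrite mul0r mulr0.
  by rewrite mulrC [e i b]eS [e i a]eS (eE _ _ _ ab).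
have [U UU [UB Ud]] : exists2 U : 'M[K]_n, U *m U^T = 1%:M &
    is_diag_mx (U *m B *m U^T) /\ forall i, is_diag_mx (U *m Dl i *m U^T).
  have [A|A A'|U UU Us] := @symmetric_codiagonalization K n (B :: codom Dl).
  - by rewrite inE => /orP[/eqP ->//|/codomP[i ->]]; rewrite tr_diag_mx.
  - rewrite !inE => /orP[/eqP ->|/codomP[i ->]] /orP[/eqP ->|/codomP[j ->]] //.
    by rewrite diag_mxC.
  exists U => //; split=> [|i]; apply: Us; rewrite inE ?eqxx //.
  by rewrite codom_f orbT.
exists (U *m Q).
  by rewrite trmx_mul mulmxA -(mulmxA U) QQ mulmx1.
split=> [|s Ss].
  by rewrite trmx_mul !mulmxA -[U *m Q *m p *m Q^T]mulmxA -(mulmxA U) (mulmxA Q).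
have -> : map_mx rc (U *m Q) *m s *m (map_mx rc (U *m Q))^T =
    map_mx rc U *m diag_mx (dv s) *m (map_mx rc U)^T.
  by rewrite -dvE // map_mxM trmx_mul !mulmxA.
have UD (i a b : 'I_n) : a != b :> nat -> \sum_j U a j * (e i j)%:R * U b j = 0.
  move=> ab; have /is_diag_mxP/(_ a b ab) := Ud i.
  by rewrite mxE => h; rewrite -[RHS]h; apply: eq_bigr => j _; rewrite mul_mx_diag !mxE.
apply/is_diag_mxP => a b ab; rewrite mxE.
pose N j := #|[pred k | e j k]|.
have N0 j : (N j)%:R != 0 :> C.
  by rewrite pnatr_eq0 -lt0n; apply/card_gt0P; exists j; rewrite inE.
(* [s] is a combination of the projections with its eigenvalues as coefficients. Each projection is
   listed once for every index of its class, hence the division by [N i]. *)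
transitivity (\sum_i dv s 0 i / (N i)%:R * rc (\sum_j U a j * (e i j)%:R * U b j)); last first.
  by apply: big1 => i _; rewrite UD ?rmorph0 ?mulr0.
under [RHS]eq_bigr do rewrite rmorph_sum mulr_sumr.
rewrite exchange_big; apply: eq_bigr => j _ /=; rewrite mul_mx_diag.
rewrite (eq_bigr (fun i => dv s 0 j / (N j)%:R * rc (U a j) * rc (U b j) *+ e j i)); last first.
  move=> i _; rewrite [e i j]eS; case: (boolP (e j i)) => [ji|_]; last first.
    by rewrite mulr0 mul0r rmorph0 mulr0.
  have -> : dv s 0 i = dv s 0 j by have /asboolP -> := ji.
  have -> : N i = N j by apply: eq_card => k; rewrite !inE (eE _ _ _ ji).
  by rewrite mulr1 rmorphM /= mulrA.
have NE : (\sum_i e j i)%N = N j.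
  by rewrite /N -sum1_card [RHS]big_mkcond; apply: eq_bigr => i _; rewrite inE; case: (e j i).
rewrite sumrMnr NE -[RHS]mulr_natr.
rewrite [RHS]mulrC !mulrA [(N j)%:R * _]mulrC mulfK //.
have Ua : map_mx rc U a j = rc (U a j) by rewrite mxE.
have Ub : (map_mx rc U)^T j b = rc (U b j) by rewrite !mxE.
by rewrite mxE Ua Ub [rc _ * dv s 0 j]mulrC.
Qed.

(* Otherwise the binomial torus through S and p would be larger than S. *)
Lemma torus_maximal (G : set (mxpol n K)) (p : 'M[K]_n) :
  alg_subgroup_SL G -> maximal_split_torus G S ->
  zeros idfun G p -> is_gram p ->
  (forall s, zeros idfun S s -> is_gram s -> p *m s = s *m p) ->
  zeros idfun S p.
Proof.
move=> [[G1 _ GM _] Gdet] [_ SG Smax] Gp [q0 q0E] pS.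
have [Q0 QQ0 Qdiag0] := torus_orthogonal_coordinates sS hST.
have pT : p^T = p by rewrite q0E trmx_mul trmxK.
have detp : \det p = 1.
  apply: (fmorph_inj rc); rewrite rmorph1 -det_map_mx.
  by apply: Gdet; apply/(zeros_map rc).
(* Commutation with [p] is a polynomial condition on [s], so it spreads from the positive points
   over [K] to all geometric points. *)
have pSc s : geom_points S s -> map_mx rc p *m s = s *m map_mx rc p.
  move=> Ss; have [d Sd ->] := torus_pt QQ0 Qdiag0 Ss.
  apply/matrixP => a b; apply/eqP; rewrite -subr_eq0; apply/eqP.
  have [f fE] := MultivariatePolynomials.upolyD (upoly_conj p 1%:M a b)
    (upolyN (upoly_conj 1%:M p a b)).
  have fE' x : mxeval rc f x = (map_mx rc p *m x) a b - (x *m map_mx rc p) a b.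
    by rewrite fE !map_mx1 mulmx1 mul1mx.
  rewrite -fE'.
  apply: (@mxeval_vclosure K C rc n _ _ f (pos_coords S Q0)) (torus_dense sS QQ0 Qdiag0 Sd).
  - exists (const_mx 1); first by apply/rowP => j; rewrite !mxE rmorph1.
    split=> [j|]; first by rewrite mxE.
    rewrite pt1 //; apply/(zeros_map rc); rewrite map_mx1.
    by case: sS => -[[]].
  - move=> _ _ [x -> [x0 Sx]] [y -> [y0 Sy]]; exists (vmul x y).
      by apply/rowP => j; rewrite !mxE rmorphM.
    split=> [j|]; first by rewrite mxE mulr_gt0.
    rewrite ptM //; apply/(zeros_map rc); rewrite map_mxM.
    by case: sS => -[[_ _ SM _] _] _ _; apply: SM; apply/(zeros_map rc).
  - move=> _ [x -> [x0 Sx]]; rewrite -[_ *m _ *m _]/(pt _ _) pt_map fE' -!map_mxM.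
    by rewrite pS ?subrr //; apply: pos_gram.
have [Q QQ [Qp Qdiag]] := torus_coordinates_with pT pSc.
have QcQc : map_mx rc Q *m (map_mx rc Q)^T = 1%:M.
  by rewrite map_trmx -map_mxM QQ map_mx1.
pose dp := \row_j (Q *m p *m Q^T) j j.
have pE : p = pt Q dp by exact: diag_pt.
have dp0 j : 0 < dp 0 j.
  apply: (@gram_pt_pos _ _ Q) => [//|k|]; last by rewrite -pE; exists q0.
  apply/eqP => dk; move: detp; rewrite pE det_pt // (bigD1 k) //= dk mul0r.
  by move=> /esym/eqP; rewrite oner_eq0.
pose dk k : 'rV[K]_n := \row_j dp 0 j ^+ k.
have dkD k l : dk (k + l)%N = vmul (dk k) (dk l).
  by apply/rowP => j; rewrite mxE [RHS]mxE ![dk _ 0 j]mxE exprD.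
(* The coordinates of the products of a positive point of [S] with a power of [p]; they form a
   monoid, and its matrices lie in [G]. *)
pose D : set 'rV[K]_n := [set d | exists (d1 : 'rV[K]_n) k, [/\ forall j, 0 < d1 0 j,
  zeros idfun S (pt Q d1) & d = vmul d1 (dk k)]].
have S1 : zeros idfun S (pt Q (const_mx 1)).
  rewrite pt1 //; apply/(zeros_map rc); rewrite map_mx1.
  by case: sS => -[[]].
have D1 : D (const_mx 1).
  exists (const_mx 1), 0%N; split=> // [j|]; first by rewrite mxE.
  by apply/rowP => j; rewrite [RHS]mxE [dk _ 0 j]mxE expr0 mulr1 ?mxE.
have Dpos (d : 'rV[K]_n) : D d -> forall j, 0 < d 0 j.
  by move=> [d1 [k [d10 _ ->]]] j; rewrite mxE [dk k 0 j]mxE mulr_gt0 ?exprn_gt0.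
have DG (d : 'rV[K]_n) : D d -> zeros idfun G (pt Q d).
  move=> [d1 [k [_ Sd ->]]]; rewrite ptM //; apply/(zeros_map rc); rewrite map_mxM.
  apply: (GM); first by apply: SG; apply/(zeros_map rc).
  elim: k => [|k IH].
    rewrite (_ : dk 0%N = const_mx 1) ?pt1 ?map_mx1 //.
    by apply/rowP => j; rewrite mxE expr0 [RHS]mxE.
  rewrite (_ : dk k.+1 = vmul dp (dk k)); last by apply/rowP => j; rewrite mxE [RHS]mxE [dk k 0 j]mxE exprS.
  by rewrite ptM // map_mxM -pE; apply: (GM) => //; apply/(zeros_map rc).
have Ddet (d : 'rV[K]_n) : D d -> \prod_j d 0 j = 1.
  move=> /DG Gd; rewrite -(det_pt QQ); apply: (fmorph_inj rc).
  by rewrite rmorph1 -det_map_mx; apply: Gdet; apply/(zeros_map rc).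
have [T [sT TE]] := binomial_torus QQ D1 Dpos Ddet.
have TS : geom_points T = geom_points S.
  apply: Smax => //.
    rewrite TE => _ [d cd <-] f Gf.
    apply: (@mxeval_vclosure K C rc n _ _ f [set map_mx rc d | d in D]) cd.
    - by exists (const_mx 1) => //; apply/rowP => j; rewrite !mxE rmorph1.
    - move=> _ _ [x Dx <-] [y Dy <-]; exists (vmul x y); last first.
        by apply/rowP => j; rewrite !mxE rmorphM.
      case: Dx Dy => [x1 [k [x0 Sx ->]]] [y1 [l [y0 Sy ->]]].
      exists (vmul x1 y1), (k + l)%N; split=> [j||].
      + by rewrite mxE mulr_gt0.
      + rewrite ptM //; apply/(zeros_map rc); rewrite map_mxM.
        by case: sS => -[[_ _ SM _] _] _ _; apply: SM; apply/(zeros_map rc).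
      + by rewrite dkD vmulACA.
    - move=> _ [x Dx <-]; rewrite -[_ *m _ *m _]/(pt _ _) pt_map mxeval_map.
      by rewrite (DG x Dx) ?rmorph0.
  move=> s Ss; have [d Sd ->] := torus_pt QQ Qdiag Ss.
  rewrite TE; exists d => // m m' mm'; apply: (torus_dense sS QQ Qdiag Sd) => _ [x -> [x0 Sx]].
  apply: mm'; exists x => //; exists x, 0%N; split=> //.
  by apply/rowP => j; rewrite [RHS]mxE [dk _ 0 j]mxE expr0 mulr1 ?mxE.
apply/(zeros_map rc); rewrite -[zeros _ _ _]/(geom_points S _) -TS TE pE -pt_map.
exists (map_mx rc dp) => // m m'; apply; exists dp => //.
exists (const_mx 1), 1%N; split=> // [j|]; first by rewrite mxE.
by apply/rowP => j; rewrite [RHS]mxE [const_mx 1 0 j]mxE [dk _ 0 j]mxE mul1r expr1.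
Qed.

End Maximality.


(* The notations of the analysis library clash with those of mpoly, which the
   module MultivariatePolynomials imports. *)
From mathcomp Require Import all_classical all_reals all_analysis.
From mathcomp Require Import lra.

Import Order.TTheory GRing.Theory Num.Theory.
Import numFieldNormedType.Exports.

Local Open Scope classical_set_scope.
Local Open Scope ring_scope.

(** * The matrix exponential *)

Section MatrixExponential.
Variables (R : realType) (n : nat).
Implicit Types (X Y P Q : 'M[R]_n) (t : R).

Lemma mulE X Y : X * Y = X *m Y. Proof. by []. Qed.

Definition exp_sum (N : nat) X : 'M[R]_n := \sum_(k < N) k`!%:R^-1 *: X ^+ k.

Definition l1norm X : R := \sum_i \sum_j `|X i j|.

Lemma l1norm_ge0 X : 0 <= l1norm X.
Proof. by apply: sumr_ge0 => i _; apply: sumr_ge0. Qed.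

Lemma mx_expr_bound X k i j : `|(X ^+ k) i j| <= l1norm X ^+ k.
Proof.
elim: k i j => [|k IH] i j.
  rewrite !expr0 mxE; case: (i == j); last by rewrite normr0.
  by rewrite normr1.
rewrite !exprS mxE; apply: le_trans (ler_norm_sum _ _ _) _.
apply: (@le_trans _ _ (\sum_l `|X i l| * l1norm X ^+ k)).
  by apply: ler_sum => l _; rewrite normrM ler_wpM2l.
rewrite -mulr_suml ler_wpM2r ?exprn_ge0 ?l1norm_ge0 //.
rewrite /l1norm [leRHS](bigD1 i) //= lerDl.
by apply: sumr_ge0 => a _; apply: sumr_ge0.
Qed.

Let term X i j : R^nat := fun k => (X ^+ k) i j / k`!%:R.

Lemma term_bound X i j k : `|term X i j k| <= exp_coeff (l1norm X) k.
Proof.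
rewrite /term /exp_coeff /= normrM normfV (ger0_norm (ler0n _ _)).
by rewrite ler_wpM2r ?invr_ge0 ?ler0n ?mx_expr_bound.
Qed.

Lemma mx_exp_cvg X i j : (fun N => exp_sum N X i j) @ \oo --> mx_exp X i j.
Proof.
rewrite mxE (_ : (fun N => _) = (fun N => \sum_(k < N) (X ^+ k) i j / k`!%:R)).
  have -> : (fun N => \sum_(k < N) (X ^+ k) i j / k`!%:R) = series (term X i j).
    by apply/funext => N; rewrite /series /= big_mkord.
  apply: normed_cvg; apply: series_le_cvg (is_cvg_series_exp_coeff (l1norm X)) => k.
  - exact: normr_ge0.
  - by rewrite /exp_coeff /= divr_ge0 ?exprn_ge0 ?l1norm_ge0 ?ler0n.
  - exact: term_bound.
apply/funext => N; rewrite /exp_sum summxE.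
by apply: eq_bigr => k _; rewrite mxE mulrC.
Qed.

Lemma mx_exp_unique X Y :
  (forall i j, (fun N => exp_sum N X i j) @ \oo --> Y i j) -> mx_exp X = Y.
Proof.
move=> XY; apply/matrixP => i j.
exact: (cvg_unique _ (@mx_exp_cvg X i j) (XY i j)).
Qed.

Lemma cvg_bigsum (T : Type) (A : set_system T) {FA : Filter A} (I : Type) (r : seq I)
    (u : I -> T -> R) (l : I -> R) :
  (forall k, u k @ A --> l k) ->
  (fun N => \sum_(k <- r) u k N) @ A --> \sum_(k <- r) l k.
Proof.
move=> ul; elim: r => [|k r IH].
  rewrite big_nil (_ : (fun N => _) = fun=> 0); first exact: cvg_cst.
  by apply/funext => N; rewrite big_nil.
rewrite big_cons (_ : (fun N => _) = u k + (fun N => \sum_(k <- r) u k N)).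
  exact: cvgD.
by apply/funext => N; rewrite big_cons.
Qed.

Lemma mx_exp_tr X : mx_exp X^T = (mx_exp X)^T.
Proof.
apply: mx_exp_unique => i j; rewrite mxE.
suff -> : (fun N => exp_sum N X^T i j) = (fun N => exp_sum N X j i).
  exact: mx_exp_cvg.
apply/funext => N; rewrite !summxE; apply: eq_bigr => k _; rewrite mxE [RHS]mxE.
congr (_ * _); have -> : X^T ^+ k = (X ^+ k)^T.
  elim: (val k) => [|a IH]; first by rewrite !expr0 -[LHS]trmx1.
  by rewrite exprS exprSr IH -[X ^+ a * X]/(X ^+ a *m X) trmx_mul.
by rewrite mxE.
Qed.

Lemma mx_exp_conj P Q X : Q *m P = 1%:M -> mx_exp (P *m X *m Q) = P *m mx_exp X *m Q.
Proof.
move=> QP; apply: mx_exp_unique => i j.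
have PQ : P *m Q = 1%:M := mulmx1C QP.
have pow k : (P *m X *m Q) ^+ k = P *m X ^+ k *m Q.
  elim: k => [|k IH]; first by rewrite !expr0 -[1 in RHS]/(1%:M) mulmx1 PQ.
  rewrite !exprS IH !mulE !mulmxA -(mulmxA _ Q P) QP mulmx1.
  by rewrite -(mulmxA P X).
have -> : (fun N => exp_sum N (P *m X *m Q) i j) =
    (fun N => \sum_b (\sum_a P i a * exp_sum N X a b) * Q b j).
  apply/funext => N; have -> : exp_sum N (P *m X *m Q) = P *m exp_sum N X *m Q.
    rewrite /exp_sum mulmx_sumr mulmx_suml; apply: eq_bigr => k _.
    by rewrite pow -scalemxAr -scalemxAl.
  by rewrite mxE; apply: eq_bigr => b _; rewrite mxE.
have -> : (P *m mx_exp X *m Q) i j = \sum_b (\sum_a P i a * mx_exp X a b) * Q b j.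
  by rewrite mxE; apply: eq_bigr => b _; rewrite mxE.
apply: cvg_bigsum => b; apply: cvgM; last exact: cvg_cst.
apply: cvg_bigsum => a; apply: cvgM; first exact: cvg_cst.
exact: mx_exp_cvg.
Qed.

Lemma mx_exp_diag (d : 'rV[R]_n) : mx_exp (diag_mx d) = diag_mx (map_mx expR d).
Proof.
apply: mx_exp_unique => i j.
have pow k : diag_mx d ^+ k = diag_mx (map_mx (fun x => x ^+ k) d).
  elim: k => [|k IH].
    by rewrite expr0; apply/matrixP => a b; rewrite !mxE expr0.
  rewrite exprS IH mulE; apply/matrixP => a b; rewrite mul_diag_mx !mxE.
  by case: eqP => _; rewrite ?mulr1n ?exprS // !mulr0n mulr0.
rewrite [diag_mx _ i j]mxE mxE; case: (eqVneq i j) => [<-|ij].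
  rewrite mulr1n (_ : (fun N => _) = series (exp_coeff (d 0 i))).
    exact: is_cvg_series_exp_coeff.
  apply/funext => N; rewrite /series /= big_mkord /exp_sum summxE.
  apply: eq_bigr => k _; rewrite mxE pow !mxE eqxx mulr1n mulrC.
  by rewrite /exp_coeff.
rewrite mulr0n (_ : (fun N => _) = fun=> 0); first exact: cvg_cst.
apply/funext => N; rewrite /exp_sum summxE big1 // => k _.
by rewrite mxE pow !mxE (negbTE ij) mulr0.
Qed.

Lemma mx_exp_pt Q (d : 'rV[R]_n) : Q *m Q^T = 1%:M ->
  mx_exp (pt Q d) = pt Q (map_mx expR d).
Proof. by move=> QQ; rewrite /pt mx_exp_conj ?mx_exp_diag. Qed.

Lemma mx_exp_nilpotent X : X ^+ n = 0 -> mx_exp X = nil_exp X.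
Proof.
move=> Xn; apply: mx_exp_unique => i j.
apply: cvg_near_cst.
exists n => // N /= nN; rewrite /nil_exp /exp_sum.
congr fun_of_matrix; rewrite -!(big_mkord xpredT (fun k => k`!%:R^-1 *: X ^+ k)).
rewrite (big_cat_nat (leq0n n) nN) //= [X in _ + X]big_nat_cond [X in _ + X]big1 ?addr0 // => k.
rewrite andbT => /andP[nk _].
by rewrite -(subnK nk) exprD Xn mulr0 scaler0.
Qed.

(** From order 3 on, each term is at most [|t|^3] times the corresponding term of the exponential
    series of [l1norm X]; the sum of that series is the constant. *)
Lemma mx_exp_taylor X : exists2 c : R, 0 <= c & forall t i j, `|t| <= 1 ->
  `|mx_exp (t *: X) i j - ((i == j)%:R + t * X i j + t ^+ 2 * (X *m X) i j / 2)|
    <= c * `|t| ^+ 3.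
Proof.
exists (expR (l1norm X)); first exact: expR_ge0.
move=> t i j t1.
set e := (X in _ - X); set b := (X in _ <= X).
have cv : (fun N => `|exp_sum N (t *: X) i j - e|) @ \oo --> `|mx_exp (t *: X) i j - e|.
  apply: cvg_norm; apply: cvgB; [exact: mx_exp_cvg|exact: cvg_cst].
apply: (cvgr_to_le cv).
exists 3%N => // N /= N3.
have powZ k : (t *: X) ^+ k = t ^+ k *: X ^+ k.
  elim: k => [|k IH]; first by rewrite !expr0 scale1r.
  by rewrite !exprS IH !mulE -scalemxAl -scalemxAr scalerA.
have -> : exp_sum N (t *: X) i j - e = \sum_(3 <= k < N) t ^+ k * term X i j k.
  rewrite /exp_sum summxE (_ : \sum_(k < N) _ = \sum_(k < N) t ^+ k * term X i j k).
    rewrite -(big_mkord xpredT (fun k => t ^+ k * term X i j k)) (big_cat_nat (leq0n 3) N3) //=.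
    rewrite (_ : \sum_(0 <= k < 3) _ = e) ?[e + _]addrC ?addrK //.
    have t0 : term X i j 0 = (i == j)%:R by rewrite /term expr0 fact0 divr1 mxE.
    have t1' : term X i j 1 = X i j by rewrite /term expr1 divr1.
    have t2 : term X i j 2 = (X *m X) i j / 2 by rewrite /term expr2.
    rewrite (big_ltn (isT : (0 < 3)%N)) (big_ltn (isT : (1 < 3)%N)).
    rewrite (big_ltn (isT : (2 < 3)%N)) (big_geq (leqnn 3)).
    by rewrite addr0 addrA t0 t1' t2 /e expr0 mul1r expr1 mulrA.
  by apply: eq_bigr => k _; rewrite powZ !mxE /term mulrCA [_^-1 * _]mulrC.
apply: le_trans (ler_norm_sum _ _ _) _.
apply: (@le_trans _ _ (\sum_(3 <= k < N) `|t| ^+ 3 * exp_coeff (l1norm X) k)).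
  rewrite big_nat_cond [leRHS]big_nat_cond; apply: ler_sum => k.
  rewrite andbT => /andP[k3 _]; rewrite normrM; apply: ler_pM => //.
    by rewrite normrX; apply: ler_wiXn2l.
  exact: term_bound.
rewrite -mulr_sumr /b mulrC ler_wpM2r ?exprn_ge0 //.
apply: (@le_trans _ _ (series (exp_coeff (l1norm X)) N)).
  rewrite /series /= (big_cat_nat (leq0n 3) N3) //= lerDr.
  by apply: sumr_ge0 => k _; rewrite divr_ge0 ?exprn_ge0 ?l1norm_ge0 ?ler0n.
apply: nondecreasing_cvgn_le (is_cvg_series_exp_coeff _) _.
apply/nondecreasing_seqP => m; rewrite /series /= big_nat_recr //= lerDl.
by rewrite divr_ge0 ?exprn_ge0 ?l1norm_ge0 ?ler0n.
Qed.

End MatrixExponential.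

Section Inverse.
Variables (R : realType) (n : nat).
Implicit Types X : 'M[R]_n.

Lemma triangle_sum (V : nmodType) (N : nat) (f : nat -> nat -> V) :
  \sum_(0 <= i < N) \sum_(0 <= j < N | (i + j < N)%N) f i j =
  \sum_(0 <= k < N) \sum_(0 <= i < k.+1) f i (k - i)%N.
Proof.
transitivity (\sum_(0 <= i < N) \sum_(0 <= k < N | (i <= k)%N) f i (k - i)%N).
  rewrite !big_nat; apply: eq_bigr => i /andP[_ iN].
  rewrite (eq_bigl (fun j => true && (j < N - i)%N)); last first.
    by move=> j /=; rewrite ltn_subRL.
  rewrite -(big_nat_widen _ _ _ (fun=> true)) ?leq_subr //.
  rewrite (eq_bigr (fun j => f i (j + i - i)%N)); last by move=> j _; rewrite addnK.
  rewrite -(big_addn 0 N i xpredT (fun k => f i (k - i)%N)) add0n.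
  by rewrite (big_nat_widenl i 0) //; apply: eq_bigl => k.
under eq_bigr do rewrite big_mkcond.
rewrite exchange_big_nat /= !big_nat; apply: eq_bigr => k /andP[_ kN].
rewrite -big_mkcond (big_nat_widen _ _ _ xpredT _ kN) /=.
by apply: eq_bigl => i; rewrite ltnS.
Qed.

(** The coefficient of the [k]-th power in the product of the series of [X] and [- X]; after
    multiplication by [k!] it is the binomial expansion of [(-1 + 1)^k]. *)
Lemma alternating_factorials k :
  \sum_(0 <= i < k.+1) i`!%:R^-1 * ((-1) ^+ (k - i) / (k - i)`!%:R) = (k == 0%N)%:R :> R.
Proof.
have fact0 (a : nat) : a`!%:R != 0 :> R by rewrite pnatr_eq0 -lt0n fact_gt0.
apply: (mulfI (fact0 k)); rewrite mulr_sumr.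
transitivity (((-1) + 1 : R) ^+ k).
  rewrite exprDn big_mkord; apply: eq_bigr => i _; rewrite expr1n mulr1.
  have ik : (i <= k)%N by rewrite -ltnS.
  rewrite -(bin_fact ik) !natrM -mulr_natr; field.
  by rewrite !fact0.
rewrite addNr expr0n; case: k => [|k]; last by rewrite mulr0.
by rewrite mulr1.
Qed.

Lemma exp_sum_inverse X N : (0 < N)%N -> exp_sum N X *m exp_sum N (- X) = 1%:M +
  \sum_(0 <= i < N) \sum_(0 <= j < N | ~~ (i + j < N)%N)
    (i`!%:R^-1 * ((-1) ^+ j / j`!%:R)) *: X ^+ (i + j).
Proof.
move=> N0; pose f i j : 'M[R]_n := (i`!%:R^-1 * ((-1) ^+ j / j`!%:R)) *: X ^+ (i + j).
have powN k : (- X) ^+ k = (-1) ^+ k *: X ^+ k.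
  elim: k => [|k IH]; first by rewrite !expr0 scale1r.
  by rewrite !exprS IH !mulE -scalemxAr mulNmx scalerN mulN1r scaleNr.
have -> : exp_sum N X *m exp_sum N (- X) = \sum_(0 <= i < N) \sum_(0 <= j < N) f i j.
  rewrite /exp_sum mulmx_suml big_mkord; apply: eq_bigr => i _.
  rewrite mulmx_sumr big_mkord; apply: eq_bigr => j _.
  rewrite powN -scalemxAl -!scalemxAr !scalerA /f exprD -mulE mulrA; congr (_ *: _).
  by rewrite -!mulrA; congr (_ * _); rewrite mulrC.
have -> : 1%:M = \sum_(0 <= i < N) \sum_(0 <= j < N | (i + j < N)%N) f i j.
  rewrite triangle_sum (eq_bigr (fun k => (k == 0%N)%:R *: X ^+ k)); last first.
    move=> k _; rewrite -alternating_factorials scaler_suml !big_nat.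
    apply: eq_bigr => i /andP[_ ik]; rewrite /f subnKC // -ltnS //.
  rewrite big_ltn // eqxx scale1r expr0 big_nat_cond big1 ?addr0 // => k.
  by case: k => // k _; rewrite scale0r.
rewrite -big_split; apply: eq_bigr => i _ /=.
exact: (bigID (fun j => i + j < N)%N).
Qed.

(* The terms of the product of the partial sums that do not cancel lie outside the
   triangle i + j < 2M, hence outside the square i, j < M. *)
Lemma mx_expN X : mx_exp X *m mx_exp (- X) = 1%:M.
Proof.
pose e N := series (exp_coeff (l1norm X)) N.
pose c i j : R := l1norm X ^+ (i + j) / (i`!%:R * j`!%:R).
have c0 i j : 0 <= c i j.
  by rewrite divr_ge0 ?exprn_ge0 ?l1norm_ge0 // mulr_ge0 ?ler0n.
have eE N M : e N * e M = \sum_(0 <= i < N) \sum_(0 <= j < M) c i j.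
  rewrite /e /series /= mulr_suml; apply: eq_bigr => i _.
  rewrite mulr_sumr; apply: eq_bigr => j _; rewrite /exp_coeff /= /c exprD.
  by rewrite invfM mulrACA.
(* The leftover terms are compared with the scalar terms of index in [[0, 2M)^2] outside [[0, M)^2].
   The two scalar products on the right have the same limit. *)
have bound M a b : (0 < M)%N ->
    `|(exp_sum (M + M) X *m exp_sum (M + M) (- X)) a b - (a == b)%:R|
      <= e (M + M)%N * e (M + M)%N - e M * e M.
  move=> M0; rewrite exp_sum_inverse ?addn_gt0 ?M0 //.
  rewrite mxE [X in X + _ - _]mxE addrAC subrr add0r summxE.
  apply: le_trans (ler_norm_sum _ _ _) _.
  apply: (@le_trans _ _ (\sum_(0 <= i < M + M)
     \sum_(0 <= j < M + M | ~~ (i + j < M + M)%N) c i j)).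
    apply: ler_sum => i _; rewrite summxE; apply: le_trans (ler_norm_sum _ _ _) _.
    apply: ler_sum => j _; rewrite mxE !normrM !normfV normrX normrN1 expr1n mul1r.
    rewrite !(ger0_norm (ler0n _ _)) -invfM /c [leLHS]mulrC; apply: ler_wpM2r.
      by rewrite invr_ge0 mulr_ge0 ?ler0n.
    exact: mx_expr_bound.
  rewrite lerBrDr !eE.
  have -> : \sum_(0 <= i < M + M) \sum_(0 <= j < M + M) c i j =
     \sum_(0 <= i < M + M) \sum_(0 <= j < M + M | ~~ (i + j < M + M)%N) c i j +
     \sum_(0 <= i < M + M) \sum_(0 <= j < M + M | (i + j < M + M)%N) c i j.
    rewrite -big_split; apply: eq_bigr => i _ /=.
    by rewrite addrC; apply: (bigID (fun j => i + j < M + M)%N).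
  rewrite lerD2l (big_cat_nat (leq0n M) (leq_addr M M)) /=.
  rewrite -[leLHS]addr0; apply: lerD; last first.
    by apply: sumr_ge0 => i _; apply: sumr_ge0.
  rewrite big_nat [leRHS]big_nat; apply: ler_sum => i /andP[_ iM].
  rewrite [leRHS](big_cat_nat (leq0n M) (leq_addr M M)) /=.
  rewrite -[leLHS]addr0; apply: lerD; last by apply: sumr_ge0.
  rewrite big_nat_cond [leRHS]big_nat_cond.
  rewrite (eq_bigl (fun j => (0 <= j < M)%N && (i + j < M + M)%N)) // => j.
  rewrite andbT; case: (ltnP j M) => //= jM; apply/esym.
  by apply: leq_trans (leq_add iM jM); rewrite addSn ltnS leq_add2l.
have cvge : e @ \oo --> expR (l1norm X) by apply: is_cvg_series_exp_coeff.
have two : (fun M => (M + M)%N) @ \oo --> \oo.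
  move=> A [N _ NA]; exists N => // M /= NM; apply: NA => /=.
  exact: leq_trans NM (leq_addr _ _).
have cvg2 (u : R^nat) (l : R) : u @ \oo --> l -> (fun M => u (M + M)%N) @ \oo --> l.
  by move=> ul; apply: (cvg_comp (fun M => (M + M)%N) u two ul).
have ee := cvgB (cvgM (cvg2 _ _ cvge) (cvg2 _ _ cvge)) (cvgM cvge cvge).
rewrite subrr in ee.
apply/matrixP => a b; rewrite [RHS]mxE.
pose w N := (exp_sum N X *m exp_sum N (- X)) a b.
have w1 : w @ \oo --> (mx_exp X *m mx_exp (- X)) a b.
  have -> : w = (fun N => \sum_j exp_sum N X a j * exp_sum N (- X) j b).
    by apply/funext => N; rewrite /w mxE.
  rewrite [X in _ --> X]mxE; apply: cvg_bigsum => j.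
  by apply: cvgM; apply: mx_exp_cvg.
apply: (cvg_unique _ (cvg2 _ _ w1)) => //.
apply/cvgrPdist_le => eps eps0.
move/(_ _ _ _)/cvgrPdist_le: ee => /(_ _ eps0) h.
near=> M; rewrite distrC; apply: le_trans (bound M a b _) _.
  by near: M; exists 1%N.
apply: le_trans (ler_norm _) _.
have : `|0 - ((e \o (fun M => (M + M)%N)) M * (e \o (fun M => (M + M)%N)) M - e M * e M)| <= eps.
  by near: M.
by rewrite sub0r normrN.
Unshelve. all: by end_near. Qed.

End Inverse.

(** * Second-order expansions *)

Section SecondOrder.
Variable R : realType.
Implicit Types (f h : R -> R) (t : R).

(** An explicit cubic error in place of derivatives: sums and products reduce to estimates, and the
    variations are read off as coefficients, [c] being half of a second derivative. *)
Definition taylor2 f (a b c : R) := exists2 C : R, 0 <= C & forall t, `|t| <= 1 ->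
  `|f t - (a + t * b + t ^+ 2 * c)| <= C * `|t| ^+ 3.

Lemma taylor2_ext f h a b c : f =1 h -> taylor2 f a b c -> taylor2 h a b c.
Proof. by move=> fh [C C0 fC]; exists C => // t t1; rewrite -fh fC. Qed.

Lemma taylor2_const a : taylor2 (fun=> a) a 0 0.
Proof. by exists 0 => // t _; rewrite !mulr0 !addr0 subrr normr0 mul0r. Qed.

Lemma taylor2D f h a b c a' b' c' : taylor2 f a b c -> taylor2 h a' b' c' ->
  taylor2 (fun t => f t + h t) (a + a') (b + b') (c + c').
Proof.
move=> [C C0 fC] [C' C'0 hC']; exists (C + C') => [|t t1]; first exact: addr_ge0.
have -> : f t + h t - (a + a' + t * (b + b') + t ^+ 2 * (c + c')) =
  (f t - (a + t * b + t ^+ 2 * c)) + (h t - (a' + t * b' + t ^+ 2 * c')) by ring.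
by rewrite mulrDl; apply: le_trans (ler_normD _ _) _; apply: lerD; [exact: fC|exact: hC'].
Qed.

Lemma taylor2M f h a b c a' b' c' : taylor2 f a b c -> taylor2 h a' b' c' ->
  taylor2 (fun t => f t * h t) (a * a') (a * b' + b * a') (a * c' + b * b' + c * a').
Proof.
move=> [C C0 fC] [C' C'0 hC'].
pose B : R := `|a| + `|b| + `|c|; pose B' : R := `|a'| + `|b'| + `|c'|.
exists (C * (B' + C') + B * C' + (`|b| * `|c'| + `|c| * `|b'| + `|c| * `|c'|)).
  by rewrite !addr_ge0 // mulr_ge0 // !addr_ge0.
move=> t t1; set p := a + t * b + t ^+ 2 * c; set p' := a' + t * b' + t ^+ 2 * c'.
have bnd x y z : `|x + t * y + t ^+ 2 * z| <= `|x| + `|y| + `|z|.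
  apply: le_trans (ler_normD _ _) _; apply: lerD.
    by apply: le_trans (ler_normD _ _) _; rewrite lerD2l normrM ler_piMl.
  by rewrite normrM normrX ler_piMl // exprn_ile1.
have -> : f t * h t - (a * a' + t * (a * b' + b * a') + t ^+ 2 * (a * c' + b * b' + c * a'))
  = (f t - p) * h t + p * (h t - p') +
    t ^+ 3 * (b * c' + c * b' + t * (c * c')) by rewrite /p /p'; ring.
have t30 : 0 <= `|t| ^+ 3 by rewrite exprn_ge0.
have hB : `|h t| <= B' + C'.
  rewrite -(subrK p' (h t)) addrC; apply: le_trans (ler_normD _ _) _.
  apply: lerD; first exact: bnd.
  by apply: le_trans (hC' t t1) _; rewrite ler_piMr // exprn_ile1.
rewrite [leRHS]mulrDl [X in _ <= X + _]mulrDl.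
apply: le_trans (ler_normD _ _) _; apply: lerD; last first.
  rewrite normrM normrX [leLHS]mulrC; apply: ler_wpM2r => //.
  apply: le_trans (ler_normD _ _) _; apply: lerD; last first.
    by rewrite !normrM ler_piMl // mulr_ge0.
  by apply: le_trans (ler_normD _ _) _; rewrite !normrM.
apply: le_trans (ler_normD _ _) _; apply: lerD.
  rewrite normrM.
  rewrite [leRHS]mulrAC; apply: ler_pM => //; exact: fC.
by rewrite normrM -[leRHS]mulrA; apply: ler_pM => //; [exact: bnd|exact: hC'].
Qed.

Lemma taylor2_sum (I : Type) (r : seq I) (f : I -> R -> R) (a b c : I -> R) :
  (forall k, taylor2 (f k) (a k) (b k) (c k)) ->
  taylor2 (fun t => \sum_(k <- r) f k t)
    (\sum_(k <- r) a k) (\sum_(k <- r) b k) (\sum_(k <- r) c k).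
Proof.
move=> fT; elim: r => [|k r IH].
  rewrite !big_nil; apply: taylor2_ext (taylor2_const 0) => t; by rewrite big_nil.
rewrite !big_cons; apply: taylor2_ext (taylor2D (fT k) IH) => t; by rewrite big_cons.
Qed.

(** If [b] were nonzero, the linear term would win at a small [t] of the same sign; after that a
    small [t] excludes a positive [c]. The sizes [|b| / (2 M)] and [c / (2 M)] are small enough
    because [M] dominates 1 and all the constants. *)
Lemma taylor2_max f a b c : taylor2 f a b c -> (forall t, f t <= a) -> b = 0 /\ c <= 0.
Proof.
move=> [C C0 fC] fa.
have h t : `|t| <= 1 -> t * b + t ^+ 2 * c <= C * `|t| ^+ 3.
  move=> t1; have := fC t t1; rewrite ler_norml => /andP[] + _.
  rewrite lerNl opprB => le1; apply: le_trans le1.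
  by have := fa t; lra.
pose M : R := 1 + `|b| + `|c| + C.
have M1 : 1 <= M by rewrite /M -!addrA lerDl !addr_ge0.
have M0 : 0 < M := lt_le_trans ltr01 M1.
have b0 : b = 0.
  apply/eqP; apply: contraT => bN0; exfalso.
  have nb : 0 < `|b| by rewrite normr_gt0.
  pose e : R := `|b| / (2 * M).
  have e0 : 0 < e by rewrite divr_gt0 ?mulr_gt0.
  have e1 : e <= 1.
    rewrite ler_pdivrMr ?mulr_gt0 // mul1r /M; have := normr_ge0 c; lra.
  have eM : e * M * 2 = `|b|.
    by rewrite /e; field; rewrite gt_eqF.
  have cM : `|c| + C <= M by rewrite /M; lra.
  have sg : exists2 t, `|t| = e & t * b = e * `|b|.
    exists (e * Num.sg b); first by rewrite normrM normr_sg bN0 mulr1 gtr0_norm.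
    by rewrite -mulrA -normrEsg.
  case: sg => t tE tb; have := h t; rewrite tE tb -real_normK ?num_real // tE => /(_ e1).
  have cl : - `|c| <= c by rewrite lerNl -normrN ler_norm.
  move=> H; have H2 : e * `|b| <= e ^+ 2 * (`|c| + C).
    have := ler_wpM2l (exprn_ge0 2 (ltW e0)) cl.
    have := ler_piMr (mulr_ge0 C0 (exprn_ge0 2 (ltW e0))) e1.
    rewrite -mulrA -exprSr; lra.
  have H3 : `|b| <= e * (`|c| + C).
    by rewrite -(ler_pM2l e0) mulrA -expr2.
  have := ler_wpM2l (ltW e0) cM; lra.
split=> //; rewrite leNgt; apply/negP => c0.
pose e : R := c / (2 * M).
have e0 : 0 < e by rewrite divr_gt0 ?mulr_gt0.
have cc : `|c| = c by rewrite gtr0_norm.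
have e1 : e <= 1.
  by rewrite ler_pdivrMr ?mulr_gt0 // mul1r /M cc; have := normr_ge0 b; lra.
have eM : e * M * 2 = c by rewrite /e; field; rewrite gt_eqF.
have := h e; rewrite gtr0_norm // b0 mulr0 add0r => /(_ e1).
have -> : C * e ^+ 3 = e ^+ 2 * (C * e) by ring.
rewrite ler_pM2l ?exprn_gt0 //.
have CM : C <= M by rewrite /M; have := normr_ge0 b; have := normr_ge0 c; lra.
have := ler_wpM2l (ltW e0) CM; lra.
Qed.

Lemma taylor2_cst f a b c : taylor2 f a b c -> (forall t, f t = a) -> b = 0.
Proof. by move=> /taylor2_max h fa; case: h => // t; rewrite fa. Qed.

Variable n : nat.
Implicit Types (M N : R -> 'M[R]_n) (A B C X : 'M[R]_n).

Definition mxtaylor2 M A B C :=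
  forall i j, taylor2 (fun t => M t i j) (A i j) (B i j) (C i j).

Lemma mxtaylor2_const A : mxtaylor2 (fun=> A) A 0 0.
Proof. by move=> i j; rewrite !mxE; apply: taylor2_const. Qed.

Lemma mxtaylor2M M N A B C A' B' C' : mxtaylor2 M A B C -> mxtaylor2 N A' B' C' ->
  mxtaylor2 (fun t => M t *m N t) (A *m A') (A *m B' + B *m A')
    (A *m C' + B *m B' + C *m A').
Proof.
move=> MT NT i j; rewrite !mxE -!big_split /=.
apply: taylor2_ext (taylor2_sum _ (fun k => taylor2M (MT i k) (NT k j))) => t.
by rewrite mxE.
Qed.

Lemma mxtaylor2_trace M A B C :
  mxtaylor2 M A B C -> taylor2 (fun t => \tr (M t)) (\tr A) (\tr B) (\tr C).
Proof. by move=> MT; apply: taylor2_sum => i; apply: MT. Qed.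

Lemma mxtaylor2_exp X : mxtaylor2 (fun t => mx_exp (t *: X)) 1%:M X (2^-1 *: (X *m X)).
Proof.
move=> i j; have [C C0 XC] := mx_exp_taylor X; exists C => // t t1.
by have := XC t i j t1; rewrite ![(_ *: (X *m X)) i j]mxE [1%:M i j]mxE mulrA [_ / 2]mulrAC.
Qed.

End SecondOrder.

(** * The identity component of the torus *)

Lemma dscal_entry (K : rcfType) n m
    (A : forall L : rcfType, {rmorphism K -> L} -> ctx n L m -> 'M[L]_n) a b :
  dmx A -> dscal (fun L i E => A L i E a b).
Proof. by apply. Qed.

Lemma dmxX (K : rcfType) n m
    (A : forall L : rcfType, {rmorphism K -> L} -> ctx n L m -> 'M[L]_n) k :
  dmx A -> dmx (fun L i E => A L i E ^+ k).
Proof.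
move=> dA; elim: k => [|k IH] a b.
  by apply: dscal_ext (@dmx1 K n m a b) => L i E; rewrite expr0.
by apply: dscal_ext (dmx_mul dA IH a b) => L i E; rewrite exprS.
Qed.

Lemma dmx_nil_exp (K : rcfType) n m
    (A : forall L : rcfType, {rmorphism K -> L} -> ctx n L m -> 'M[L]_n) :
  dmx A -> dmx (fun L i E => nil_exp (A L i E)).
Proof.
move=> dA a b; apply: (@dscal_ext _ _ _ (fun L i E =>
    \sum_(k <- index_enum 'I_n) i (k`!%:R^-1) * (A L i E ^+ k) a b)).
  move=> L i E; rewrite summxE; apply: eq_bigr => k _.
  by rewrite mxE fmorphV rmorph_nat.
apply: dscal_sum => k; apply: dscalM; first exact: dscal_const.
exact: dmxX.
Qed.

(** Definability is proved by descending through the statement. Matrix variables, up to five deep,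
    are tried first; [dscal_entry], which passes from an entry to its matrix, is tried last. *)
Ltac definable := repeat (cbv beta; first
  [ exact: dmx_var0 | exact: dmx_var1 | exact: dmx_var2 | exact: dmx_var3 | exact: dmx_var4
  | exact: dmx_const | exact: dmx1
  | apply: dmx_mul | apply: dmx_tr | apply: dmxD | apply: dmxN
  | exact: dscal0 | exact: dscal1 | exact: dscal_nat | exact: dscal_const
  | apply: dscal_mxeval
  | apply: dform_all => ? | apply: dform_iff | apply: dform_and
  | apply: dform_or | apply: dform_not | apply: dform_imp
  | apply: dform_zeros | apply: dform_sa | apply: dform_mxeq
  | apply: dform_lt | apply: dform_le | apply: dform_eq
  | apply: dform_forall | apply: dform_exists
  | apply: dform_forall_fin => ?
  | apply: dscalD | apply: dscalM | apply: dscalN | apply: dscalX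
  | apply: dscal_det | apply: dmx_nil_exp | apply: dmxZ | apply: dscal_entry ]).

Section Adherence.
Variables (K : rcfType) (n : nat).

(* The tolerance is a matrix because definable formulas quantify over matrices. *)
Definition adherent (Z : set 'M[K]_n) (x : 'M[K]_n) :=
  forall e : 'M[K]_n, (forall a b, 0 < e a b) ->
    exists y, Z y /\ forall a b, - e a b < x a b - y a b /\ x a b - y a b < e a b.

Lemma adherentP Z x : closure Z x <-> adherent Z x.
Proof.
split=> [clx e e0|adh B /nbhs_ballP[r /= r0 rB]].
  pose m := \big[Num.min/1]_a \big[Num.min/1]_b e a b.
  have m0 : 0 < m.
    rewrite /m; elim/big_ind: _ => // [u v u0 v0|a _]; first by rewrite lt_min u0.
    by elim/big_ind: _ => // u v u0 v0; rewrite lt_min u0.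
  have mE a b : m <= e a b.
    rewrite /m (bigD1 a) //=; apply: (@le_trans _ _ (\big[Num.min/1]_b e a b)); first by rewrite ge_min lexx.
    by rewrite (bigD1 b) //=; rewrite ge_min lexx.
  have /clx[y [Zy [_ xy]]] : nbhs x (ball x m) by apply/nbhs_ballP; exists m.
  exists y; split=> // a b; have := lt_le_trans (xy a b) (mE a b).
  by rewrite ltr_norml => /andP[].
have [|y [Zy xy]] := adh (const_mx r); first by move=> a b; rewrite mxE.
exists y; split=> //; apply: rB; split=> // a b.
by rewrite /ball /= ltr_norml; have := xy a b; rewrite mxE => -[-> ->].
Qed.

End Adherence.

(** * Group laws on points over real closed extensions *)

Section Points.
Variables (K : rcfType) (n : nat).

Lemma zeros_geom (G : set (mxpol n K)) g :
  zeros idfun G g <-> geom_points G (map_mx (real_complex K) g).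
Proof. exact: iff_sym (zeros_map (real_complex K) G g). Qed.

Section Group.
Variables (G : set (mxpol n K)).
Hypothesis hG : alg_subgroup_SL G.
Variables (L : rcfType) (i : {rmorphism K -> L}).

(** The group hypotheses concern points over [K[i]]. They restrict to points over [K] and reach [L]
    by transfer; the lemmas that follow take the same route. *)
Lemma zeros_det g : zeros i G g -> \det g = 1.
Proof.
have d : dform (m := 0) (fun L i (E : ctx n L 0) =>
  forall g : 'M[L]_n, zeros i G g -> \det g = 1) by definable.
apply/(transfer i d) : g => g /zeros_geom Gg; apply: (fmorph_inj (real_complex K)).
by rewrite rmorph1 -det_map_mx; apply: hG.2.
Qed.

Lemma zeros_unit g : zeros i G g -> g \in unitmx.
Proof. by move=> /zeros_det dg; rewrite unitmxE dg unitr1. Qed.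

Lemma zeros1 : zeros i G 1%:M.
Proof.
have d : dform (m := 0) (fun L i (E : ctx n L 0) => zeros i G 1%:M) by definable.
by apply/(transfer i d)/zeros_geom; rewrite map_mx1; case: hG.1.
Qed.

Lemma zerosM g h : zeros i G g -> zeros i G h -> zeros i G (g *m h).
Proof.
have d : dform (m := 0) (fun L i (E : ctx n L 0) =>
  forall g h : 'M[L]_n, zeros i G g -> zeros i G h -> zeros i G (g *m h)) by definable.
apply/(transfer i d) : g h => g h /zeros_geom Gg /zeros_geom Gh.
by apply/zeros_geom; rewrite map_mxM; case: hG.1 => _ _ + _; apply.
Qed.

Lemma zerosV g : zeros i G g -> zeros i G (invmx g).
Proof.
(* The sentence speaks of a left inverse [h], which makes it first-order without a term for
   [invmx]. *)
have d : dform (m := 0) (fun L i (E : ctx n L 0) =>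
  forall g h : 'M[L]_n, zeros i G g -> h *m g = 1%:M -> zeros i G h) by definable.
move=> Gg; have : invmx g *m g = 1%:M by rewrite mulVmx ?zeros_unit.
apply/(transfer i d) : (g) (invmx g) Gg => {}g h /zeros_geom Gg hg.
have Ug : g \in unitmx by have [] := mulmx1_unit hg.
apply/zeros_geom; have -> : h = invmx g by rewrite -[RHS]mul1mx -hg mulmxK.
by rewrite map_invmx; case: hG.1 => _ _ _; apply.
Qed.

Lemma zeros_tr g : self_adjoint G -> zeros i G g -> zeros i G g^T.
Proof.
move=> hGT; have d : dform (m := 0) (fun L i (E : ctx n L 0) =>
  forall g : 'M[L]_n, zeros i G g -> zeros i G g^T) by definable.
apply/(transfer i d) : g => g /zeros_geom Gg.
by apply/zeros_geom; rewrite -map_trmx; apply: hGT.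
Qed.

End Group.

Lemma sa_conj (I : eqType) (r : seq I) (f : I -> sa_formula K n) :
  exists h, forall (L : rcfType) (i : {rmorphism K -> L}) x,
    sa_set i h x <-> forall k, k \in r -> sa_set i (f k) x.
Proof.
elim: r => [|k r [h hE]].
  have [z zE] := MultivariatePolynomials.upoly_const n (0 : K).
  by exists (SaNot (SaPos z)) => L i x; split=> // _; rewrite /sa_set /= zE rmorph0 ltxx.
exists (SaAnd (f k) h) => L i x; split=> [/andP[fk /hE hx] j|H].
  by rewrite inE => /orP[/eqP ->|/hx].
apply/andP; split; first by apply: H; rewrite inE eqxx.
by apply/hE => j jr; apply: H; rewrite inE jr orbT.
Qed.

Lemma sa_transfer (f h : sa_formula K n) (L : rcfType) (i : {rmorphism K -> L}) :
  sa_set idfun f = sa_set idfun h -> sa_set i f = sa_set i h.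
Proof.
move=> fh; apply/funext => x; apply/propext.
have d : dform (m := 0) (fun L i (E : ctx n L 0) =>
  forall x : 'M[L]_n, sa_set i f x <-> sa_set i h x) by definable.
by apply/(transfer i d) : x => x; rewrite fh.
Qed.

End Points.

Lemma exp_vmon (R : realType) n (m : 'I_n -> nat) (t : R) d :
  vmon m (map_mx expR (t *: d)) = expR (t * \sum_j (m j)%:R * d 0 j).
Proof.
rewrite mulr_sumr (@expR_sum R) /vmon; apply: eq_bigr => j _.
by rewrite !mxE -expRM_natl mulrCA.
Qed.

(** Two monomials that agree at [exp d] have exponents with the same pairing with [d], since the
    real exponential is injective; hence they agree at every [exp (t d)]. So the natural powers are
    Zariski dense in the one-parameter group. *)
Lemma zeros_one_parameter (K : fieldType) (R : realType) (i : {rmorphism K -> R}) n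
    (I : set (mxpol n K)) (Q : 'M[R]_n) d :
  (forall k : nat, zeros i I (pt Q (map_mx expR (k%:R *: d)))) ->
  forall t, zeros i I (pt Q (map_mx expR (t *: d))).
Proof.
move=> Ik t p Ip.
apply: (@mxeval_vclosure _ _ i _ _ _ p [set map_mx expR (k%:R *: d) | k in (setT : set nat)]).
- by exists 0%N => //; apply/rowP => j; rewrite !mxE mul0r expR0.
- move=> _ _ [k _ <-] [l _ <-]; exists (k + l)%N => //.
  by apply/rowP => j; rewrite !mxE natrD mulrDl expRD.
- by move=> _ [k _ <-]; apply: Ik.
move=> m m' mm'; have /mm' : [set map_mx expR (k%:R *: d) | k in (setT : set nat)]
  (map_mx expR (1%:R *: d)) by exists 1%N.
by rewrite !exp_vmon !mul1r => /expR_inj ->.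
Qed.

(** * The positive points of the torus form its identity component *)

Section PositiveTorus.
Variables (K : rcfType) (n : nat) (S : set (mxpol n K)).
Hypothesis sS : split_torus S.
Hypothesis hST : forall s, geom_points S s -> s^T = s.
Variable Q : 'M[K]_n.
Hypothesis QQ : Q *m Q^T = 1%:M.
Hypothesis Qdiag : forall s, geom_points S s ->
  is_diag_mx (map_mx (real_complex K) Q *m s *m (map_mx (real_complex K) Q)^T).

Definition positive_torus (L : rcfType) (i : {rmorphism K -> L}) : set 'M[L]_n :=
  [set s | zeros i S s /\ is_gram s].

Let aS : alg_subgroup_SL S. Proof. by case: sS. Qed.

Section Extension.
Variables (L : rcfType) (i : {rmorphism K -> L}).
Local Notation QL := (map_mx i Q).

Lemma map_orthogonal : QL *m QL^T = 1%:M.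
Proof. by rewrite map_trmx -map_mxM QQ map_mx1. Qed.

Lemma torus_off_diag s j k : j != k -> zeros i S s -> (QL *m s *m QL^T) j k = 0.
Proof.
move=> jk; have d : dform (m := 0) (fun L i (E : ctx n L 0) =>
    forall s : 'M[L]_n, zeros i S s -> (map_mx i Q *m s *m (map_mx i Q)^T) j k = 0).
  apply: dform_forall; apply: dform_imp; first by definable.
  apply: dform_eq; last by definable.
  have : dmx (m := 1) (fun L (i : {rmorphism K -> L}) (E : ctx n L 1) =>
    map_mx i Q *m E.2 *m (map_mx i Q)^T) by definable.
  by apply.
apply/(transfer i d) : s => s /zeros_geom /Qdiag /is_diag_mxP /(_ j k jk).
rewrite map_mx_id // map_trmx -!map_mxM mxE => /eqP.
by rewrite fmorph_eq0 => /eqP.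
Qed.

Definition torus_coords (s : 'M[L]_n) : 'rV[L]_n := \row_j (QL *m s *m QL^T) j j.

Lemma torus_coordsE s : zeros i S s -> s = pt QL (torus_coords s).
Proof.
move=> Ss; apply: diag_pt; first exact: map_orthogonal.
by apply/is_diag_mxP => j k jk; apply: torus_off_diag.
Qed.

Lemma torus_coords_neq0 s : zeros i S s -> forall j, torus_coords s 0 j != 0.
Proof.
move=> Ss j; have := zeros_det aS Ss; rewrite {1}(torus_coordsE Ss).
rewrite det_pt ?map_orthogonal // => d1; apply: contra_eq_neq d1 => sj.
by rewrite (bigD1 j) //= sj mul0r eq_sym oner_neq0.
Qed.

Lemma positive_torusP s :
  positive_torus i s <-> zeros i S s /\ forall j, 0 < torus_coords s 0 j.
Proof.
split=> -[Ss]; last first.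
  by move=> s0; split; rewrite // (torus_coordsE Ss); apply: pos_gram.
rewrite {1}(torus_coordsE Ss) => gs; split=> //.
by apply: (gram_pt_pos map_orthogonal (torus_coords_neq0 Ss)).
Qed.

Lemma positive_torus1 : positive_torus i 1%:M.
Proof. by split; [apply: zeros1|exists 1%:M; rewrite trmx1 mulmx1]. Qed.

End Extension.

(** The atoms of [sa_formula] are strict inequalities, so an equation is written as two negated
    ones. The formula is the same for all [L]. *)
Lemma positive_torus_formula : exists f, forall (L : rcfType) (i : {rmorphism K -> L}),
  positive_torus i = sa_set i f.
Proof.
have [N [r [rS rP]]] := MultivariatePolynomials.finite_basis_ord S.
have [neg negE] := choice (fun k => upolyN (ex_intro _ (r k) (fun L i x => erefl))).
have [c cE] := choice (fun j => upoly_conj Q Q^T j j).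
have [f fE] := sa_conj (enum 'I_N)
  (fun k => SaAnd (SaNot (SaPos (r k))) (SaNot (SaPos (neg k)))).
have [h hE] := sa_conj (enum 'I_n) (fun j => SaPos (c j)).
exists (SaAnd f h) => L i; apply/funext => x; apply/propext.
have cx j : mxeval i (c j) x = torus_coords i x 0 j by rewrite cE [RHS]mxE -map_trmx.
have fx : sa_set i f x <-> zeros i S x.
  apply: (iff_trans (fE L i x)); split=> [fx|Sx k _].
    apply: rP => k; have /andP[] := fx k (mem_enum _ _).
    by rewrite /= negE oppr_gt0 -!leNgt => p0 n0; apply/eqP; rewrite eq_le p0 n0.
  by apply/andP; rewrite /= negE Sx // oppr0 !ltxx.
have hx : sa_set i h x <-> forall j, 0 < torus_coords i x 0 j.
  apply: (iff_trans (hE L i x)); split=> [hx j|x0 j _]; last by rewrite /sa_set /= cx.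
  by have := hx j (mem_enum _ _); rewrite /sa_set /= cx.
apply: (iff_trans (positive_torusP i x)).
split=> [[/fx fx' /hx hx']|/andP[/fx Sx /hx x0]]; last by [].
by apply/andP; split.
Qed.

Section RealPoints.
Variables (R : realType) (i : {rmorphism K -> R}).
Local Notation QR := (map_mx i Q).

Lemma positive_torus_exp d : positive_torus i (pt QR (map_mx expR d)) <->
  zeros i S (pt QR (map_mx expR d)).
Proof.
split=> [[]//|Sd]; split=> //; apply: pos_gram => j; by rewrite mxE expR_gt0.
Qed.

Lemma torus_expn d : zeros i S (pt QR (map_mx expR d)) ->
  forall t, positive_torus i (pt QR (map_mx expR (t *: d))).
Proof.
move=> Sd t; apply/positive_torus_exp; move: t; apply: zeros_one_parameter => k.
elim: k => [|k IH].
  have -> : map_mx expR (0%:R *: d) = const_mx 1.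
    by apply/rowP => j; rewrite !mxE mul0r expR0.
  by rewrite pt1 ?map_orthogonal //; apply: zeros1.
have -> : map_mx expR (k.+1%:R *: d) = vmul (map_mx expR d) (map_mx expR (k%:R *: d)).
  by apply/rowP => j; rewrite !mxE -expRD mulrSr addrC mulrDl mul1r.
by rewrite (ptM (map_orthogonal i)); apply: (zerosM aS Sd IH).
Qed.

Lemma torus_log s : positive_torus i s ->
  exists2 d, s = pt QR (map_mx expR d) & zeros i S (pt QR (map_mx expR d)).
Proof.
move=> /positive_torusP[Ss s0]; exists (map_mx (@ln R) (torus_coords i s)).
  rewrite {1}(torus_coordsE Ss); congr pt; apply/rowP => j.
  by rewrite [RHS]mxE [X in expR X]mxE lnK // posrE.
have -> : map_mx expR (map_mx (@ln R) (torus_coords i s)) = torus_coords i s.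
  by apply/rowP => j; rewrite [LHS]mxE mxE lnK // posrE.
by rewrite -torus_coordsE.
Qed.

Lemma torus_path_cont d a b : continuous (fun t : R => pt QR (map_mx expR (t *: d)) a b).
Proof.
have -> : (fun t : R => pt QR (map_mx expR (t *: d)) a b) =
    (fun t => \sum_j QR j a * expR (t * d 0 j) * QR j b).
  apply/funext => t; rewrite /pt mxE; apply: eq_bigr => j _.
  by rewrite mul_mx_diag !mxE.
move=> t; apply: cvg_bigsum => j; apply: cvgM; last exact: cvg_cst.
apply: cvgM; first exact: cvg_cst.
apply: (@cvg_comp _ _ _ (fun t => t * d 0 j) expR); last exact: continuous_expR.
by apply: cvgM; [exact: cvg_id|exact: cvg_cst].
Qed.

(* Over the reals, [t |-> s^t] joins 1 to [s] inside the positive torus. *)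
Lemma positive_torus_path_connected (Z1 Z2 : set 'M[R]_n) :
  (forall x, positive_torus i x -> Z1 x \/ Z2 x) ->
  (forall x, Z1 x -> Z2 x -> False) ->
  (forall x, positive_torus i x -> adherent Z1 x -> Z1 x) ->
  (forall x, positive_torus i x -> adherent Z2 x -> Z2 x) ->
  Z1 1%:M -> forall s, positive_torus i s -> Z1 s.
Proof.
move=> Z12 Z1Z2 cl1 cl2 Z11 s Ps; have [d sE Sd] := torus_log Ps.
pose c t := pt QR (map_mx expR (t *: d)).
have Pc t : positive_torus i (c t) by apply: torus_expn.
have clc (Z : set 'M[R]_n) : (forall x, positive_torus i x -> adherent Z x -> Z x) ->
    closed [set t | Z (c t)].
  move=> clZ t clt; apply: clZ => // e e0.
  have [|t' [Zt' H]] := clt [set t' | forall a b, `|c t a b - c t' a b| < e a b].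
    apply: (@filter_forall _ _ (fun a t1 => forall b, `|c t a b - c t1 a b| < e a b) _ (nbhs_filter t)) => a.
    apply: (@filter_forall _ _ (fun b t1 => `|c t a b - c t1 a b| < e a b) _ (nbhs_filter t)) => b.
    by have /cvgrPdist_lt := @torus_path_cont d a b t; apply.
  by exists (c t'); split=> // a b; have := H a b; rewrite ltr_norml => /andP[].
have B0 : [set t | Z1 (c t)] 0.
  have e0 : map_mx expR (0 *: d) = const_mx 1 by apply/rowP => j; rewrite !mxE mul0r expR0.
  by rewrite /= /c e0 (pt1 (map_orthogonal i)).
have opB : open [set t | Z1 (c t)].
  rewrite -[X in open X]setCK; apply: closed_openC.
  rewrite (_ : ~` _ = [set t | Z2 (c t)]); first exact: clc.
  apply/seteqP; split=> t /= h; last by move=> h1; apply: Z1Z2 h1 h.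
  by case: (Z12 _ (Pc t)).
have cR : connected [set: R] by apply/connected_intervalP.
have := cR [set t | Z1 (c t)] (ex_intro _ 0 B0).
move=> /(_ (ex_intro2 _ _ _ opB (esym (setTI _)))).
move=> /(_ (ex_intro2 _ _ _ (clc _ cl1) (esym (setTI _)))) BT.
have : [set t | Z1 (c t)] 1 by rewrite BT.
by rewrite /= /c scale1r -sE.
Qed.

End RealPoints.

(** For two fixed formulas, and with closure expressed by [adherent], connectedness is a first-order
    sentence; it descends to [K] from [R], where paths are available. *)
Lemma positive_torus_sa_connected (R : realType) (iR : {rmorphism K -> R}) :
  sa_connected (positive_torus (idfun : {rmorphism K -> K})).
Proof.
have [f fE] := positive_torus_formula.
have key (f1 f2 : sa_formula K n) :
  let Z j := sa_set (idfun : {rmorphism K -> K}) (if j then f1 else f2) in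
  positive_torus idfun = Z true `|` Z false -> Z true `&` Z false = set0 ->
  closed_in (positive_torus idfun) (Z true) -> closed_in (positive_torus idfun) (Z false) ->
  Z true 1%:M -> Z true = positive_torus idfun.
  move=> Z PE Z0 [sub1 cl1] [_ cl2] Z11; apply/seteqP; split=> // s Ps.
  have d : dform (m := 0) (fun L i (E : ctx n L 0) =>
    (forall x : 'M[L]_n, sa_set i f x -> sa_set i f1 x \/ sa_set i f2 x) ->
    (* The equation [1 = 0] stands for falsity. *)
    (forall x : 'M[L]_n, sa_set i f1 x -> sa_set i f2 x -> 1 = 0 :> L) ->
    (forall x : 'M[L]_n, sa_set i f x -> adherent (sa_set i f1) x -> sa_set i f1 x) ->
    (forall x : 'M[L]_n, sa_set i f x -> adherent (sa_set i f2) x -> sa_set i f2 x) ->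
    sa_set i f1 1%:M -> forall s : 'M[L]_n, sa_set i f s -> sa_set i f1 s).
    rewrite /adherent; definable.
  have [h _] := transfer iR d.
  apply: h; last by rewrite -fE.
  - rewrite -fE => H1 H2 H3 H4 H5; apply: positive_torus_path_connected H4 H5 => // x h1 h2.
    by have /eqP := H2 x h1 h2; rewrite oner_eq0.
  - by move=> x; rewrite -fE PE.
  - move=> x h1 h2; have : (Z true `&` Z false) x by [].
    by rewrite Z0.
  - by move=> x; rewrite -fE => Px /adherentP adx; apply: cl1.
  - by move=> x; rewrite -fE => Px /adherentP adx; apply: cl2.
  - by [].
move=> Z1 Z2 [f1 ->] [f2 ->] c1 c2 PE Z0.
have : positive_torus idfun (1%:M : 'M[K]_n) by apply: positive_torus1.
rewrite {1}PE => -[h|h]; first by left; apply: (key f1 f2).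
by right; apply: (key f2 f1) => //; rewrite 1?setUC // setIC.
Qed.

(** No coordinate vanishes on the torus, so positivity of all coordinates is both an open and a
    closed condition there, and a connected set through 1 cannot leave the positive points. The
    other inclusion is the connectedness just shown. *)
Lemma torus_component_positive (R : realType) (iR : {rmorphism K -> R}) :
  torus_component S = positive_torus idfun.
Proof.
apply/seteqP; split=> [x [C [[fC CE] conC C1 CS] Cx]|x Px]; last first.
  exists (positive_torus idfun) => //; split.
  - by have [f fE] := positive_torus_formula; exists f; apply: fE.
  - exact: positive_torus_sa_connected iR.
  - exact: positive_torus1.
  - by move=> s [].
have [h hE] : exists h, forall s, sa_set (idfun : {rmorphism K -> K}) h s <->
    forall j, 0 < torus_coords idfun s 0 j.
  have [c cE] := choice (fun j => upoly_conj Q Q^T j j).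
  have [h hE] := sa_conj (enum 'I_n) (fun j => SaPos (c j)).
  have cx j s : mxeval idfun (c j) s = torus_coords idfun s 0 j.
    by rewrite cE [RHS]mxE -map_trmx.
  exists h => s; apply: (iff_trans (hE K idfun s)).
  split=> [hx j|x0 j _]; last by rewrite /sa_set /= cx.
  by have := hx j (mem_enum _ _); rewrite /sa_set /= cx.
have near_coord (s : 'M[K]_n) (r : K) : 0 < r -> exists2 e : 'M[K]_n, (forall a b, 0 < e a b) &
    forall y : 'M[K]_n, (forall a b, - e a b < s a b - y a b /\ s a b - y a b < e a b) ->
      forall j, `|torus_coords idfun s 0 j - torus_coords idfun y 0 j| < r.
  move=> r0; pose q j : K := \sum_a \sum_b `|Q j a| * `|Q j b|.
  have q0 j : 0 <= q j.
    by rewrite sumr_ge0 // => a _; rewrite sumr_ge0 // => b _; rewrite mulr_ge0.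
  (* Exceeds every [q j], which is a Lipschitz constant of the [j]-th coordinate with respect to the
     entries. *)
  pose B : K := 1 + \sum_j q j.
  have qB j : q j < B.
    by rewrite /B (bigD1 j) //= addrCA ltrDl ltr_pwDl // sumr_ge0.
  have B0 : 0 < B by rewrite ltr_pwDl // sumr_ge0.
  exists (const_mx (r / B)) => [a b|y ye j]; first by rewrite mxE divr_gt0.
  have -> : torus_coords idfun s 0 j - torus_coords idfun y 0 j =
      \sum_a \sum_b Q j b * (s b a - y b a) * Q j a.
    rewrite !mxE -sumrB; apply: eq_bigr => a _.
    rewrite !mxE -mulrBl -sumrB mulr_suml; apply: eq_bigr => b _.
    by rewrite !mxE -mulrBr.
  apply: le_lt_trans (ler_norm_sum _ _ _) _.
  apply: (@le_lt_trans _ _ (r / B * q j)).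
    rewrite mulr_sumr; apply: ler_sum => a _; apply: le_trans (ler_norm_sum _ _ _) _.
    rewrite mulr_sumr; apply: ler_sum => b _; rewrite !normrM.
    rewrite [leLHS]mulrC mulrA [leRHS]mulrC; apply: ler_wpM2l; first exact: mulr_ge0.
    by have := ye b a; rewrite mxE => -[h1 h2]; rewrite ler_norml !ltW.
  by rewrite mulrAC ltr_pdivrMr // ltr_pM2l.
have SZ s : C s -> zeros idfun S s by apply: CS.
have inZ s g : sa_set idfun (SaAnd fC g) s <-> C s /\ sa_set idfun g s.
  by rewrite CE; split=> [/andP[]|[fs gs]]; last exact/andP.
have notE s : sa_set idfun (SaNot h) s <-> ~ sa_set idfun h s by split=> /negP.
have [||||||Z1C|Z2C] := conC (sa_set idfun (SaAnd fC h)) (sa_set idfun (SaAnd fC (SaNot h))).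
- by exists (SaAnd fC h).
- by exists (SaAnd fC (SaNot h)).
- split=> [s /inZ[]//|s [/adherentP cls Cs]]; apply/inZ; split=> //; apply/hE => j.
  rewrite ltNge le_eqVlt (negbTE (torus_coords_neq0 (SZ s Cs) j)) /=; apply/negP => sj.
  have [|e e0 eP] := near_coord s (- torus_coords idfun s 0 j); first by rewrite oppr_gt0.
  have [y [/inZ[_ /hE/(_ j) yj] ye]] := cls e e0.
  have := eP y ye j; rewrite ltr_norml opprK => /andP[+ _].
  by rewrite ltrDl oppr_gt0 ltNge (ltW yj).
- split=> [s /inZ[]//|s [/adherentP cls Cs]]; apply/inZ; split=> //; apply/notE => /hE s0.
  pose r := \big[Num.min/1]_j torus_coords idfun s 0 j.
  have r0 : 0 < r.
    by rewrite /r; elim/big_ind: _ => // u v u0 v0; rewrite lt_min u0.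
  have rE j : r <= torus_coords idfun s 0 j.
    by rewrite /r (bigD1 j) //= ge_min lexx.
  have [e e0 eP] := near_coord s r r0.
  have [y [/inZ[_ /notE yh] ye]] := cls e e0; apply: yh; apply/hE => j.
  have := eP y ye j; rewrite ltr_norml => /andP[_ h3].
  by have := lt_le_trans h3 (rE j); rewrite gtrDl oppr_lt0.
- apply/seteqP; split=> s; last by case=> /inZ[].
  move=> Cs; have [hs|hs] := pselect (sa_set idfun h s); first by left; apply/inZ.
  by right; apply/inZ; split=> //; apply/notE.
- by apply/seteqP; split=> // s [/inZ[_ h1] /inZ[_ /notE]].
- move: Cx; rewrite -Z1C => /inZ[Cx /hE x0]; apply/positive_torusP; split=> //.
  exact: SZ.
- move: C1; rewrite -Z2C => /inZ[_ /notE]; case; apply/hE => j.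
  by rewrite /torus_coords mxE mulmx1 map_orthogonal mxE eqxx ltr01.
Qed.

Lemma torus_component_extE (R : realType) (iR : {rmorphism K -> R}) (L : rcfType)
    (i : {rmorphism K -> L}) : torus_component_ext S i = positive_torus i.
Proof.
have [f fE] := positive_torus_formula.
rewrite /torus_component_ext (torus_component_positive iR) !fE.
apply/seteqP; split=> [x [h hE]|x fx]; last by exists f.
by rewrite (sa_transfer i hE).
Qed.

End PositiveTorus.

(** * Maximization over the compact group *)

Section Traces.
Variables (R : realFieldType) (n : nat).
Implicit Types (y z : 'M[R]_n) (h v : 'rV[R]_n).

Lemma antisymmetrize (w : 'I_n -> 'I_n -> R) h : (forall i j, w j i = - w i j) ->
  2 * (\sum_i \sum_j w i j * h 0 i) = \sum_i \sum_j w i j * (h 0 i - h 0 j).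
Proof.
move=> wA; have e : \sum_i \sum_j w i j * h 0 i = - \sum_i \sum_j w i j * h 0 j.
  rewrite exchange_big -sumrN; apply: eq_bigr => i _.
  by rewrite -sumrN; apply: eq_bigr => j _; rewrite wA mulNr.
rewrite mulr_natl mulr2n {2}e -sumrB; apply: eq_bigr => i _.
by rewrite -sumrB; apply: eq_bigr => j _; rewrite mulrBr.
Qed.

(** The left side is the first variation at [t = 0] of the trace of
    [exp (t z) y exp (- t z) diag h]. Antisymmetry of [z] produces the differences of [h]. *)
Lemma trace_bracket y z h : y^T = y -> z^T = - z ->
  \tr ((y *m - z + z *m y) *m diag_mx h) =
  \sum_i \sum_j z i j * y i j * (h 0 i - h 0 j).
Proof.
move=> yT zT; have yE i j : y j i = y i j by rewrite -{1}yT mxE.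
have zE i j : z j i = - z i j by have /matrixP/(_ i j) := zT; rewrite !mxE.
rewrite -antisymmetrize; last by move=> i j; rewrite zE yE mulNr.
rewrite mulr_sumr; apply: eq_bigr => i _; rewrite mul_mx_diag !mxE.
rewrite -big_split mulr_suml mulr_sumr; apply: eq_bigr => j _ /=.
by rewrite !mxE zE yE; ring.
Qed.

(** The coefficient of [t^2] in the same function for diagonal [y]; each summand has the sign of a
    product of a difference of [v] and a difference of [h]. *)
Lemma trace_second y z h v : y = diag_mx v -> z^T = - z ->
  \tr ((y *m (2^-1 *: (- z *m - z)) + z *m y *m - z + 2^-1 *: (z *m z) *m y) *m diag_mx h) =
  - 2^-1 * \sum_i \sum_j z i j ^+ 2 * (v 0 i - v 0 j) * (h 0 i - h 0 j).
Proof.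
move=> yE zT; have zE i j : z j i = - z i j.
  by have /matrixP/(_ i j) := zT; rewrite !mxE.
rewrite -antisymmetrize; last by move=> i j; rewrite zE sqrrN -mulrN opprB.
rewrite mulrA mulNr mulVf ?pnatr_eq0 // mulN1r -sumrN; apply: eq_bigr => i _.
have P1 : \sum_j z i j * z j i = - \sum_j z i j ^+ 2.
  by rewrite -sumrN; apply: eq_bigr => j _; rewrite (zE i j) mulrN.
have P2 : \sum_j (z *m diag_mx v) i j * z j i = - \sum_j z i j ^+ 2 * v 0 j.
  rewrite -sumrN; apply: eq_bigr => j _; rewrite mul_mx_diag mxE (zE i j); ring.
have -> : \sum_j z i j ^+ 2 * (v 0 i - v 0 j) * h 0 i =
    ((\sum_j z i j ^+ 2) * v 0 i - \sum_j z i j ^+ 2 * v 0 j) * h 0 i.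
  rewrite !mulr_suml -sumrB mulr_suml; apply: eq_bigr => j _; ring.
rewrite mul_mx_diag mxE mulmxN mulNmx opprK yE mul_diag_mx mulmxN.
rewrite [(_ *m diag_mx v) in X in _ + X]mul_mx_diag !mxE P1 P2; by field.
Qed.

End Traces.

Section CompactMaximum.
Variables (K : rcfType) (R : realType) (iR : {rmorphism K -> R}) (n : nat).
Variables (G : set (mxpol n K)).

Definition maximal_compact (k : 'M[R]_n) := zeros iR G k /\ k *m k^T = 1%:M.

Lemma cvg_bigprod (T : Type) (A : set_system T) {FA : Filter A} (I : Type) (r : seq I)
    (u : I -> T -> R) (l : I -> R) :
  (forall k, u k @ A --> l k) ->
  (fun N => \prod_(k <- r) u k N) @ A --> \prod_(k <- r) l k.
Proof.
move=> ul; elim: r => [|k r IH].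
  rewrite big_nil (_ : (fun N => _) = fun=> 1); first exact: cvg_cst.
  by apply/funext => N; rewrite big_nil.
rewrite big_cons (_ : (fun N => _) = (fun N => u k N * \prod_(k <- r) u k N)).
  exact: cvgM.
by apply/funext => N; rewrite big_cons.
Qed.

Local Notation V := 'rV[R]_(n * n).

Lemma entry_continuous a b : continuous (fun v : V => (vec_mx v : 'M[R]_n) a b).
Proof.
rewrite (_ : (fun v => _) = (fun v : V => v ord0 (mxvec_index a b))).
  exact: coord_continuous.
by apply/funext => v; rewrite mxE.
Qed.

Lemma mxeval_continuous p : continuous (fun v : V => mxeval iR p (vec_mx v)).
Proof.
have [s sP] := MultivariatePolynomials.mxeval_monoms p.
rewrite (_ : (fun v => _) = (fun v : V => \sum_(t <- s) iR t.1 *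
    \prod_a \prod_b \prod_(k < t.2 a b) (vec_mx v : 'M[R]_n) a b)); last first.
  apply/funext => v; rewrite sP; apply: eq_bigr => t _; congr (_ * _).
  apply: eq_bigr => a _; apply: eq_bigr => b _.
  by rewrite prodr_const card_ord.
move=> v; apply: (@cvg_bigsum _ _ _ (nbhs_filter v)) => t; apply: cvgM; first exact: cvg_cst.
apply: (@cvg_bigprod _ _ (nbhs_filter v)) => a;
  apply: (@cvg_bigprod _ _ (nbhs_filter v)) => b;
  apply: (@cvg_bigprod _ _ (nbhs_filter v)) => k.
exact: entry_continuous.
Qed.

Lemma closed_level (f : V -> R) c : continuous f -> closed [set v | f v = c].
Proof.
move=> cf; rewrite (_ : [set v | _] = f @^-1` [set c]) //.
by apply: closed_comp => [v _|]; [apply: cf|apply: closed_eq].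
Qed.

Lemma closed_forall (I : Type) (Z : I -> set V) :
  (forall k, closed (Z k)) -> closed [set v | forall k, Z k v].
Proof.
move=> cZ; rewrite (_ : [set v | _] = \bigcap_k Z k); first by apply: closed_bigI.
by apply/seteqP; split=> v vZ k; [move=> _|]; apply: vZ.
Qed.

(** The group is closed, and orthogonality bounds the entries by 1. Matrices are flattened to row
    vectors, where a product of segments is compact. *)
Lemma maximal_compact_max (Y H : 'M[R]_n) : maximal_compact 1%:M ->
  exists k, maximal_compact k /\
    forall h, maximal_compact h -> \tr (h *m Y *m h^T *m H) <= \tr (k *m Y *m k^T *m H).
Proof.
move=> K1; pose A : set V := [set v | maximal_compact (vec_mx v)].
pose f (v : V) := \tr (vec_mx v *m Y *m (vec_mx v)^T *m H).
have cf : continuous f.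
  rewrite (_ : f = fun v : V => \sum_a \sum_b (\sum_c (\sum_d (vec_mx v : 'M[R]_n) a d * Y d c) *
     (vec_mx v : 'M[R]_n) b c) * H b a).
    move=> v; apply: (@cvg_bigsum _ _ _ (nbhs_filter v)) => a;
  apply: (@cvg_bigsum _ _ _ (nbhs_filter v)) => b.
    apply: cvgM; last exact: cvg_cst.
    apply: (@cvg_bigsum _ _ _ (nbhs_filter v)) => c; apply: cvgM; last exact: entry_continuous.
    apply: (@cvg_bigsum _ _ _ (nbhs_filter v)) => d; apply: cvgM; last exact: cvg_cst.
    exact: entry_continuous.
  apply/funext => v; apply: eq_bigr => a _; rewrite mxE; apply: eq_bigr => b _.
  rewrite mxE; congr (_ * _); apply: eq_bigr => c _.
  by rewrite mxE [_^T _ _]mxE.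
have clA : closed A.
  rewrite (_ : A = [set v | forall p, G p -> mxeval iR p (vec_mx v) = 0] `&`
     [set v | forall a b, \sum_c (vec_mx v : 'M[R]_n) a c * (vec_mx v : 'M[R]_n) b c = (a == b)%:R]).
    apply: closedI; do 2!apply: closed_forall => ?; apply: closed_level.
      exact: mxeval_continuous.
    move=> v; apply: (@cvg_bigsum _ _ _ (nbhs_filter v)) => c; apply: cvgM; exact: entry_continuous.
  have kkE (k : 'M[R]_n) : (k *m k^T = 1%:M) <-> forall a b, \sum_c k a c * k b c = (a == b)%:R.
    split=> [kk a b|kk].
      have /matrixP/(_ a b) := kk; rewrite !mxE => <-.
      by apply: eq_bigr => c _; rewrite mxE.
    apply/matrixP => a b; rewrite !mxE -kk.
    by apply: eq_bigr => c _; rewrite mxE.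
  by apply/seteqP; split=> v [h1 /kkE h2].
have cA : compact A.
  apply: (subclosed_compact clA (rV_compact (fun=> @segment_compact R (-1) 1))) => v [_ kk] j.
  case/mxvec_indexP: j => a b.
  have /matrixP/(_ a a) := kk; rewrite !mxE eqxx => kaa.
  have : (vec_mx v : 'M[R]_n) a b ^+ 2 <= 1.
    rewrite -[leRHS]kaa (bigD1 b) //= [_^T _ _]mxE -expr2 lerDl sumr_ge0 // => c _.
    by rewrite [_^T _ _]mxE -expr2 sqr_ge0.
  rewrite mxE -real_normK ?num_real // expr_le1 // => vab.
  by rewrite /= in_itv /= -ler_norml.
have [||k /set_mem Ak kmax] := @compact_EVT_max _ _ f A _ cA.
- by exists (mxvec 1%:M); rewrite /A /= mxvecK.
- exact: continuous_subspaceT.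
exists (vec_mx k); split=> // h Kh; have := kmax (mxvec h).
by rewrite /f mxvecK; apply; apply/mem_set; rewrite /A /= mxvecK.
Qed.

End CompactMaximum.

Lemma dual_values (F : fieldType) (W : vectType F) (D : seq 'Hom(W, F^o)) (v : nat -> F) :
  free D -> exists w, forall k, (k < size D)%N -> (D`_k) w = v k.
Proof.
move=> fD; pose B := vbasis {:W}.
pose M : 'M[F]_(\dim {:W}, size D) := \matrix_(l, k) ((D`_k) B`_l : F).
have Mfull : row_full M.
  rewrite /row_full -mxrank_tr; apply/inj_row_free => c cM.
  have c0 : \sum_(k < size D) c 0 k *: D`_k = 0.
    apply/lfunP => w; rewrite (coord_vbasis (memvf w)) [LHS]linear_sum [RHS]linear_sum.
    apply: eq_bigr => l _; rewrite [LHS]linearZ [RHS]linearZ; congr (_ *: _).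
    rewrite /= sum_lfunE zero_lfunE; have /rowP/(_ l) := cM; rewrite !mxE => e; apply: etrans e.
    by apply: eq_bigr => k _; rewrite scale_lfunE !mxE.
  apply/rowP => k; rewrite mxE.
  exact: (freeP (X := in_tuple D) fD (fun k => c 0 k) c0 k).
have [c cE] := row_fullP Mfull.
pose r : 'rV[F]_(\dim {:W}) := (\row_(k < size D) v k) *m c.
exists (\sum_l r 0 l *: B`_l) => k kD; rewrite linear_sum /=.
have : (r *m M) 0 (Ordinal kD) = v k by rewrite -mulmxA cE mulmx1 mxE.
rewrite mxE => <-; apply: eq_bigr => l _; by rewrite linearZ !mxE.
Qed.

Section GenericElement.
Variables (R : realType) (n : nat) (a : {vspace 'M[R]_n}).
Variable Delta : seq (dual_space a).

(** Prescribing the value [t^l] on the [l]-th element of [Delta] turns each nonzero [beta k] into a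
    nonzero polynomial in [t], and some positive [t] is a root of none of them. *)
Lemma generic_element (I : finType) (beta : I -> dual_space a) :
  basis_of fullv Delta ->
  exists H : subvs_of a, (forall alpha, alpha \in Delta -> 0 < (alpha H : R)) /\
    forall k, beta k != 0 -> (beta k H : R) != 0.
Proof.
move=> bD; have fD := basis_free bD.
have bE k : beta k = \sum_(l < size Delta) coord (in_tuple Delta) l (beta k) *: Delta`_l.
  by have := coord_basis (X := in_tuple Delta) bD (memvf (beta k)).
pose p k : {poly R} := \sum_(l < size Delta) coord (in_tuple Delta) l (beta k) *: 'X^l.
have pN k : beta k != 0 -> p k != 0.
  apply: contra_neq => p0; rewrite bE big1 // => l _.
  suff -> : coord (in_tuple Delta) l (beta k) = 0 by rewrite scale0r.
  have := congr1 (fun q : {poly R} => q`_l) p0; rewrite coef0 => <-.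
  rewrite coef_sum (bigD1 l) //= coefZ coefXn eqxx mulr1 big1 ?addr0 // => l' ll'.
  by rewrite coefZ coefXn eq_sym val_eqE (negbTE ll') mulr0.
have PN : \prod_(k | beta k != 0) p k != 0 by apply/prodf_neq0.
have [t t0] := poly_nonroot PN.
have [H HE] := dual_values (fun l => t ^+ l) fD.
rewrite horner_prod => /prodf_neq0 pt0; exists H; split=> [al|k bk].
  by move=> /(nthP 0)[l lD <-]; rewrite HE // exprn_gt0.
have -> : beta k H = (p k).[t]; last exact: pt0.
rewrite [in LHS]bE sum_lfunE /p horner_sum; apply: eq_bigr => l _.
by rewrite scale_lfunE HE // hornerZ hornerXn.
Qed.

End GenericElement.

(** * Valuations and integral matrices *)

Section Valuation.
Variables (F : rcfType) (O : convexSubring F).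
Implicit Types x y c : F.

Lemma csubD x y : x \in csub O -> y \in csub O -> x + y \in csub O.
Proof. by move=> xO yO; rewrite -[y]opprK; apply: csubB => //; apply: csubN. Qed.

Lemma csub_sum (I : Type) (r : seq I) (P : pred I) (f : I -> F) :
  (forall k, P k -> f k \in csub O) -> \sum_(k <- r | P k) f k \in csub O.
Proof. by move=> fO; elim/big_ind: _ => //; [apply: csub0|apply: csubD]. Qed.

Lemma csub_prod (I : Type) (r : seq I) (P : pred I) (f : I -> F) :
  (forall k, P k -> f k \in csub O) -> \prod_(k <- r | P k) f k \in csub O.
Proof. by move=> fO; elim/big_ind: _ => //; [apply: csub1|apply: csubM]. Qed.

Lemma csubX x k : x \in csub O -> x ^+ k \in csub O.
Proof. by move=> xO; elim: k => [|k IH]; rewrite ?expr0 ?csub1 // exprS csubM. Qed.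

Lemma csub_nat k : k%:R \in csub O.
Proof. by elim: k => [|k IH]; rewrite ?csub0 // -natr1 csubD ?csub1. Qed.

Lemma csub_natV k : k%:R^-1 \in csub O.
Proof.
case: k => [|k]; first by rewrite invr0 csub0.
apply: (csub_norm (csub1 O)); rewrite normr1 normfV normr_nat.
by rewrite invf_le1 ?ltr0n // ler1n.
Qed.

Lemma csub_sqr x : (x ^+ 2 \in csub O) = (x \in csub O).
Proof.
apply/idP/idP => [xO|]; last exact: csubX.
apply: (csub_norm (csubD (csub1 O) xO)).
rewrite [leRHS]ger0_norm ?addr_ge0 ?sqr_ge0 // -[x ^+ 2]real_normK ?num_real //.
have := sqr_ge0 (`|x| - 2^-1); rewrite sqrrB; lra.
Qed.

Lemma csub_gt0 x y : 0 < x -> x <= y -> y \in csub O -> x \in csub O.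
Proof. by move=> x0 xy yO; apply: (csub_norm yO); rewrite !gtr0_norm // (lt_le_trans x0). Qed.

(** The reals are archimedean, so through [iR] each element of [K] is bounded by a natural number;
    the bound passes to [F] and convexity applies. *)
Lemma csub_rmorph (K : rcfType) (R : realType) (iR : {rmorphism K -> R})
  (iF : {rmorphism K -> F}) (z : K) : iF z \in csub O.
Proof.
have [k zk] : exists k : nat, `|z| <= k%:R.
  exists (Num.bound (iR `|z|)); rewrite -(rcf_rmorph_le iR) rmorph_nat.
  by apply/ltW/archi_boundP; rewrite rcf_rmorph_ge0.
apply: (csub_norm (csub_nat k)); rewrite normr_nat -(rmorph_nat iF).
move: zk; rewrite ler_norml => /andP[h1 h2].
by rewrite ler_norml -rmorphN !rcf_rmorph_le h1.
Qed.

Lemma negv_le x y : y != 0 -> (negv O x <= negv O y)%O = (x / y \in csub O).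
Proof.
move=> y0; rewrite /negv; case: insubP => [X _ XE|]; last first.
  by rewrite negbK => /eqP ->; rewrite mul0r csub0.
case: insubP => [Y _ YE|]; last by rewrite y0.
have -> : (Fin (- vclass O X) <= Fin (- vclass O Y))%O =
  Lle (Lopp (vclass O X)) (Lopp (vclass O Y)) by [].
by rewrite !LoppE LleE !val_nz_inv invrK XE YE mulrC.
Qed.

Lemma negv1 : negv O 1 = Fin 0.
Proof.
rewrite /negv; case: insubP => [X _ XE|]; last by rewrite oner_eq0.
have -> : X = nz_one F by apply: val_inj.
by congr Some; apply/eqP; rewrite oppr_eq0.
Qed.

Lemma negv_eq x y : x != 0 -> y != 0 ->
  negv O x = negv O y <-> x / y \in csub O /\ y / x \in csub O.
Proof.
move=> x0 y0; rewrite -!negv_le //; split=> [-> //|[xy yx]].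
by apply/eqP; rewrite eq_le xy.
Qed.

Lemma negv_norm x : negv O `|x| = negv O x.
Proof.
have [->|x0] := eqVneq x 0; first by rewrite normr0.
have nx0 : `|x| != 0 by rewrite normr_eq0.
apply/negv_eq => //; split; apply: (csub_norm (csub1 O));
  by rewrite normr1 normf_div normr_id divff.
Qed.

Lemma negv_surj w : exists y, negv O y = w.
Proof.
case: w => [l|]; last by exists 0; rewrite negv0.
exists (val (repr l))^-1; rewrite /negv; case: insubP => [X _ XE|]; last first.
  by rewrite invr_eq0 (valP (repr l)).
have -> : X = nz_inv (repr l) by apply: val_inj; rewrite XE.
by congr Some; rewrite -LoppE vclass_repr; apply: opprK.
Qed.

(** Halving takes the square root of the absolute value of a representative. The comparison is
    squared, which [csub_sqr] allows, and absolute values and the choice of representative only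
    contribute units of [O]. *)
Lemma whalf_negv_le y c : c != 0 ->
  (whalf (negv O y) <= negv O c)%O = (y / c ^+ 2 \in csub O).
Proof.
move=> c0; rewrite /negv; case: insubP => [Y Y0 YE|]; last first.
  by rewrite negbK => /eqP ->; rewrite mul0r csub0.
case: insubP => [C _ CE|]; last by rewrite c0.
set z := repr (vclass O (nz_inv Y)).
have -> : (whalf (Some (- vclass O Y)) <= Fin (- vclass O C))%O =
  Lle (vclass O (nz_sqrt z)) (Lopp (vclass O C)).
  by rewrite /z -LoppE.
rewrite LoppE LleE val_nz_inv CE val_nz_sqrt -csub_sqr exprMn exprVn exprVn sqr_sqrtr //.
have /andP[] := assoc_repr O (nz_inv Y); rewrite -/z val_nz_inv YE invrK => zy yz.
have z0 := valP z; have y0 : y != 0 by rewrite -YE (valP Y).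
have nz : (val z)^-1 * `|val z| \in csub O /\ `|val z|^-1 * val z \in csub O.
  by split; apply: (csub_norm (csub1 O)); rewrite normr1 normrM normfV normr_id mulVf ?normr_eq0.
have zN : `|val z| != 0 by rewrite normr_eq0.
apply/idP/idP => h.
  have -> : y / c ^+ 2 = c ^- 2 / `|val z| * (`|val z|^-1 * val z)^-1 * (val z * y).
    by field; rewrite c0 z0 zN.
  apply: csubM => //; apply: csubM => //; by rewrite invfM invrK mulrC; case: nz.
have -> : c ^- 2 / `|val z| = y / c ^+ 2 * (y^-1 / val z) * ((val z)^-1 * `|val z|)^-1.
  by field; rewrite c0 z0 y0 zN.
apply: csubM; last by rewrite invfM invrK mulrC; case: nz.
by apply: csubM.
Qed.

End Valuation.

Section Integral.
Variables (F : rcfType) (O : convexSubring F) (n : nat).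
Implicit Types L M N : 'M[F]_n.

Definition integral_mx M := forall j k, M j k \in csub O.

Lemma integral_mx1 : integral_mx 1%:M.
Proof. by move=> j k; rewrite mxE csub_nat. Qed.

Lemma integral_mxM M N : integral_mx M -> integral_mx N -> integral_mx (M *m N).
Proof. by move=> MO NO j k; rewrite mxE; apply: csub_sum => l _; apply: csubM. Qed.

Lemma integral_mxM3 L M N :
  integral_mx L -> integral_mx M -> integral_mx N -> integral_mx (L *m M *m N).
Proof. by move=> LO MO NO; do 2?apply: integral_mxM. Qed.

Lemma integral_mxD M N : integral_mx M -> integral_mx N -> integral_mx (M + N).
Proof. by move=> MO NO j k; rewrite mxE; apply: csubD. Qed.

Lemma integral_mxZ c M : c \in csub O -> integral_mx M -> integral_mx (c *: M).
Proof. by move=> cO MO j k; rewrite mxE; apply: csubM. Qed.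

Lemma integral_mx_tr M : integral_mx M -> integral_mx M^T.
Proof. by move=> MO j k; rewrite mxE. Qed.

Lemma integral_mx_exp M k : integral_mx M -> integral_mx (M ^+ k).
Proof.
by move=> MO; elim: k => [|k IH]; [apply: integral_mx1|rewrite exprS; apply: integral_mxM].
Qed.

Lemma integral_mx_sum (I : Type) (r : seq I) (P : pred I) (f : I -> 'M[F]_n) :
  (forall k, P k -> integral_mx (f k)) -> integral_mx (\sum_(k <- r | P k) f k).
Proof.
move=> fO; elim/big_ind: _ => //; last exact: integral_mxD.
by move=> j k; rewrite mxE csub0.
Qed.

(** A diagonal entry of the product is a sum of squares and bounds each of them, so convexity of [O]
    and [csub_sqr] apply. *)
Lemma integral_mx_gram M : integral_mx (M *m M^T) -> integral_mx M.
Proof.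
move=> MO j k; rewrite -csub_sqr; have := MO j j; rewrite mxE.
under eq_bigr do rewrite [_^T _ _]mxE -expr2.
rewrite (bigD1 k) //= => h; apply: (csub_norm h).
rewrite !ger0_norm ?sqr_ge0 ?lerDl ?addr_ge0 ?sqr_ge0 ?sumr_ge0 // => l _; exact: sqr_ge0.
Qed.

Lemma integral_mx_orthogonal M : M *m M^T = 1%:M -> integral_mx M.
Proof. by move=> MM; apply: integral_mx_gram; rewrite MM; apply: integral_mx1. Qed.

Lemma integral_mx_inv M : \det M = 1 -> integral_mx M -> integral_mx (invmx M).
Proof.
move=> dM MO j k; have uM : M \in unitmx by rewrite unitmxE dM unitr1.
rewrite /invmx uM dM invr1 scale1r mxE /cofactor; apply: csubM.
  by apply: csubX; apply/csubN/csub1.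
rewrite /determinant; apply: csub_sum => s _; apply: csubM.
  by apply: csubX; apply/csubN/csub1.
by apply: csub_prod => l _; rewrite !mxE.
Qed.

Lemma negv_mx_le M c : c != 0 ->
  (negv_mx O M <= negv O c)%O <-> forall j k, M j k / c \in csub O.
Proof.
move=> c0; split=> [|MO]; last first.
  apply/bigmax_leP; split=> [|j _]; first exact: le0x.
  apply/bigmax_leP; split=> [|k _]; first exact: le0x.
  by rewrite negv_le.
move=> /bigmax_leP[_ h] j k; rewrite -negv_le //.
by have /bigmax_leP[_] := h j isT; apply.
Qed.

Lemma root_group_val_le M N c : c != 0 ->
  (Order.max (negv_mx O M) (whalf (negv_mx O N)) <= negv O c)%O <->
  integral_mx (c^-1 *: M) /\ integral_mx (c ^- 2 *: N).
Proof.
move=> c0; have c20 : c ^+ 2 != 0 by rewrite expf_neq0.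
have -> : integral_mx (c^-1 *: M) <-> (negv_mx O M <= negv O c)%O.
  apply: iff_sym; apply: (iff_trans (negv_mx_le M c0)).
  by split=> h j k; have := h j k; rewrite mxE mulrC.
have -> : integral_mx (c ^- 2 *: N) <-> (whalf (negv_mx O N) <= negv O c)%O.
  (* The maximum over the entries is the value of some field element [y], which reduces the claim to
     scalars. *)
  have [y yE] := negv_surj (negv_mx O N); rewrite -yE whalf_negv_le // -negv_le // yE.
  apply: iff_sym; apply: (iff_trans (negv_mx_le N c20)).
  by split=> h j k; have := h j k; rewrite mxE mulrC.
by rewrite ge_max; split=> /andP.
Qed.

Lemma integral_mxeval (K : rcfType) (R : realType) (iR : {rmorphism K -> R})
  (iF : {rmorphism K -> F}) p M : integral_mx M -> mxeval iF p M \in csub O.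
Proof.
move=> MO; have [s sP] := MultivariatePolynomials.mxeval_monoms p; rewrite sP.
apply: csub_sum => t _; apply: csubM; first exact: csub_rmorph iR iF _.
by apply: csub_prod => j _; apply: csub_prod => k _; apply: csubX.
Qed.

End Integral.

(** A nonzero entry in row [j] of [M ^+ k] requires [k] successive drops of weight, so at least [k]
    indices weigh less than [j], and [j] is not one of them. *)
Lemma nilpotent_of_weights (L : fieldType) (R : realDomainType) n (w : 'I_n -> R) (M : 'M[L]_n) :
  (forall j k, M j k != 0 -> w k < w j) -> M ^+ n = 0.
Proof.
move=> Mw; have step k : forall j l, (M ^+ k) j l != 0 -> (k <= #|[pred m | (w m < w j)%R]|)%N.
  elim: k => [//|k IH] j l; rewrite exprS => Mjl.
  have [m Mjm Mml] : exists2 m, M j m != 0 & (M ^+ k) m l != 0.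
    apply: contrapT => nm; move/eqP: Mjl; apply.
    rewrite [LHS]mxE big1 // => m _; have [->|Mjm] := eqVneq (M j m) 0; first by rewrite mul0r.
    have [->|Mml] := eqVneq ((M ^+ k) m l) 0; first by rewrite mulr0.
    by case: nm; exists m.
  apply: leq_ltn_trans (IH _ _ Mml) _; apply: proper_card; apply/properP; split.
    by apply/fintype.subsetP => q; rewrite !inE => /lt_trans; apply; apply: Mw.
  by exists m; rewrite !inE ?ltxx // Mw.
apply/matrixP => j l; rewrite [RHS]mxE; apply/eqP; apply: contraT => /step.
rewrite leqNgt -[X in (_ < X)%N]card_ord; case/negP.
apply: proper_card; apply/properP; split; first exact/fintype.subsetP.
by exists j; rewrite ?inE // ltxx.
Qed.

(** * Exponentials of graded nilpotent matrices *)

Section Graded.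
Variables (F : rcfType) (R : realDomainType) (n : nat) (w : 'I_n -> R).
Implicit Types (M X : 'M[F]_n) (c d : R).

(** Weights lie in [R] while entries lie in [F]: the grading only says which entries vanish, and
    that can be transferred. *)
Definition homogeneous c M := forall j k, M j k != 0 -> w j - w k = c.

Lemma homogeneous_entry c M j k : homogeneous c M -> w j - w k != c -> M j k = 0.
Proof. by move=> Mc jk; apply/eqP; apply: contraTT isT => /Mc /eqP; rewrite (negbTE jk). Qed.

Lemma mulmx_neq0 M X j k : (M *m X) j k != 0 -> exists2 l, M j l != 0 & X l k != 0.
Proof.
move=> h; apply: contrapT => nl; move/eqP: h; apply.
rewrite mxE big1 // => l _; have [->|Mjl] := eqVneq (M j l) 0; first by rewrite mul0r.
have [->|Xlk] := eqVneq (X l k) 0; first by rewrite mulr0.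
by case: nl; exists l.
Qed.

Lemma homogeneousM c d M X : homogeneous c M -> homogeneous d X -> homogeneous (c + d) (M *m X).
Proof.
by move=> Mc Xd j k /mulmx_neq0[l /Mc <- /Xd <-]; rewrite addrA subrK.
Qed.

Lemma homogeneousZ c (a : F) M : homogeneous c M -> homogeneous c (a *: M).
Proof. by move=> Mc j k; rewrite mxE mulf_eq0 negb_or => /andP[_ /Mc]. Qed.

Variables (X X' : 'M[F]_n).
Hypotheses (hX : homogeneous 1 X) (hX' : homogeneous 2 X').
Let M := X + X'.

Let M_weight j k : M j k != 0 -> 1 <= w j - w k.
Proof.
rewrite /M mxE => MN; have [Xjk|/hX -> //] := eqVneq (X j k) 0.
by move: MN; rewrite Xjk add0r => /hX' ->; rewrite ler1n.
Qed.

Let M_weightX m j k : (M ^+ m) j k != 0 -> m%:R <= w j - w k.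
Proof.
elim: m j k => [|m IH] j k.
  by rewrite expr0 mxE; case: (j =P k) => [-> _|_]; rewrite ?subrr ?eqxx.
rewrite exprS => /mulmx_neq0[l /M_weight jl /IH lk].
by rewrite -natr1 addrC -[w j](subrK (w l)) -addrA lerD.
Qed.

Lemma graded_nilpotent : M ^+ n = 0.
Proof.
apply: (nilpotent_of_weights (w := w)) => j k /M_weight.
by rewrite -subr_gt0; apply: lt_le_trans.
Qed.

Lemma graded_exp : exists2 T, nil_exp M = 1%:M + M + 2^-1 *: (M *m M) + T &
  forall j k, T j k != 0 -> 3 <= w j - w k.
Proof.
have M0 m : (n <= m)%N -> M ^+ m = 0.
  by move=> nm; rewrite -(subnK nm) exprD graded_nilpotent mulr0.
(* The sum is prolonged by zero terms up to [n + 3], so that it splits at 3 even when [n < 3]. *)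
exists (\sum_(3 <= m < n + 3) m`!%:R^-1 *: M ^+ m); last first.
  move=> j k; rewrite summxE => h.
  have [m m3 Mm] : exists2 m, (3 <= m)%N & (M ^+ m) j k != 0.
    apply: contrapT => nm; move/eqP: h; apply; rewrite big_nat big1 // => m /andP[m3 _].
    rewrite mxE; have [->|Mm] := eqVneq ((M ^+ m) j k) 0; first by rewrite mulr0.
    by case: nm; exists m.
  by apply: le_trans (M_weightX Mm); rewrite ler_nat.
rewrite /nil_exp -(big_mkord xpredT (fun m => m`!%:R^-1 *: M ^+ m)).
have -> : \sum_(0 <= m < n) m`!%:R^-1 *: M ^+ m = \sum_(0 <= m < n + 3) m`!%:R^-1 *: M ^+ m.
  rewrite [RHS](big_cat_nat (leq0n n) (leq_addr 3 n)) /= [X in _ = _ + X]big_nat.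
  by rewrite [X in _ = _ + X]big1 ?addr0 // => m /andP[nm _]; rewrite M0 ?scaler0.
rewrite [LHS](big_cat_nat (leq0n 3) (leq_addl n 3)) /=; congr (_ + _).
rewrite big_mkord !big_ord_recl big_ord0 /= !invr1 !scale1r expr0 expr1 addr0 !addrA.
by congr (_ + _); rewrite /bump /= exprS expr1.
Qed.

Variable O : convexSubring F.

(* An entry of degree 1 of the exponential is one of X, an entry of degree 2 is one
   of X' + X^2 / 2. *)
Lemma graded_exp_integral : integral_mx O (nil_exp M) <-> integral_mx O X /\ integral_mx O X'.
Proof.
have [T uE TN] := graded_exp; split=> [uO|[XO X'O]]; last first.
  rewrite /nil_exp; apply: integral_mx_sum => k _; apply: integral_mxZ.
    exact: csub_natV.
  by apply: integral_mx_exp; apply: integral_mxD.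
have T0 j k : w j - w k < 3 -> T j k = 0.
  by move=> jk; apply/eqP; apply: contraTT jk => /TN; rewrite -leNgt.
have one0 j k : w j - w k != 0 -> (1%:M : 'M[F]_n) j k = 0.
  by rewrite mxE; case: (j =P k) => // ->; rewrite subrr eqxx.
have MM : M *m M = X *m X + X *m X' + X' *m X + X' *m X'.
  by rewrite /M mulmxDl !mulmxDr !addrA.
have uE' j k : nil_exp M j k = (1%:M : 'M[F]_n) j k + (X j k + X' j k) +
    2^-1 * ((X *m X) j k + (X *m X') j k + (X' *m X) j k + (X' *m X') j k) + T j k.
  rewrite uE MM /M.
  move: (X *m X) (X *m X') (X' *m X) (X' *m X') (1%:M : 'M[F]_n) => A B C D E.
  by rewrite !mxE.
have n12 : (1 == 2 :> R) = false by rewrite (eqr_nat R 1 2).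
have deg (k l : nat) : k != l -> (k%:R : R) != l%:R by rewrite eqr_nat.
have XX := homogeneousM hX hX; have XX' := homogeneousM hX hX'.
have X'X := homogeneousM hX' hX; have X'X' := homogeneousM hX' hX'.
have nat2 : 1 + 1 = 2%:R :> R by ring.
have nat3 : 1 + 2 = 3%:R :> R by ring.
have nat3' : 2 + 1 = 3%:R :> R by ring.
have nat4 : 2 + 2 = 4%:R :> R by ring.
rewrite nat2 in XX; rewrite nat3 in XX'; rewrite nat3' in X'X; rewrite nat4 in X'X'.
have XO : integral_mx O X.
  move=> j k; have [jk|jk] := eqVneq (w j - w k) 1; last first.
    by rewrite (homogeneous_entry hX jk) csub0.
  have := uO j k; rewrite uE' one0 ?jk ?oner_eq0 // T0 ?jk ?(ltr_nat _ 1 3) //.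
  rewrite (homogeneous_entry hX' (j := j) (k := k)) ?jk ?(deg 1%N 2%N) //.
  rewrite (homogeneous_entry XX (j := j) (k := k)) ?jk ?(deg 1%N 2%N) //.
  rewrite (homogeneous_entry XX' (j := j) (k := k)) ?jk ?(deg 1%N 3%N) //.
  rewrite (homogeneous_entry X'X (j := j) (k := k)) ?jk ?(deg 1%N 3%N) //.
  rewrite (homogeneous_entry X'X' (j := j) (k := k)) ?jk ?(deg 1%N 4%N) //.
  by rewrite !addr0 mulr0 addr0 add0r.
split=> // j k; have [jk|jk] := eqVneq (w j - w k) 2; last first.
  by rewrite (homogeneous_entry hX' jk) csub0.
have := uO j k; rewrite uE' one0 ?jk ?pnatr_eq0 // T0 ?jk ?(ltr_nat _ 2 3) //.
rewrite (homogeneous_entry hX (j := j) (k := k)) ?jk ?(deg 2%N 1%N) //.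
rewrite (homogeneous_entry XX' (j := j) (k := k)) ?jk ?(deg 2%N 3%N) //.
rewrite (homogeneous_entry X'X (j := j) (k := k)) ?jk ?(deg 2%N 3%N) //.
rewrite (homogeneous_entry X'X' (j := j) (k := k)) ?jk ?(deg 2%N 4%N) //.
rewrite !addr0 !add0r => sO; rewrite -[X' j k](addrK (2^-1 * (X *m X) j k)).
by apply: csubB => //; apply: csubM; [apply: csub_natV|apply: integral_mxM].
Qed.

Lemma graded_exp_diag j : nil_exp M j j = 1.
Proof.
have [T -> TN] := graded_exp.
have Tjj : T j j = 0.
  apply/eqP; apply: contraTT isT => /TN; by rewrite subrr leNgt ltr0n.
have M0 : M j j = 0.
  by apply/eqP; apply: contraTT isT => /M_weight; rewrite subrr leNgt ltr01.
have MM0 : (M *m M) j j = 0.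
  apply/eqP; apply: contraTT isT => h; have := @M_weightX 2%N j j.
  by rewrite expr2 => /(_ h); rewrite subrr leNgt ltr0n.
have gen (A B C : 'M[F]_n) : A j j = 0 -> B j j = 0 -> C j j = 0 ->
    (1%:M + A + 2^-1 *: B + C) j j = 1.
  by move=> a b c; rewrite !mxE a b c eqxx mulr0 !addr0.
exact: gen.
Qed.

End Graded.

(** * The Cartan decomposition and the building *)

Lemma ptZ (L : fieldType) n (Q : 'M[L]_n) c d : pt Q (c *: d) = c *: pt Q d.
Proof. by rewrite /pt linearZ /= -scalemxAr -scalemxAl. Qed.

Lemma diag_commutator (F : fieldType) n (h : 'rV[F]_n) (M : 'M[F]_n) (c : F) j k :
  diag_mx h *m M - M *m diag_mx h = c *: M -> M j k != 0 -> c = h 0 j - h 0 k.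
Proof.
rewrite mul_diag_mx mul_mx_diag => /matrixP/(_ j k); rewrite !mxE => e M0.
by apply: (mulIf M0); rewrite -[LHS]e; ring.
Qed.

Lemma diag_commute (F : fieldType) n (h : 'rV[F]_n) (M : 'M[F]_n) :
  (forall j k, M j k != 0 -> h 0 j = h 0 k) -> M *m diag_mx h = diag_mx h *m M.
Proof.
move=> Mh; rewrite mul_diag_mx mul_mx_diag; apply/matrixP => j k; rewrite !mxE mulrC.
by have [->|/Mh ->] := eqVneq (M j k) 0; rewrite ?mulr0.
Qed.

Lemma nil_exp0 (L : rcfType) m : nil_exp (0 : 'M[L]_m) = 1%:M.
Proof.
case: m => [|m]; first by apply/matrixP => -[].
rewrite /nil_exp big_ord_recl big1 ?addr0 => [|k _]; first by rewrite /= invr1 scale1r expr0.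
by rewrite exprS mul0r scaler0.
Qed.

Lemma mul_sinh_gt0 (R : realType) (x : R) : x != 0 -> 0 < x * (expR x - expR (- x)).
Proof.
move=> x0; have [xn|xp] : x < 0 \/ 0 < x by apply/orP; rewrite -neq_lt.
  by rewrite nmulr_rgt0 // subr_lt0 ltr_expR; lra.
by rewrite pmulr_rgt0 // subr_gt0 ltr_expR; lra.
Qed.

(** * The real Lie algebra and its root spaces *)

Section LieAlgebra.
Variables (K : rcfType) (R : realType) (iR : {rmorphism K -> R}) (n : nat).
Variables (G S : set (mxpol n K)).
Hypothesis aG : alg_subgroup_SL G.
Hypothesis hGT : self_adjoint G.
Hypothesis hS : maximal_split_torus G S.
Hypothesis hST : forall s, geom_points S s -> s^T = s.
Variables (g a : {vspace 'M[R]_n}).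
Hypothesis hg : is_Lie_algebra_of g (zeros iR G).
Hypothesis ha : is_Lie_algebra_of a (torus_component_ext S iR).
Variable Q : 'M[K]_n.
Hypothesis QQ : Q *m Q^T = 1%:M.
Hypothesis Qdiag : forall s, geom_points S s ->
  is_diag_mx (map_mx (real_complex K) Q *m s *m (map_mx (real_complex K) Q)^T).

Let sS : split_torus S. Proof. by case: hS. Qed.
Let aS : alg_subgroup_SL S. Proof. by case: sS. Qed.
Local Notation QR := (map_mx iR Q).
Let QRQR : QR *m QR^T = 1%:M. Proof. exact: map_orthogonal. Qed.
Let QRTQR : QR^T *m QR = 1%:M. Proof. exact: QTQ. Qed.

Lemma torus_sub (L : rcfType) (i : {rmorphism K -> L}) s : zeros i S s -> zeros i G s.
Proof.
have d : dform (m := 0) (fun L i (E : ctx n L 0) =>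
  forall s : 'M[L]_n, zeros i S s -> zeros i G s) by definable.
apply/(transfer i d) : s => s /zeros_geom Ss; apply/zeros_geom.
by case: hS => _ + _; apply.
Qed.

Lemma cartan_algebraP X : X \in a <-> forall t, positive_torus S iR (mx_exp (t *: X)).
Proof. by have := ha X; rewrite (torus_component_extE sS QQ Qdiag iR). Qed.

Lemma cartan_sub X : X \in a -> X \in g.
Proof. by move=> /cartan_algebraP Xa; apply/hg => t; apply: torus_sub; case: (Xa t). Qed.

Definition coords (X : 'M[R]_n) : 'M[R]_n := QR *m X *m QR^T.

Lemma coords_is_linear : linear coords.
Proof. by move=> c X Y; rewrite /coords mulmxDr mulmxDl -scalemxAr -scalemxAl. Qed.
HB.instance Definition _ :=
  GRing.isLinear.Build R 'M[R]_n 'M[R]_n _ coords coords_is_linear.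

Lemma coordsM X Y : coords (X *m Y) = coords X *m coords Y.
Proof. by rewrite /coords !mulmxA -(mulmxA _ QR^T QR) QRTQR mulmx1. Qed.

Lemma coordsB X Y : coords (X - Y) = coords X - coords Y.
Proof. exact: linearB. Qed.

Lemma coordsD X Y : coords (X + Y) = coords X + coords Y.
Proof. exact: linearD. Qed.

Lemma coordsN X : coords (- X) = - coords X.
Proof. exact: linearN. Qed.

Lemma coordsZ c X : coords (c *: X) = c *: coords X.
Proof. exact: linearZ. Qed.

Lemma coordsT X : coords X^T = (coords X)^T.
Proof. by rewrite /coords !trmx_mul trmxK mulmxA. Qed.

Lemma coords_inj : injective coords.
Proof.
move=> X Y; move/(congr1 (fun Z => QR^T *m Z *m QR)).
by rewrite /coords !mulmxA QRTQR !mul1mx -!mulmxA QRTQR !mulmx1.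
Qed.

Lemma coords_pt d : coords (pt QR d) = diag_mx d.
Proof. by rewrite /coords pt_conj. Qed.

(** The off-diagonal coordinates of [exp (t X)] vanish for all [t], and their first-order
    coefficients are the coordinates of [X]. *)
Lemma cartan_diag X : X \in a -> exists d, X = pt QR d.
Proof.
move=> Xa; exists (\row_j (coords X) j j); apply: diag_pt => //.
apply/is_diag_mxP => j k jk; have /cartan_algebraP Xt := Xa.
have := mxtaylor2M (mxtaylor2M (mxtaylor2_const QR) (mxtaylor2_exp X)) (mxtaylor2_const QR^T) j k.
rewrite !(mulmx0, mul0mx, add0r, addr0, mulmx1, QRQR) => /taylor2_cst; apply => t.
rewrite (torus_off_diag Qdiag jk); last by case: (Xt t).
by rewrite mxE -val_eqE (negbTE jk).
Qed.

Lemma positive_torus_log s : positive_torus S iR s -> exists2 X, X \in a & s = mx_exp X.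
Proof.
move=> /(torus_log sS QQ Qdiag)[d sE Sd]; exists (pt QR d); last by rewrite (mx_exp_pt _ QRQR).
apply/cartan_algebraP => t; rewrite -ptZ (mx_exp_pt _ QRQR).
exact: (torus_expn sS QQ Sd).
Qed.

Lemma Lie_tr X : X \in g -> X^T \in g.
Proof.
by move=> /hg Xg; apply/hg => t; rewrite -linearZ mx_exp_tr; apply: zeros_tr.
Qed.

Lemma Lie_conj k X : zeros iR G k -> X \in g -> k *m X *m invmx k \in g.
Proof.
move=> Gk /hg Xg; have Uk := zeros_unit aG Gk; apply/hg => t.
rewrite scalemxAl scalemxAr mx_exp_conj ?mulVmx //.
by do 2?apply: zerosM => //; apply: zerosV.
Qed.

Local Notation maxK := (maximal_compact iR G).

Lemma exp_antisym Z t : Z \in g -> Z^T = - Z -> maxK (mx_exp (t *: Z)).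
Proof.
move=> /hg Zg ZT; split; first exact: Zg.
by rewrite -mx_exp_tr linearZ /= ZT scalerN mx_expN.
Qed.

Lemma maximal_compactM h k :
  maxK h -> maxK k -> maxK (h *m k).
Proof.
move=> [Gh hh] [Gk kk]; split; first exact: zerosM.
by rewrite trmx_mul mulmxA -(mulmxA h) kk mulmx1.
Qed.

Lemma maximal_compactT k : maxK k -> maxK k^T.
Proof. by move=> [Gk kk]; split; [apply: zeros_tr|rewrite trmxK; apply: mulmx1C]. Qed.

Lemma maximal_compact_inv k : maxK k -> invmx k = k^T.
Proof.
by move=> [Gk kk]; rewrite -[RHS](mulKmx (zeros_unit aG Gk)) kk mulmx1.
Qed.

(** The natural powers of the positive definite matrix [h h^T] lie in [G], hence its real powers do
    by [zeros_one_parameter]; [Y] is half of its logarithm. *)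
Lemma polar_decomposition h : zeros iR G h -> exists Y U d k,
  [/\ Y \in g, Y = pt U d, U *m U^T = 1%:M, maxK k & h = mx_exp Y *m k].
Proof.
move=> Gh; pose p := h *m h^T.
have pT : p^T = p by rewrite trmx_mul trmxK.
have Gp : zeros iR G p by apply: zerosM => //; apply: zeros_tr.
have [||U UU Ud] := @symmetric_codiagonalization R n [:: p].
- by move=> A; rewrite inE => /eqP ->.
- by move=> A B; rewrite !inE => /eqP -> /eqP ->.
have := Ud p (mem_head _ _) => /(diag_pt UU); set e := \row_j _ => pE.
have e0 j : 0 < e 0 j.
  apply: (gram_pt_pos UU); last by exists h; rewrite -pE.
  move=> k; have := zeros_det aG Gp; rewrite pE det_pt // => d1.
  by apply: contra_eq_neq d1 => ek; rewrite (bigD1 k) //= ek mul0r eq_sym oner_neq0.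
pose d : 'rV[R]_n := map_mx (@ln R) e.
have eE : map_mx expR d = e.
  by apply/rowP => j; rewrite [LHS]mxE [X in expR X]mxE lnK // posrE.
have Gd t : zeros iR G (pt U (map_mx expR (t *: d))).
  move: t; apply: zeros_one_parameter => k; elim: k => [|k IH].
    have -> : map_mx expR (0%:R *: d) = const_mx 1.
      by apply/rowP => j; rewrite !mxE mul0r expR0.
    by rewrite (pt1 UU); apply: zeros1.
  have -> : map_mx expR (k.+1%:R *: d) = vmul e (map_mx expR (k%:R *: d)).
    by rewrite -eE; apply/rowP => j; rewrite !mxE -expRD mulrSr addrC mulrDl mul1r.
  by rewrite (ptM UU) -pE; apply: zerosM.
pose Y := pt U (2^-1 *: d).
have Yg : Y \in g.
  by apply/hg => t; rewrite /Y -ptZ (mx_exp_pt _ UU) scalerA; apply: Gd.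
have YE : mx_exp Y = pt U (map_mx expR (2^-1 *: d)) by rewrite (mx_exp_pt _ UU).
have YT : (mx_exp Y)^T = mx_exp Y by rewrite YE pt_tr.
have YY : mx_exp Y *m mx_exp Y = p.
  rewrite YE -(ptM UU) pE; congr pt; rewrite -eE; apply/rowP => j.
  rewrite !mxE -expRD; congr expR; lra.
have GY : zeros iR G (mx_exp Y) by rewrite YE; apply: Gd.
have UY := zeros_unit aG GY.
exists Y, U, (2^-1 *: d), (invmx (mx_exp Y) *m h); split=> //; last by rewrite mulKVmx.
split; first by apply: zerosM => //; apply: zerosV.
rewrite trmx_mul trmx_inv YT mulmxA -(mulmxA _ h) -/p -YY.
by rewrite mulKmx // mulmxV.
Qed.

Lemma entry_form_subproof (j : 'I_n) :
  linear (fun H : subvs_of a => coords (vsval H) j j : R^o).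
Proof.
move=> c H H'; have -> : vsval (c *: H + H') = c *: vsval H + vsval H' by rewrite linearP.
rewrite coordsD coordsZ.
by move: (coords _) (coords _) => A B; rewrite !mxE.
Qed.

Definition entry_form (j : 'I_n) : dual_space a := linfun
  (HB.pack_for {linear subvs_of a -> R^o} (fun H : subvs_of a => coords (vsval H) j j : R^o)
    (GRing.isLinear.Build R (subvs_of a) R^o _ _ (entry_form_subproof j))).

Lemma entry_formE j (H : subvs_of a) : entry_form j H = coords (vsval H) j j.
Proof. by rewrite lfunE. Qed.

Definition entry_diff (j k : 'I_n) : dual_space a := entry_form j - entry_form k.

Lemma entry_diffE j k (H : subvs_of a) :
  entry_diff j k H = coords (vsval H) j j - coords (vsval H) k k.
Proof. by rewrite add_lfunE opp_lfunE !entry_formE. Qed.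

Lemma coords_cartan (H : subvs_of a) : coords (vsval H) = diag_mx (\row_j coords (vsval H) j j).
Proof.
have [d ->] := cartan_diag (subvsP H); rewrite coords_pt; congr diag_mx.
by apply/rowP => j; rewrite !mxE eqxx.
Qed.

Lemma root_entry alpha X j k (H : subvs_of a) : root_space g alpha X ->
  coords X j k != 0 -> (alpha H : R) = coords (vsval H) j j - coords (vsval H) k k.
Proof.
move=> [_ /(_ H)/(congr1 coords)]; rewrite coordsB coordsZ !coordsM coords_cartan.
move/diag_commutator => /[apply] ->; by rewrite -coords_cartan [X in X - _]mxE [X in _ - X]mxE.
Qed.

(** A torus through a real point [p] need not be defined over [K], so maximality of [S] is not
    applied directly; its consequence [torus_maximal] for points over [K] is transferred to [R]. *)
Lemma torus_maximal_real p : zeros iR G p -> is_gram p ->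
  (forall s, positive_torus S iR s -> p *m s = s *m p) -> zeros iR S p.
Proof.
have d : dform (m := 0) (fun L i (E : ctx n L 0) =>
    forall p : 'M[L]_n, zeros i G p -> (exists q : 'M[L]_n, p = q *m q^T) ->
    (forall s : 'M[L]_n, zeros i S s -> (exists q : 'M[L]_n, s = q *m q^T) ->
       p *m s = s *m p) -> zeros i S p).
  definable.
have H : forall p : 'M[K]_n, zeros idfun G p -> is_gram p ->
    (forall s, zeros idfun S s -> is_gram s -> p *m s = s *m p) -> zeros idfun S p.
  by move=> q Gq gq qS; apply: (torus_maximal sS hST aG hS Gq gq).
move=> Gp gp pS; apply: ((transfer iR d).2 H) => // s Ss gs; exact: pS.
Qed.

Lemma mxtrace_coords X : \tr (coords X) = \tr X.
Proof. by rewrite /coords mxtrace_mulC mulmxA QRTQR mul1mx. Qed.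

(** * First and second variation at a maximum *)

Section Maximum.
Variables (Y : 'M[R]_n) (H : subvs_of a).
Hypothesis Yg : Y \in g.
Hypothesis YT : Y^T = Y.
Hypothesis Ymax : forall h, maxK h -> \tr (h *m Y *m h^T *m vsval H) <= \tr (Y *m vsval H).

(** [exp (t Z)] runs in the compact group, so the trace along this curve is largest at [t = 0]; the
    claims concern its coefficients of [t] and [t^2]. *)
Lemma maximum_conditions Z : Z \in g -> Z^T = - Z ->
  \tr ((Y *m - Z + Z *m Y) *m vsval H) = 0 /\
  \tr ((Y *m (2^-1 *: (- Z *m - Z)) + Z *m Y *m - Z + 2^-1 *: (Z *m Z) *m Y) *m vsval H) <= 0.
Proof.
move=> Zg ZT.
have := mxtaylor2_trace (mxtaylor2M (mxtaylor2M (mxtaylor2M (mxtaylor2_exp Z)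
  (mxtaylor2_const Y)) (mxtaylor2_exp (- Z))) (mxtaylor2_const (vsval H))).
rewrite !(mul1mx, mulmx1, mulmx0, mul0mx, add0r, addr0) => /taylor2_max[] // t.
have := Ymax (exp_antisym t Zg ZT).
by rewrite -mx_exp_tr linearZ /= ZT.
Qed.

Let h := \row_j coords (vsval H) j j.

Lemma maximum_coords Z : Z \in g -> Z^T = - Z ->
  \sum_j \sum_k coords Z j k * coords Y j k * (h 0 j - h 0 k) = 0.
Proof.
move=> Zg ZT; have [+ _] := maximum_conditions Zg ZT.
rewrite -mxtrace_coords !coordsM coordsD !coordsM coordsN coords_cartan.
by rewrite trace_bracket // -coordsT ?YT // ZT coordsN.
Qed.

(* Test the maximum in the direction Z = Ad(exp H) Y - Ad(exp (-H)) Y, whose first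
   variation is a sum of terms y^2 x (e^x - e^(-x)). *)
Lemma maximum_commutes j k : coords Y j k != 0 -> h 0 j = h 0 k.
Proof.
pose E := mx_exp (vsval H); pose E' := mx_exp (- vsval H).
have EE' : E *m E' = 1%:M by apply: mx_expN.
have [HN HNE] : exists H' : subvs_of a, vsval H' = - vsval H.
  by exists (- H); rewrite raddfN.
have diagE (H' : subvs_of a) : exists d, coords (vsval H') = diag_mx d /\
    coords (mx_exp (vsval H')) = diag_mx (map_mx expR d) /\
    zeros iR G (mx_exp (vsval H')) /\ (mx_exp (vsval H'))^T = mx_exp (vsval H').
  have [d dE] := cartan_diag (subvsP H'); exists d.
  rewrite dE (mx_exp_pt _ QRQR) !coords_pt pt_tr; do !split.
  by have /cartan_sub/hg/(_ 1) := subvsP H'; rewrite scale1r dE (mx_exp_pt _ QRQR).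
have [d [dE [EE [GE ET]]]] := diagE H.
have [d' []] := diagE HN; rewrite HNE coordsN dE => d'E [EE'' [GE' E'T]].
have d'E' : d' = - d.
  apply/rowP => l; have /matrixP/(_ l l) := d'E.
  by rewrite !mxE eqxx !mulr1n => <-.
have E'E : E' *m E = 1%:M by apply: mulmx1C.
have iE : invmx E = E' by rewrite -[RHS](mulKmx (zeros_unit aG GE)) EE' mulmx1.
have iE' : invmx E' = E by rewrite -iE invmxK.
pose Z := E *m Y *m E' - E' *m Y *m E.
have Zg : Z \in g.
  apply: rpredB; first by rewrite -iE; apply: Lie_conj.
  by rewrite -[X in _ *m X]iE'; apply: Lie_conj.
have ZT : Z^T = - Z.
  by rewrite /Z linearB /= !trmx_mul YT ET E'T opprB !mulmxA.
have hE l : h 0 l = d 0 l by rewrite /h mxE dE mxE eqxx.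
have ZE p q : coords Z p q = (expR (d 0 p - d 0 q) - expR (- (d 0 p - d 0 q))) * coords Y p q.
  rewrite /Z coordsB !coordsM EE EE'' d'E' !mul_diag_mx !mul_mx_diag.
  move: (coords Y) => y; rewrite !mxE opprB !expRD; ring.
have wE p q : coords Z p q * coords Y p q * (h 0 p - h 0 q) = coords Y p q ^+ 2 *
    ((d 0 p - d 0 q) * (expR (d 0 p - d 0 q) - expR (- (d 0 p - d 0 q)))).
  by rewrite ZE !hE; ring.
have w0 p q : 0 <= coords Z p q * coords Y p q * (h 0 p - h 0 q).
  by rewrite wE mulr_ge0 ?sqr_ge0 //; have [->|/mul_sinh_gt0/ltW] := eqVneq (d 0 p - d 0 q) 0; rewrite ?mul0r.
move=> Yjk; apply/eqP; rewrite -subr_eq0; apply: contraTT isT => hjk.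
have s0 : \sum_q coords Z j q * coords Y j q * (h 0 j - h 0 q) = 0.
  apply: (psumr_eq0P _ (maximum_coords Zg ZT) (erefl : xpredT j)) => p _.
  by apply: sumr_ge0 => q _; apply: w0.
have : coords Z j k * coords Y j k * (h 0 j - h 0 k) = 0.
  exact: (psumr_eq0P (fun q _ => w0 j q) s0 (erefl : xpredT k)).
move/eqP; by rewrite wE mulf_eq0 sqrf_eq0 (negbTE Yjk) gt_eqF ?mul_sinh_gt0 -?hE.
Qed.

(** The test direction is [E - E^T]. Its nonzero coordinates sit where diagonal entries differ by
    [alpha] up to a common sign, so all terms of the second variation share the factor
    [alpha H' * alpha H]. *)
Lemma maximum_dominant alpha E : root_space g alpha E -> E != 0 -> (alpha H : R) != 0 ->
  forall H' : subvs_of a, vsval H' = Y -> 0 <= (alpha H' : R) * alpha H.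
Proof.
move=> rE E0 aH H' HY.
have [Z [Zg ZT ZE]] : exists Z, [/\ Z \in g, Z^T = - Z &
    forall p q, coords Z p q = coords E p q - coords E q p].
  exists (E - E^T); have Eg : E \in g by case: rE.
  split; first by apply: rpredB => //; apply: Lie_tr.
    by rewrite linearB /= trmxK opprB.
  move=> p q; rewrite coordsB coordsT; move: (coords E) => e.
  by rewrite !mxE.
have [_] := maximum_conditions Zg ZT.
have YE : coords Y = diag_mx (\row_j coords Y j j) by rewrite -HY -coords_cartan.
rewrite -mxtrace_coords !(coordsM, coordsD, coordsZ, coordsN) coords_cartan.
rewrite (trace_second _ YE); last by rewrite -coordsT ZT coordsN.
rewrite mulNr oppr_le0 pmulr_rge0 ?invr_gt0 ?ltr0n //.
have wE p q : coords Z p q ^+ 2 * ((\row_j coords Y j j) 0 p - (\row_j coords Y j j) 0 q) *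
    ((\row_j coords (vsval H) j j) 0 p - (\row_j coords (vsval H) j j) 0 q) =
    coords Z p q ^+ 2 * ((alpha H' : R) * alpha H).
  have [->|] := eqVneq (coords Z p q) 0; first by rewrite expr2 !mul0r.
  rewrite ZE => EN; rewrite -mulrA; congr (_ * _).
  rewrite [X in X - _]mxE [X in _ - X]mxE [X in _ * (X - _)]mxE [X in _ * (_ - X)]mxE.
  have [Epq|Epq] := eqVneq (coords E p q) 0.
    have Eqp : coords E q p != 0 by apply: contraNneq EN => ->; rewrite Epq subrr.
    by rewrite !(root_entry _ rE Eqp) HY; ring.
  by rewrite !(root_entry _ rE Epq) HY.
under eq_bigr do under eq_bigr do rewrite wE.
under eq_bigr do rewrite -mulr_suml.
rewrite -mulr_suml pmulr_rge0 //.
have [p [q Epq]] : exists p q, coords E p q != 0.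
  apply: contrapT => nE; move/eqP: E0; apply; apply: coords_inj.
  rewrite (linear0 coords); apply/matrixP => p q; rewrite [RHS]mxE; apply/eqP/negPn/negP => Epq.
  by apply: nE; exists p, q.
(* Two opposite nonzero coordinates would give [alpha H = - alpha H]. Hence [Z] does not vanish at
   [(p, q)] and the sum of squares is positive. *)
have Eqp : coords E q p = 0.
  apply/eqP; apply: contraNT aH => Eqp; apply/eqP.
  have h1 := root_entry H rE Epq; have h2 := root_entry H rE Eqp.
  have : (alpha H : R) = - alpha H by rewrite {1}h1 h2 opprB.
  by move/esym/eqP; rewrite eqNr => /eqP.
have Zpq : 0 < coords Z p q ^+ 2.
  by rewrite exprn_even_gt0 //= ZE Eqp subr0.
rewrite (bigD1 p) //= (bigD1 q) //= -addrA ltr_pwDl // addr_ge0 //.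
  by apply: sumr_ge0 => *; apply: sqr_ge0.
by apply: sumr_ge0 => *; apply: sumr_ge0 => *; apply: sqr_ge0.
Qed.

End Maximum.

(** * The Cartan decomposition, its transfer, and bounds on the torus *)

Variable Delta : seq (dual_space a).
Hypothesis hDelta : root_basis g Delta.

Lemma conj_dominant Y U d : Y \in g -> Y = pt U d -> U *m U^T = 1%:M ->
  exists k (H' : subvs_of a), [/\ maxK k, vsval H' = k *m Y *m k^T &
    forall beta, beta \in Delta -> 0 <= (beta H' : R)].
Proof.
move=> Yg YE UU; have [bD Droot _] := hDelta.
(* Generic here means that two diagonal coordinates of [H] agree only if they agree on all of [a];
   commuting with [H] is then commuting with [a]. *)
have [H [Hpos Hgen]] := generic_element (fun jk : 'I_n * 'I_n => entry_diff jk.1 jk.2) bD.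
have K1 : maxK 1%:M by split; [exact: zeros1|rewrite trmx1 mulmx1].
have [k [Kk kmax]] := maximal_compact_max Y (vsval H) K1.
pose Y' := k *m Y *m k^T; pose U' := U *m k^T.
have kTk : k^T *m k = 1%:M by apply: mulmx1C; case: Kk.
have U'U' : U' *m U'^T = 1%:M by rewrite trmx_mul trmxK mulmxA -(mulmxA U) kTk mulmx1.
have Y'E : Y' = pt U' d by rewrite /Y' YE /pt trmx_mul trmxK !mulmxA.
have Y'g : Y' \in g by rewrite /Y' -maximal_compact_inv //; apply: Lie_conj => //; case: Kk.
have Y'T : Y'^T = Y' by rewrite Y'E pt_tr.
have Y'max h : maxK h -> \tr (h *m Y' *m h^T *m vsval H) <= \tr (Y' *m vsval H).
  move=> Kh; have := kmax _ (maximal_compactM Kh Kk).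
  by rewrite trmx_mul /Y' !mulmxA.
have Y'diag j l : coords Y' j l != 0 -> forall H' : subvs_of a,
    coords (vsval H') j j = coords (vsval H') l l.
  move=> /(maximum_commutes Y'g Y'T Y'max); rewrite [LHS]mxE [RHS]mxE => jl H'.
  apply/eqP; rewrite -subr_eq0 -entry_diffE; apply: contraTT isT => H'0.
  have b0 : entry_diff j l != 0 by apply: contraNneq H'0 => e; rewrite e zero_lfunE eqxx.
  have := Hgen (j, l) b0.
  by rewrite entry_diffE jl subrr eqxx.
have Y'a : Y' \in a.
  apply/cartan_algebraP => t.
  have gr : is_gram (mx_exp (t *: Y')).
    rewrite Y'E -ptZ (mx_exp_pt _ U'U'); apply: pos_gram => j.
    by rewrite mxE expR_gt0.
  split=> //; apply: torus_maximal_real => //; first by move/hg: Y'g; apply.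
  move=> s /positive_torus_log[X Xa sE].
  have [e XE] := cartan_diag Xa; have sE' : s = pt QR (map_mx expR e).
    by rewrite sE XE (mx_exp_pt _ QRQR).
  have Us : s \in unitmx.
    have /hg/(_ 1) := cartan_sub Xa; rewrite scale1r -sE.
    exact: zeros_unit.
  have comm : Y' *m s = s *m Y'.
    apply: coords_inj; rewrite (coordsM Y') (coordsM s) sE' coords_pt; apply: diag_commute => j l jl.
    have := Y'diag j l jl (vsproj a X); rewrite vsprojK // XE coords_pt !mxE !eqxx.
    by rewrite !mulr1n => ->.
  have sYs : t *: Y' = s *m (t *: Y') *m invmx s.
    by rewrite -scalemxAr -scalemxAl -comm mulmxK.
  by rewrite {1}sYs mx_exp_conj ?mulVmx // mulmxKV.
exists k, (vsproj a Y'); rewrite vsprojK //; split=> // beta bD'.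
have [E rE E0] : exists2 E, root_space g beta E & E != 0.
  have [_ r0] := Droot beta bD'; apply: contrapT => nE; apply: r0; apply/seteqP; split=> E /=.
    by move=> rE; apply: contrapT => E0; apply: nE; exists E => //; apply/eqP.
  move=> ->; split=> [|H']; first exact: mem0v.
  by rewrite mulmx0 mul0mx subrr scaler0.
have bH := Hpos beta bD'.
have := maximum_dominant Y'max rE E0 (lt0r_neq0 bH) (vsprojK Y'a).
by rewrite pmulr_lge0.
Qed.

Variable chi : dual_space a -> mxpol n K.
Hypothesis hchi : forall alpha, restricted_roots g a alpha ->
  forall H : subvs_of a, mxeval iR (chi alpha) (mx_exp (vsval H)) = expR (alpha H).

Lemma cartan_decomposition_real h : zeros iR G h -> exists k k' s,
  [/\ maxK k, maxK k', positive_torus S iR s,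
      forall beta, beta \in Delta -> 1 <= mxeval iR (chi beta) s & h = k *m s *m k'].
Proof.
move=> /polar_decomposition[Y [U [d [k0 [Yg YE UU Kk0 hE]]]]].
have [k [H [Kk HE Hpos]]] := conj_dominant Yg YE UU.
have [_ kk] := Kk; have kTk := mulmx1C kk.
exists k^T, (k *m k0), (mx_exp (vsval H)); split.
- exact: maximal_compactT.
- exact: maximal_compactM.
- by have /cartan_algebraP/(_ 1) := subvsP H; rewrite scale1r.
- move=> beta bD; rewrite hchi; last by have [_ + _] := hDelta; apply.
  by rewrite -expR0 ler_expR; apply: Hpos.
rewrite hE [in LHS](_ : Y = k^T *m vsval H *m k) ?mx_exp_conj ?mulmxA //.
by rewrite HE !mulmxA kTk mul1mx -mulmxA kTk mulmx1.
Qed.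

Lemma root_nonzero beta : restricted_roots g a beta ->
  exists E, root_space g beta E /\ E != 0.
Proof.
move=> [_ r0]; apply: contrapT => nE; apply: r0; apply/seteqP; split=> E /=.
  by move=> rE; apply: contrapT => E0; apply: nE; exists E; split=> //; apply/eqP.
move=> ->; split=> [|H']; first exact: mem0v.
by rewrite mulmx0 mul0mx subrr scaler0.
Qed.

(** A nonzero coordinate of a root vector exhibits the root as a difference of two entry forms. *)
Lemma finite_roots : finite_set (restricted_roots g a).
Proof.
apply: (@sub_finite_set _ _
  [set entry_diff jk.1 jk.2 | jk in [set: 'I_n * 'I_n]]); last first.
  exact/finite_image/finite_finset.
move=> beta /root_nonzero[E [rE /eqP E0]].
have [j [k Ejk]] : exists j k, coords E j k != 0.
  apply: contrapT => nE; apply: E0; apply: coords_inj; apply/matrixP => j k.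
  rewrite (linear0 coords) [RHS]mxE; apply/eqP/negPn/negP => Ejk.
  by apply: nE; exists j, k.
exists (j, k) => //; apply/lfunP => H.
by rewrite entry_diffE (root_entry H rE Ejk).
Qed.

Lemma root_coroot (beta : dual_space a) : beta != 0 -> exists H : subvs_of a, (beta H : R) = 1.
Proof.
move=> b0; have [H bH] : exists H : subvs_of a, (beta H : R) != 0.
  apply: contrapT => nH; move/eqP: b0; apply; apply/lfunP => H; rewrite zero_lfunE.
  by apply/eqP/negPn/negP => bH; apply: nH; exists H.
by exists ((beta H : R)^-1 *: H); rewrite linearZ; apply: mulVf.
Qed.

Definition weights (H : subvs_of a) (j : 'I_n) : R := coords (vsval H) j j.

Lemma root_homogeneous (beta : dual_space a) X (H : subvs_of a) c : root_space g beta X -> (beta H : R) = c ->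
  homogeneous (weights H) c (coords X).
Proof. by move=> rX <- j k /(root_entry H rX) ->. Qed.

Lemma torus_log_coords s : positive_torus S iR s -> exists H : subvs_of a,
  s = mx_exp (vsval H) /\ coords s = diag_mx (\row_j expR (coords (vsval H) j j)).
Proof.
move=> /positive_torus_log[X Xa sE]; exists (vsproj a X); rewrite vsprojK //; split=> //.
rewrite sE; have [d ->] := cartan_diag Xa; rewrite (mx_exp_pt _ QRQR) !coords_pt.
by congr diag_mx; apply/rowP => j; rewrite !mxE eqxx mulr1n.
Qed.

Lemma root_commutation (beta : dual_space a) X s (H : subvs_of a) :
  root_space g beta X -> s = mx_exp (vsval H) ->
  coords s = diag_mx (\row_j expR (coords (vsval H) j j)) ->
  s *m X = expR (beta H) *: (X *m s).
Proof.
move=> rX sE sc; apply: coords_inj; rewrite coordsZ !coordsM sc.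
rewrite mul_diag_mx mul_mx_diag; apply/matrixP => j k.
have := @root_entry beta X j k H rX; move: (coords X) (coords (vsval H)) => x h jk.
rewrite !mxE; have [->|/jk ->] := eqVneq (x j k) 0; first by rewrite mulr0 mul0r mulr0.
by rewrite expRD expRN; field; rewrite gt_eqF ?expR_gt0.
Qed.

(** Weights taken from an [H] with [beta H = 1] make the sum strictly graded, hence nilpotent; so
    its finite exponential is the analytic one. *)
Lemma root_exp_point (beta : dual_space a) X X' : beta != 0 -> root_space g beta X ->
  root_space g (beta *+ 2) X' -> zeros iR G (nil_exp (X + X')).
Proof.
move=> /root_coroot[H bH] rX rX'.
have b2H : ((beta *+ 2) H : R) = 2 by rewrite mulr2n add_lfunE bH.
have nil : (X + X') ^+ n = 0.
  have cX m M : coords (M ^+ m) = coords M ^+ m.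
    elim: m => [|m IH]; first by rewrite !expr0 /coords mulmx1 QRQR.
    by rewrite !exprS coordsM IH.
  apply: coords_inj; rewrite cX coordsD (linear0 coords).
  exact: graded_nilpotent (root_homogeneous rX bH) (root_homogeneous rX' b2H).
rewrite -(mx_exp_nilpotent nil) -[X + X']scale1r; move: (1 : R); apply/hg.
by apply: rpredD; [case: rX|case: rX'].
Qed.

Lemma chi_surj_real beta c : restricted_roots g a beta -> 0 < c ->
  exists2 s, positive_torus S iR s & mxeval iR (chi beta) s = c.
Proof.
move=> rb c0; have [/eqP b0 _] := rb; have [H bH] := root_coroot b0.
exists (mx_exp (vsval (ln c *: H))).
  by have /cartan_algebraP/(_ 1) := subvsP (ln c *: H); rewrite scale1r.
rewrite hchi //; have -> : (beta (ln c *: H) : R) = ln c.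
  by rewrite linearZ /= bH; apply: mulr1.
by rewrite lnK.
Qed.

(** The logarithm of a diagonal coordinate is the value of an entry form, a combination of [Delta],
    and the hypotheses bound [Delta] by [ln B]. The exponent is a natural number above the sum of
    the absolute values of the coefficients, so that the inequality is polynomial and can be
    transferred. *)
Lemma torus_bound : Delta != [::] -> exists C : nat, forall j s (B : R), positive_torus S iR s ->
  (forall beta, beta \in Delta ->
     mxeval iR (chi beta) s <= B /\ 1 <= B * mxeval iR (chi beta) s) ->
  coords s j j <= B ^+ C.
Proof.
move=> D0; have [bD Droot _] := hDelta.
pose c j l : R := coord (in_tuple Delta) l (entry_form j).
have cE j : entry_form j = \sum_(l < size Delta) c j l *: Delta`_l.
  by have := coord_basis (X := in_tuple Delta) bD (memvf (entry_form j)).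
pose Cr : R := \sum_j \sum_l `|c j l|.
exists (Num.bound Cr) => j s B Ps sB.
have [H [sE sc]] := torus_log_coords Ps.
have [b0 b0D] : exists b, b \in Delta by case: (Delta) D0 => // b ? _; exists b; rewrite mem_head.
have chE b : b \in Delta -> mxeval iR (chi b) s = expR (b H) by move=> bD'; rewrite sE hchi //; apply: Droot.
have B0 : 0 < B.
  have [_] := sB b0 b0D; rewrite chE // => /(lt_le_trans ltr01).
  by rewrite pmulr_lgt0 // expR_gt0.
have bH b : b \in Delta -> `|b H : R| <= ln B.
  move=> bD'; have [h1 h2] := sB b bD'; rewrite chE // in h1 h2.
  rewrite ler_norml -[X in _ && X]ler_expR lnK // h1 andbT lerNl -ler_expR lnK // expRN.
  by rewrite -[leLHS]mul1r ler_pdivrMr ?expR_gt0.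
have lnB : 0 <= ln B by apply: le_trans (bH _ b0D).
rewrite sc mxE eqxx mulr1n mxE -[leRHS]lnK ?posrE ?exprn_gt0 // ler_expR lnXn //.
apply: (@le_trans _ _ (Cr * ln B)); last first.
  rewrite -mulr_natl; apply: ler_wpM2r => //; apply/ltW/archi_boundP.
  by rewrite sumr_ge0 // => *; rewrite sumr_ge0.
rewrite -entry_formE cE sum_lfunE; apply: (@le_trans _ _ (\sum_l `|c j l| * ln B)).
  apply: ler_sum => l _; rewrite scale_lfunE; apply: le_trans (ler_norm _) _.
  by rewrite normrM; apply: ler_wpM2l => //; apply: bH; apply: mem_nth.
rewrite -mulr_suml; apply: ler_wpM2r => //.
rewrite /Cr (bigD1 j) //= lerDl sumr_ge0 // => *; exact: sumr_ge0.
Qed.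

Lemma cartan_decomposition (L : rcfType) (i : {rmorphism K -> L}) h :
  zeros i G h -> exists k k' s,
  [/\ zeros i G k /\ k *m k^T = 1%:M, zeros i G k' /\ k' *m k'^T = 1%:M,
      positive_torus S i s,
      forall beta, beta \in Delta -> 1 <= mxeval i (chi beta) s & h = k *m s *m k'].
Proof.
have d : dform (m := 0) (fun L i (E : ctx n L 0) => forall h : 'M[L]_n, zeros i G h ->
    exists k k' s : 'M[L]_n, (zeros i G k /\ k *m k^T = 1%:M) /\
     (zeros i G k' /\ k' *m k'^T = 1%:M) /\
     (zeros i S s /\ exists q : 'M[L]_n, s = q *m q^T) /\
     (forall beta, beta \in Delta -> 1 <= mxeval i (chi beta) s) /\ h = k *m s *m k').
  definable.
have HK : forall h : 'M[K]_n, zeros idfun G h ->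
    exists k k' s : 'M[K]_n, (zeros idfun G k /\ k *m k^T = 1%:M) /\
     (zeros idfun G k' /\ k' *m k'^T = 1%:M) /\
     (zeros idfun S s /\ exists q : 'M[K]_n, s = q *m q^T) /\
     (forall beta, beta \in Delta -> 1 <= mxeval idfun (chi beta) s) /\ h = k *m s *m k'.
  apply/(transfer iR d) => h' /cartan_decomposition_real[k [k' [s [? ? ? ? ?]]]].
  by exists k, k', s.
move=> Gh; have [k [k' [s [? [? [? [? ?]]]]]]] := (transfer i d).2 HK h Gh.
by exists k, k', s.
Qed.

Hypothesis hchiA : forall alpha, restricted_roots g a alpha -> alg_character S (chi alpha).

Lemma chiM (L : rcfType) (i : {rmorphism K -> L}) beta s t : restricted_roots g a beta ->
  zeros i S s -> zeros i S t ->
  mxeval i (chi beta) (s *m t) = mxeval i (chi beta) s * mxeval i (chi beta) t.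
Proof.
move=> /hchiA[_ chM].
have d : dform (m := 0) (fun L i (E : ctx n L 0) => forall s t : 'M[L]_n,
    zeros i S s -> zeros i S t ->
    mxeval i (chi beta) (s *m t) = mxeval i (chi beta) s * mxeval i (chi beta) t).
  definable.
apply/(transfer i d) : s t => s t /zeros_geom Ss /zeros_geom St.
apply: (fmorph_inj (real_complex K)); rewrite rmorphM -!(mxeval_map (real_complex K)) map_mxM.
exact: chM.
Qed.

Lemma chi_gt0 (L : rcfType) (i : {rmorphism K -> L}) beta s : restricted_roots g a beta ->
  positive_torus S i s -> 0 < mxeval i (chi beta) s.
Proof.
move=> rb.
have d : dform (m := 0) (fun L i (E : ctx n L 0) => forall s : 'M[L]_n,
    zeros i S s -> (exists q : 'M[L]_n, s = q *m q^T) -> 0 < mxeval i (chi beta) s).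
  definable.
have HR : forall s : 'M[R]_n, zeros iR S s -> is_gram s -> 0 < mxeval iR (chi beta) s.
  move=> t St gt; have [|H [-> _]] := @torus_log_coords t; first by split.
  by rewrite hchi // expR_gt0.
by case; apply: ((transfer i d).2 ((transfer iR d).1 HR)).
Qed.

Lemma chi_surj (L : rcfType) (i : {rmorphism K -> L}) beta c : restricted_roots g a beta ->
  0 < c -> exists2 s, positive_torus S i s & mxeval i (chi beta) s = c.
Proof.
move=> rb c0; have [E [[_ _] /eqP E0]] := root_nonzero rb.
(* An index lets the sentence quantify over the scalar [c] as a matrix entry; a nonzero root vector
   shows that [n] is positive. *)
have j : 'I_n by case: (n) E E0 => [|m] E E0; [case: E0; apply: thinmx0|exact: ord0].
have d : dform (m := 0) (fun L i (E : ctx n L 0) => forall c : 'M[L]_n, 0 < c j j ->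
    exists s : 'M[L]_n, zeros i S s /\ (exists q : 'M[L]_n, s = q *m q^T) /\
      mxeval i (chi beta) s = c j j).
  definable.
have HR : forall c : 'M[R]_n, 0 < c j j -> exists s : 'M[R]_n,
    zeros iR S s /\ is_gram s /\ mxeval iR (chi beta) s = c j j.
  by move=> C C0; have [s [Ss gs] sC] := chi_surj_real rb C0; exists s.
have [|s [Ss [gs sE]]] := (transfer i d).2 ((transfer iR d).1 HR) (const_mx c).
  by rewrite mxE.
by exists s; rewrite // sE mxE.
Qed.

Lemma torus_bound_ext (L : rcfType) (i : {rmorphism K -> L}) : Delta != [::] ->
  exists C : nat, forall j s (B : L), positive_torus S i s ->
  (forall beta, beta \in Delta -> mxeval i (chi beta) s <= B /\ 1 <= B * mxeval i (chi beta) s) ->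
  torus_coords Q i s 0 j <= B ^+ C.
Proof.
move=> /torus_bound[C HC]; exists C => j.
have d : dform (m := 0) (fun L i (E : ctx n L 0) => forall s B : 'M[L]_n,
    zeros i S s -> (exists q : 'M[L]_n, s = q *m q^T) ->
    (forall beta, beta \in Delta ->
       mxeval i (chi beta) s <= B j j /\ 1 <= B j j * mxeval i (chi beta) s) ->
    (map_mx i Q *m s *m (map_mx i Q)^T) j j <= B j j ^+ C).
  definable.
have HR : forall s B : 'M[R]_n, zeros iR S s -> is_gram s ->
    (forall beta, beta \in Delta ->
       mxeval iR (chi beta) s <= B j j /\ 1 <= B j j * mxeval iR (chi beta) s) ->
    (map_mx iR Q *m s *m (map_mx iR Q)^T) j j <= B j j ^+ C.
  by move=> s B Ss gs sB; apply: HC.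
move=> s B [Ss gs] sB; rewrite mxE.
have := (transfer i d).2 ((transfer iR d).1 HR) s (const_mx B) Ss gs.
by rewrite [const_mx B j j]mxE; apply.
Qed.

Section RootSpaces.
Variables (L : rcfType) (i : {rmorphism K -> L}) (alpha : dual_space a).
Hypothesis ralpha : restricted_roots g a alpha.
Let VL := sa_extension iR i (root_space g alpha).
Let VL2 := sa_extension iR i (root_space g (alpha *+ 2)).
Local Notation QL := (map_mx i Q).
Variable H : subvs_of a.
Hypothesis aH : (alpha H : R) = 1.

(** For each position whose real weights do not differ by [c], the vanishing of that entry on the
    set defined by [f] is one sentence over [K]. *)
Lemma root_space_homogeneous beta c X : sa_extension iR i (root_space g beta) X ->
  (beta H : R) = c -> homogeneous (weights H) c (QL *m X *m QL^T).
Proof.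
move=> [f fE fX] bH j k; apply: contraNeq => jk.
have d : dform (m := 0) (fun L i (E : ctx n L 0) => forall X : 'M[L]_n,
    sa_set i f X -> (map_mx i Q *m X *m (map_mx i Q)^T) j k = 0).
  definable.
apply/eqP; apply: ((transfer i d).2 ((transfer iR d).1 _)) => // Y; rewrite -fE => rY.
by apply: homogeneous_entry jk; apply: root_homogeneous rY bH.
Qed.

(** Over [R] this says that [X] is an eigenvector of conjugation by [exp H']. Written with the
    character instead of [alpha], the equation makes sense over [L]. *)
Lemma root_space_commutation X s : VL X -> positive_torus S i s ->
  s *m X = mxeval i (chi alpha) s *: (X *m s).
Proof.
move=> [f fE fX] [Ss gs].
have d : dform (m := 0) (fun L i (E : ctx n L 0) => forall X s : 'M[L]_n, sa_set i f X ->
    zeros i S s -> (exists q : 'M[L]_n, s = q *m q^T) ->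
    s *m X = mxeval i (chi alpha) s *: (X *m s)).
  definable.
apply: ((transfer i d).2 ((transfer iR d).1 _)) => // Y t; rewrite -fE => rY St gt.
have [|H' [tE tc]] := @torus_log_coords t; first by split.
by rewrite (root_commutation rY tE tc) -(hchi ralpha) -tE.
Qed.

Lemma root_space2_commutation X s : VL2 X -> positive_torus S i s ->
  s *m X = mxeval i (chi alpha) s ^+ 2 *: (X *m s).
Proof.
move=> [f fE fX] [Ss gs].
have d : dform (m := 0) (fun L i (E : ctx n L 0) => forall X s : 'M[L]_n, sa_set i f X ->
    zeros i S s -> (exists q : 'M[L]_n, s = q *m q^T) ->
    s *m X = mxeval i (chi alpha) s ^+ 2 *: (X *m s)).
  definable.
apply: ((transfer i d).2 ((transfer iR d).1 _)) => // Y t; rewrite -fE => rY St gt.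
have [|H' [tE tc]] := @torus_log_coords t; first by split.
by rewrite (root_commutation rY tE tc) mulr2n add_lfunE expRD -(hchi ralpha) -tE -expr2.
Qed.

Lemma root_group_point X X' : VL X -> VL2 X' -> zeros i G (nil_exp (X + X')).
Proof.
move=> [f fE fX] [f2 f2E fX'].
have d : dform (m := 0) (fun L i (E : ctx n L 0) => forall X X' : 'M[L]_n, sa_set i f X ->
    sa_set i f2 X' -> zeros i G (nil_exp (X + X'))).
  definable.
apply: ((transfer i d).2 ((transfer iR d).1 _)) => // Y Y'; rewrite -fE -f2E.
by apply: root_exp_point; apply/eqP; case: ralpha.
Qed.

End RootSpaces.

(** * The building and its standard apartment *)

Section Building.
Variables (F : rcfType) (iF : {rmorphism K -> F}) (O : convexSubring F).
Local Notation PF := (positive_torus S iF).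
Local Notation QF := (map_mx iF Q).
Local Notation Sigma := (restricted_roots g a).
Local Notation GF := (zeros iF G).
Local Notation chiF := (fun beta => mxeval iF (chi beta)).
Local Notation o := (basepoint O Sigma Delta chiF GF PF).
Implicit Types (x y s t : 'M[F]_n).

Let QFQF : QF *m QF^T = 1%:M. Proof. exact: map_orthogonal. Qed.
Let QFTQF : QF^T *m QF = 1%:M. Proof. exact: QTQ. Qed.

Lemma integral_coords x : integral_mx O (QF *m x *m QF^T) <-> integral_mx O x.
Proof.
have QO : integral_mx O QF by apply: integral_mx_orthogonal.
have QTO := integral_mx_tr QO; split=> xO; last exact: integral_mxM3.
have -> : x = QF^T *m (QF *m x *m QF^T) *m QF.
  by rewrite !mulmxA QFTQF mul1mx -mulmxA QFTQF mulmx1.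
exact: integral_mxM3.
Qed.

Lemma positive_torusM s t : PF s -> PF t -> PF (s *m t).
Proof.
move=> /(positive_torusP sS QQ Qdiag)[Ss s0] /(positive_torusP sS QQ Qdiag)[St t0].
split; first exact: zerosM.
rewrite (torus_coordsE QQ Qdiag Ss) (torus_coordsE QQ Qdiag St) -(ptM QFQF).
by apply: pos_gram => j; rewrite mxE mulr_gt0.
Qed.

Lemma positive_torusV s : PF s -> PF (invmx s).
Proof.
move=> [Ss [q sE]]; split; first exact: zerosV.
exists (invmx q)^T; have us : s \in unitmx by apply: zeros_unit Ss.
have uq : q \in unitmx by move: us; rewrite sE unitmx_mul => /andP[].
rewrite -[RHS](mulKmx us) -[LHS]mulmx1; congr (_ *m _); apply: esym.
by rewrite trmxK sE !mulmxA -(mulmxA q) -trmx_mul mulVmx // trmx1 mulmx1 mulmxV.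
Qed.

Lemma torus_point s : PF s -> GF s.
Proof. by case=> /torus_sub. Qed.

Lemma chiV s beta : Sigma beta -> PF s -> mxeval iF (chi beta) (invmx s) = (mxeval iF (chi beta) s)^-1.
Proof.
move=> rb Ps; have [Ss _] := Ps; have us := zeros_unit aS Ss.
have c0 := lt0r_neq0 (chi_gt0 rb Ps).
have P1 : PF 1%:M by apply: positive_torus1.
have c10 := lt0r_neq0 (chi_gt0 rb P1).
have c1 : mxeval iF (chi beta) 1%:M = 1.
  by apply: (mulfI c10); rewrite -chiM ?mulmx1 ?mulr1 //; case: P1.
apply: (mulfI c0); rewrite -chiM ?mulmxV ?mulfV //.
by case: (positive_torusV Ps).
Qed.

(* A product of numbers >= 1 is integral iff all its factors are. *)
Lemma torus_integral s : Delta != [::] -> PF s ->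
  integral_mx O s <-> negv O (mult_norm Sigma chiF s) = Fin 0.
Proof.
move=> D0 Ps; pose m beta : F := Num.max (mxeval iF (chi beta) s) (mxeval iF (chi beta) s)^-1.
have [l lS NE] : exists2 l : seq (dual_space a), (forall beta, beta \in l <-> Sigma beta) &
    mult_norm Sigma chiF s = \prod_(beta <- l) m beta.
  exists (finmap.enum_fset (fset_set Sigma)) => [beta|].
    have e := in_fset_set finite_roots beta.
    by split=> [h|/mem_set h]; [apply/set_mem; rewrite -e|rewrite -e in h].
  by rewrite /mult_norm fsbig_finite //; apply: finite_roots.
set N := mult_norm _ _ _ in NE *.
have rS beta : beta \in l -> Sigma beta by move/lS.
have m1 beta : Sigma beta -> 1 <= m beta.
  move=> rb; rewrite le_max; have [//|c1] := leP 1 (mxeval iF (chi beta) s).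
  by rewrite invf_ge1 ?(ltW c1) ?orbT // (chi_gt0 rb Ps).
have prod1 (r : seq (dual_space a)) : {subset r <= l} -> 1 <= \prod_(beta <- r) m beta.
  move=> rr; rewrite big_seq; elim/big_ind: _ => // [x y|beta /rr/rS/m1 //].
  by move=> x1 y1; rewrite -[1]mulr1 ler_pM.
have N1 : 1 <= N by rewrite NE; apply: prod1.
have N0 : N != 0 by rewrite gt_eqF // (lt_le_trans ltr01).
have mN beta : Sigma beta -> m beta <= N.
  move=> rb; have br : beta \in l by apply/lS.
  rewrite NE (big_rem beta) //= ler_peMr //; first by apply: le_trans (m1 _ rb).
  by apply: prod1 => b /mem_rem.
rewrite -negv1; apply: iff_trans (iff_sym (negv_eq O N0 (oner_neq0 F))).
rewrite divr1 div1r; split=> [sO|[NO _]].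
  have N'O : N \in csub O.
    rewrite NE big_seq; apply: csub_prod => beta /rS rb; rewrite /m.
    case: leP => _; last by apply: integral_mxeval iR iF _ _ _.
    rewrite -chiV //; apply: (integral_mxeval iR iF); apply: integral_mx_inv => //.
    exact: (zeros_det aS (proj1 Ps)).
  split=> //; apply: (csub_norm (csub1 O)).
  by rewrite normr1 normfV ger0_norm ?invf_le1 ?(le_trans ler01) // (lt_le_trans ltr01).
(* The bound is used with [B = N], which dominates [chi beta] at [s] and its inverse for all [beta]
   in [Delta]. *)
have [C HC] := torus_bound_ext iF D0.
have sE := torus_coordsE QQ Qdiag (proj1 Ps).
have [_ s0] := (positive_torusP sS QQ Qdiag iF s).1 Ps.
apply/integral_coords; rewrite sE pt_conj // => j k; rewrite mxE.
case: eqP => _; last by rewrite mulr0n csub0.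
rewrite mulr1n; apply: (csub_gt0 (s0 j)) (csubX C NO).
apply: HC => // beta bD; have rb : Sigma beta by have [_ + _] := hDelta; apply.
have := mN _ rb; rewrite ge_max => /andP[cN cN']; split=> //.
by rewrite -ler_pdivrMr ?(chi_gt0 rb Ps) // div1r.
Qed.

Lemma cartan_integral x k s k' : k *m k^T = 1%:M -> k' *m k'^T = 1%:M -> x = k *m s *m k' ->
  integral_mx O x <-> integral_mx O s.
Proof.
move=> kk kk' xE; have kO := integral_mx_orthogonal O kk; have k'O := integral_mx_orthogonal O kk'.
split=> [xO|sO]; last by rewrite xE; apply: integral_mxM3.
have -> : s = k^T *m x *m k'^T.
  by rewrite xE !mulmxA (mulmx1C kk) mul1mx -mulmxA kk' mulmx1.
by apply: integral_mxM3 => //; apply: integral_mx_tr.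
Qed.

Lemma integral_gram x : integral_mx O (x *m x^T) <-> integral_mx O x.
Proof.
split; first exact: integral_mx_gram.
by move=> xO; apply: integral_mxM => //; apply: integral_mx_tr.
Qed.

Hypothesis D0 : Delta != [::].

(** For [y = h h^T], integrality of [y] is that of [h], and this is that of the torus part, the
    other factors being orthogonal. Among them is [g1], because it represents the base point and so
    [g1 g1^T = 1]. *)
Lemma basepointP y : o y <-> XF GF y /\ integral_mx O y.
Proof.
suff key x : GF x -> y = x *m x^T ->
    pdist O Sigma Delta chiF GF PF 1%:M y = Fin 0 <-> integral_mx O y.
  split=> -[[x Gx xE] yO]; (split; first by exists x); apply/(key x) => //;
  by rewrite -xE /mx_act mulmx1.
move=> Gx yE; rewrite /pdist /cartan_proj.
set A := [set t | _]; have : A (xget 1%:M A).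
  apply: xgetPex; have [k [k' [s [[Gk kk] [Gk' kk'] Ps s1 xE]]]] := cartan_decomposition Gx.
  exists s; split=> //; exists 1%:M, x, k, k'; split.
    split=> //; first exact: zeros1.
      by split=> //; apply: (zeros_det aG Gk).
    by split=> //; apply: (zeros_det aG Gk').
  by split; rewrite /mx_act ?mulmx1 ?trmx1 ?mulmx1 ?invmx1 ?mul1mx.
move: (xget _ _) => t [[Pt _] [g1 [h [k [k' [[Gg1 Gh [_ kk _] [_ kk' _]] [e1 yh hE]]]]]]].
rewrite -torus_integral // yh /mx_act mulmx1.
apply: iff_sym; apply: iff_trans (integral_gram h) _.
have ug := zeros_unit aG Gg1.
apply: (@cartan_integral _ (g1 *m k) _ k') => //; last by rewrite -!mulmxA (mulmxA k) -hE mulKVmx.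
rewrite trmx_mul mulmxA -(mulmxA g1) kk mulmx1; move: e1.
by rewrite /mx_act mulmx1 => ->.
Qed.

Lemma bactM x y p : bact x (bact y p) = bact (x *m y) p.
Proof.
rewrite /bact image_comp; apply: eq_imagel => z _ /=.
by rewrite /mx_act trmx_mul !mulmxA.
Qed.

Lemma bact_integral x : GF x -> integral_mx O x -> bact x o `<=` o.
Proof.
move=> Gx xO _ [y /basepointP[[z Gz zE] yO] <-]; apply/basepointP; split.
  exists (x *m z); first exact: zerosM.
  by rewrite -zE /mx_act !mulmx1 trmx_mul !mulmxA.
by apply: integral_mxM3 => //; apply: integral_mx_tr.
Qed.

(** The point [y y^T] of [bact y o], moved back by [x], is the Gram matrix of [x^-1 y]. Conversely
    an integral element of determinant 1 and its inverse both map [o] into itself. *)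
Lemma bact_basepoint x y : GF x -> GF y ->
  bact x o = bact y o <-> integral_mx O (invmx x *m y).
Proof.
move=> Gx Gy; have ux := zeros_unit aG Gx; have uy := zeros_unit aG Gy.
have Gm : GF (invmx x *m y) by apply: zerosM => //; apply: zerosV.
split=> [xy|mO].
  have o1 : o 1%:M.
    apply/basepointP; split; last exact: integral_mx1.
    by exists 1%:M; rewrite /mx_act ?trmx1 ?mulmx1 //; apply: zeros1.
  have : bact y o (mx_act y 1%:M) by exists 1%:M.
  rewrite -xy => -[z /basepointP[_ zO] zE]; apply/integral_gram.
  suff -> : invmx x *m y *m (invmx x *m y)^T = z by [].
  have <- : invmx x *m mx_act x z *m (invmx x)^T = z.
    by rewrite /mx_act !mulmxA mulVmx // mul1mx -mulmxA -trmx_mul mulVmx // trmx1 mulmx1.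
  by rewrite zE /mx_act mulmx1 trmx_mul !mulmxA.
have iO : integral_mx O (invmx (invmx x *m y)).
  by apply: integral_mx_inv => //; apply: (zeros_det aG Gm).
have mo : bact (invmx x *m y) o = o.
  apply/seteqP; split; first exact: bact_integral.
  have := image_subset (mx_act (invmx x *m y)) (bact_integral (zerosV aG Gm) iO).
  rewrite -/(bact _ _) bactM mulmxV ?(zeros_unit aG Gm) //.
  suff -> : bact 1%:M o = o by [].
  apply/seteqP; split=> z; first by case=> z' oz' <-; rewrite /mx_act trmx1 mulmx1 mul1mx.
  by move=> oz; exists z; rewrite // /mx_act trmx1 mulmx1 mul1mx.
by rewrite -{1}mo bactM mulKVmx.
Qed.

Variable alpha : dual_space a.
Hypothesis ralpha : Sigma alpha.
Local Notation V := (sa_extension iR iF (root_space g alpha)).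
Local Notation V2 := (sa_extension iR iF (root_space g (alpha *+ 2))).
Section RootElement.
Variables X X' : 'M[F]_n.
Hypotheses (VX : V X) (V2X' : V2 X').
Let u := nil_exp (X + X').

Lemma nil_exp_conj (L : rcfType) (P P' M : 'M[L]_n) : P *m P' = 1%:M ->
  nil_exp (P *m M *m P') = P *m nil_exp M *m P'.
Proof.
move=> PP'; have P'P := mulmx1C PP'.
have pw k : (P *m M *m P') ^+ k = P *m M ^+ k *m P'.
  elim: k => [|k IH]; first by rewrite !expr0 mulmx1.
  have mE (A B : 'M[L]_n) : A * B = A *m B by [].
  by rewrite !exprS IH !mE !mulmxA -(mulmxA _ P' P) P'P mulmx1.
rewrite /nil_exp mulmx_sumr mulmx_suml; apply: eq_bigr => k _.
by rewrite pw -scalemxAr -scalemxAl.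
Qed.

Lemma translate_exp x : PF x -> let c := mxeval iF (chi alpha) x in
  invmx x *m u *m x = nil_exp (c^-1 *: X + c ^- 2 *: X').
Proof.
move=> Px c; have ux := zeros_unit aS (proj1 Px).
have c0 : c != 0 := lt0r_neq0 (chi_gt0 ralpha Px).
rewrite -nil_exp_conj ?mulVmx // mulmxDr mulmxDl; congr (nil_exp (_ + _)).
  have e : X *m x = c^-1 *: (x *m X).
    by rewrite (root_space_commutation ralpha VX Px) scalerA mulVf // scale1r.
  by rewrite -mulmxA e -scalemxAr mulKmx.
have e : X' *m x = c ^- 2 *: (x *m X').
  by rewrite (root_space2_commutation ralpha V2X' Px) scalerA mulVf ?expf_neq0 // scale1r.
by rewrite -mulmxA e -scalemxAr mulKmx.
Qed.

Let graded (b b' : F) : exists w : 'I_n -> R,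
  homogeneous w 1 (b *: (QF *m X *m QF^T)) /\ homogeneous w 2 (b' *: (QF *m X' *m QF^T)).
Proof.
have [H aH] : exists H : subvs_of a, (alpha H : R) = 1.
  by apply: root_coroot; apply/eqP; case: ralpha.
exists (weights H); split; apply: homogeneousZ.
  exact: root_space_homogeneous VX aH.
by apply: root_space_homogeneous V2X' _; rewrite mulr2n add_lfunE aH.
Qed.

Let exp_coords (b b' : F) : QF *m nil_exp (b *: X + b' *: X') *m QF^T =
  nil_exp (b *: (QF *m X *m QF^T) + b' *: (QF *m X' *m QF^T)).
Proof.
rewrite -nil_exp_conj // mulmxDr mulmxDl; congr (nil_exp (_ + _));
  by rewrite -scalemxAr -scalemxAl.
Qed.

Lemma translate_integral x : PF x -> integral_mx O (invmx x *m u *m x) <->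
  (Order.max (negv_mx O X) (whalf (negv_mx O X')) <= negv O (mxeval iF (chi alpha) x))%O.
Proof.
move=> Px; rewrite translate_exp //; set c := mxeval iF (chi alpha) x.
have c0 : c != 0 := lt0r_neq0 (chi_gt0 ralpha Px).
have [w [w1 w2]] := graded c^-1 (c ^- 2).
apply: iff_trans (iff_sym (integral_coords _)) _; rewrite exp_coords.
apply: iff_trans (graded_exp_integral w1 w2 O) _.
refine (iff_trans _ (iff_sym (root_group_val_le O X X' c0))).
have cE (b : F) Y : integral_mx O (b *: (QF *m Y *m QF^T)) <-> integral_mx O (b *: Y).
  by rewrite scalemxAl scalemxAr; apply: integral_coords.
by split=> -[/cE h1 /cE h2].
Qed.

Lemma translate_diag x j : PF x -> (QF *m (invmx x *m u *m x) *m QF^T) j j = 1.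
Proof.
move=> Px; rewrite translate_exp // exp_coords.
set c := mxeval iF (chi alpha) x; have [w [w1 w2]] := graded c^-1 (c ^- 2).
exact: graded_exp_diag w1 w2 j.
Qed.

Lemma apartment_meets x : PF x ->
  (exists2 b, PF b & bact u (bact x o) = bact b o) <-> integral_mx O (invmx x *m u *m x).
Proof.
move=> Px; have Gu : GF u by apply: root_group_point VX V2X'.
have Gx := torus_point Px; have ux := zeros_unit aG Gx.
have Gux : GF (u *m x) by apply: zerosM.
split=> [[b Pb]|vO]; last first.
  exists x => //; rewrite bactM; apply/esym/bact_basepoint => //.
  by rewrite mulmxA.
rewrite bactM => /esym/(bact_basepoint (torus_point Pb) Gux) bO.
set v := invmx x *m u *m x; pose t := invmx b *m x.
have Pt : PF t by apply: positive_torusM => //; apply: positive_torusV.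
have tv : t *m v = invmx b *m (u *m x) by rewrite /t /v !mulmxA mulmxK // !mulmxA.
have tE := torus_coordsE QQ Qdiag (proj1 Pt).
have tO : integral_mx O t.
  apply/integral_coords; rewrite tE pt_conj // => j k; rewrite mxE.
  case: eqP => _; last by rewrite mulr0n csub0.
  have /integral_coords/(_ j j) := bO; rewrite mulr1n -tv.
  have -> : QF *m (t *m v) *m QF^T = diag_mx (torus_coords Q iF t) *m (QF *m v *m QF^T).
    by rewrite -(pt_conj QFQF) -tE !mulmxA -(mulmxA _ QF^T QF) QFTQF mulmx1.
  by rewrite mul_diag_mx [X in X \in _]mxE translate_diag // mulr1.
have ut := zeros_unit aS (proj1 Pt).
rewrite -[v](mulKmx ut) tv; apply: integral_mxM => //.
by apply: integral_mx_inv => //; apply: (zeros_det aS (proj1 Pt)).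
Qed.

End RootElement.

Local Notation AA := (apartment O Sigma Delta chiF GF PF).
Local Notation phi := (root_group_val O V V2).

(** The pair is the one that [xget] picks inside [root_group_val], so the element and its value
    refer to the same [X] and [X']. *)
Lemma root_group_valE v : root_group V V2 v -> exists X X',
  [/\ V X, V2 X', v = nil_exp (X + X') & phi v = Order.max (negv_mx O X) (whalf (negv_mx O X'))].
Proof.
move=> [X [X' [VX V2X' vE]]]; rewrite /root_group_val; set A := [set XX' | _].
have : A (xget (0, 0) A) by apply: xgetPex; exists (X, X').
by case: (xget _ _) => Y Y' [VY V2Y' vE']; exists Y, Y'.
Qed.

Lemma root_group_fixed v : root_group V V2 v ->
  [set p | AA p /\ AA (bact v p)] =
  [set bact x o | x in [set x | PF x /\ (phi v <= negv O (mxeval iF (chi alpha) x))%O]].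
Proof.
move=> /root_group_valE[X [X' [VX V2X' -> phiE]]].
apply/seteqP; split=> [_ [[x Px <-] [b Pb bE]]|_ [x [Px xphi] <-]].
  exists x => //; split=> //; rewrite phiE; apply/(translate_integral VX V2X' Px).
  by apply/(apartment_meets VX V2X' Px); exists b.
split; first by exists x.
have [|b Pb bE] := (apartment_meets VX V2X' Px).2; last by exists b.
by apply/(translate_integral VX V2X' Px); rewrite -phiE.
Qed.

(** The value [-oo] would keep all multiples of the entries of [X] and [X'] in [O]; as [O] is
    proper, these entries would be 0. *)
Lemma root_group_val_finite v : root_group V V2 v -> v <> 1%:M -> exists l, phi v = Fin l.
Proof.
move=> /root_group_valE[X [X' [VX V2X' vE phiE]]] v1.
case phiN : (phi v) => [l|]; first by exists l.
case: v1; have XX0 c : c != 0 -> integral_mx O (c^-1 *: X) /\ integral_mx O (c ^- 2 *: X').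
  by move=> c0; apply/(root_group_val_le O X X' c0); rewrite -phiE phiN; apply: le0x.
have [z zO] := csub_proper O.
have z0 : z != 0 by apply: contraNneq zO => ->; apply: csub0.
(* For nonzero [y], the choice [c = y / z] returns [z], which is outside [O]. *)
have scale0 (y : F) : (forall c, c != 0 -> y / c \in csub O) -> y = 0.
  move=> yO; apply/eqP; apply: contraNT zO => y0.
  by have := yO (y / z); rewrite mulf_neq0 ?invr_neq0 // invfM invrK mulrA divff // mul1r; apply.
have X0 : X = 0.
  apply/matrixP => j k; rewrite [RHS]mxE; apply: scale0 => c c0.
  by have [/(_ j k)] := XX0 c c0; rewrite mxE mulrC.
have X'0 : X' = 0.
  apply/matrixP => j k; rewrite [RHS]mxE; apply: scale0 => c c0.
  (* [X'] is divided by squares only, so the scalar used is the square root of [|c|]. *)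
  have sc : Num.sqrt `|c| != 0 by rewrite sqrtr_eq0 -ltNge normr_gt0.
  have [_ /(_ j k)] := XX0 _ sc; rewrite mxE sqr_sqrtr // mulrC => h.
  by apply: (csub_norm h); rewrite !normrM !normfV normr_id.
by rewrite vE X0 X'0 addr0 nil_exp0.
Qed.

(** The translation is by a torus element at which the character is positive with value [l]; it
    exists because the character maps onto the positive elements of [F]. *)
Lemma wall_parallel l : parallel PF (wall O Sigma Delta chiF GF PF alpha l)
  (wall O Sigma Delta chiF GF PF alpha 0).
Proof.
have [y yE] := negv_surj (Fin l).
have y0 : `|y| != 0.
  by rewrite normr_eq0; apply: contra_eq_neq yE => ->; rewrite negv0.
have [s Ps sy] : exists2 s, PF s & mxeval iF (chi alpha) s = `|y|.
  by apply: chi_surj => //; rewrite lt_neqAle eq_sym y0 normr_ge0.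
have {}yE : negv O `|y| = Fin l by rewrite negv_norm.
exists s => //; apply/seteqP; split=> [_ [x [Px xl] <-]|_ [_ [x [Px xl] <-] <-]].
  have cx := lt0r_neq0 (chi_gt0 ralpha Px).
  have Psx : PF (invmx s *m x) by apply: positive_torusM => //; apply: positive_torusV.
  exists (bact (invmx s *m x) o); last first.
    by rewrite bactM mulKVmx //; apply: (zeros_unit aS (proj1 Ps)).
  exists (invmx s *m x) => //; split=> //.
  rewrite /= chiM //; try by [case: Px|case: (positive_torusV Ps)].
  rewrite chiV // sy -negv1; move: xl; rewrite /= -yE => /(negv_eq O cx y0)[h1 h2].
  apply/negv_eq; rewrite ?mulf_neq0 ?invr_neq0 ?oner_eq0 // divr1 div1r invfM invrK.
  by rewrite mulrC.
have cx := lt0r_neq0 (chi_gt0 ralpha Px).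
rewrite bactM; exists (s *m x) => //; split; first exact: positive_torusM.
rewrite /= chiM //; try by [case: Px|case: Ps].
rewrite sy -yE; move: xl; rewrite /= -negv1 => /(negv_eq O cx (oner_neq0 F)).
rewrite divr1 div1r => -[h1 h2]; apply/negv_eq; rewrite ?mulf_neq0 //.
by rewrite mulrAC divff // mul1r invfM mulrA divff // mul1r.
Qed.

End Building.

End LieAlgebra.

Theorem proposition5p8
  (K : rcfType) (R : realType) (F : rcfType)
  (iR : {rmorphism K -> R}) (iF : {rmorphism K -> F})
  (O : convexSubring F) (n : nat)
  (G S : set (mxpol n K))
  (hG : connected_semisimple G) (hGT : self_adjoint G)
  (hS : maximal_split_torus G S)
  (hST : forall s, geom_points S s -> s^T = s)
  (g a : {vspace 'M[R]_n})
  (hg : is_Lie_algebra_of g (zeros iR G))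
  (ha : is_Lie_algebra_of a (torus_component_ext S iR))
  (chi : dual_space a -> mxpol n K)
  (hchi : forall alpha, restricted_roots g a alpha -> alg_character S (chi alpha) /\
     forall H : subvs_of a,
       mxeval iR (chi alpha) (mx_exp (vsval H)) = expR (alpha H))
  (Delta : seq (dual_space a)) (hDelta : root_basis g Delta)
  (alpha : dual_space a) (halpha : restricted_roots g a alpha) :
  let Sigma := restricted_roots g a in
  let GF := zeros iF G in
  let AF := torus_component_ext S iF in
  let chiF := fun beta => mxeval iF (chi beta) in
  let V := sa_extension iR iF (root_space g alpha) in
  let V2 := sa_extension iR iF (root_space g (alpha *+ 2)) in
  let phi := root_group_val O V V2 in
  let o := basepoint O Sigma Delta chiF GF AF in
  let AA := apartment O Sigma Delta chiF GF AF in
  forall u : 'M[F]_n, root_group V V2 u ->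
    let D := [set p | AA p /\ AA (bact u p)] in
    D = [set bact x o | x in [set x | AF x /\ phi u <= negv O (chiF alpha x)]] /\
    (u <> 1%:M ->
     exists2 M, is_half_apartment_with_wall O Sigma Delta chiF GF AF D M &
       parallel AF M (wall O Sigma Delta chiF GF AF alpha 0)).
Proof.
have [sS _ _] := hS; have [aG _ _] := hG.
have [Q QQ Qdiag] := torus_orthogonal_coordinates sS hST.
have hchi1 beta : restricted_roots g a beta -> forall H : subvs_of a,
  mxeval iR (chi beta) (mx_exp (vsval H)) = expR (beta H) by move=> /hchi[].
have hchiA beta : restricted_roots g a beta -> alg_character S (chi beta) by move=> /hchi[].
(* Without simple roots, [alpha] would be an empty sum, hence 0. *)
have D0 : Delta != nil.
  apply/eqP => De; have := hDelta; rewrite De => -[_ _ /(_ alpha halpha)[c]].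
  by rewrite big_ord0 oppr0; case: halpha => + _ [].
rewrite (torus_component_extE sS QQ Qdiag iR iF) => Sigma GF AF chiF V V2 phi o AA u ru D.
have DE := root_group_fixed aG hGT hS hST hg ha QQ Qdiag hDelta hchi1 hchiA O D0 halpha ru.
split=> [|u1]; first exact: DE.
have [l phil] := root_group_val_finite O ru u1.
exists (wall O Sigma Delta chiF GF AF alpha l).
  by exists alpha, l; split=> //; rewrite /D DE phil.
exact: (wall_parallel hS ha QQ Qdiag).
Qed.
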